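(* Let $\omega_{\rm o}>0$, $c_0,c_1>0$, $0<z_{\rm int}<z_{\rm obs}$, $s_j=1/c_j$, and $\Delta k=\omega_{\rm o}|s_0-s_1|$. Let $V$ be a random field on $\mathbb{R}^2$ that is mean-zero, stationary, isotropic, bounded, rapidly mixing, and smooth with bounded second-order derivatives, and let $\Psi:\mathbb{R}^2\to\mathbb{C}$ be smooth and rapidly decaying. Let $\mathcal{I}_{\rm mf}$ (depending on $\varepsilon>0$ and $\gamma$), $\phi_V$ and $\kappa$ be as defined in the context. Then for every $\mathbf{y}\in\mathbb{R}^2$: (i) if $\gamma=1/2$, $$\mathrm{Var}\big(\mathcal{I}_{\rm mf}(\mathbf{y})\big)=\int\kappa(\Delta k,\mathbf{k})\left|\Psi\Big(\mathbf{y}+\frac{c_0z_{\rm int}}{\omega_{\rm o}}\mathbf{k}\Big)\right|^2d\mathbf{k}-\big|\phi_V(\Delta k)\Psi(\mathbf{y})\big|^2;$$ (ii) if $\gamma<1/2$, $$\lim_{\varepsilon\to0}\mathrm{Var}\big(\mathcal{I}_{\rm mf}(\mathbf{y})\big)=|\Psi(\mathbf{y})|^2\big(1-|\phi_V(\Delta k)|^2\big);$$ (iii) if $\gamma>1/2$, $$\lim_{\varepsilon\to0}\mathrm{Var}\big(\mathcal{I}_{\rm mf}(\mathbf{y})\big)=0.$$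
   Context: Parameters: $\omega_{\rm o}>0$ (frequency), $c_0,c_1>0$ (wave speeds to the left and right of the interface), $s_j=c_j^{-1}$, $0<z_{\rm int}<z_{\rm obs}$. Integrals are over $\mathbb{R}^2$ for each vector variable. Fourier transform: $\hat f(\mathbf{k})=\int f(\mathbf{x})e^{-i\mathbf{k}\cdot\mathbf{x}}d\mathbf{x}$. ''Smooth and rapidly decaying'' means Schwartz class. For a complex random variable $Z$, $\mathrm{Var}(Z)=\mathbb{E}|Z|^2-|\mathbb{E}Z|^2$. The random field $V:\mathbb{R}^2\to\mathbb{R}$: stationary means its law is translation invariant, isotropic means its law is rotation invariant, rapidly mixing means that its restrictions to two regions become asymptotically independent, rapidly, as the distance between the regions tends to infinity. Characteristic functions: $\phi_V(\tau)=\mathbb{E}[e^{i\tau V(\mathbf{0})}]$ and $\phi_{\Delta V}(\tau,\mathbf{x})=\mathbb{E}[e^{i\tau(V(\mathbf{x}+\mathbf{x}')-V(\mathbf{x}'))}]$ (independent of $\mathbf{x}'$ by stationarity). Scattering kernel: $$\kappa(\tau,\mathbf{k})=\frac{1}{(2\pi)^2}\int e^{-i\mathbf{r}\cdot\mathbf{k}}\phi_{\Delta V}(\tau,\mathbf{r})\,d\mathbf{r},$$ understood in the sense of tempered distributions (it is a finite positive measure in $\mathbf{k}$, and $\int\kappa(\tau,\mathbf{k})f(\mathbf{k})d\mathbf{k}$ denotes integration against it). Paraxial propagators: $\hat G_j(\omega,\mathbf{k},z)=\exp\left(-i\frac{z c_j|\mathbf{k}|^2}{2\omega}\right)$, $j=0,1$.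 Scattering operator (kernel understood in the sense of distributions): $$\mathfrak{K}^\varepsilon(\tau,\mathbf{k},\mathbf{k}')=\frac{1}{(2\pi)^2}\int e^{i(\mathbf{k}'-\mathbf{k})\cdot\mathbf{x}}e^{i\tau V(\mathbf{x}/\varepsilon^{\gamma-1/2})}d\mathbf{x},$$ so that $\int\mathfrak{K}^\varepsilon(\tau,\mathbf{k},\mathbf{k}')\hat f(\mathbf{k}')d\mathbf{k}'$ is the Fourier transform of $\mathbf{x}\mapsto e^{i\tau V(\mathbf{x}/\varepsilon^{\gamma-1/2})}f(\mathbf{x})$. Observed field: $$U^\varepsilon_{\rm obs}(\mathbf{x})=\frac{1}{(2\pi)^2}\iint e^{i\mathbf{k}\cdot\mathbf{x}}\,\mathfrak{K}^\varepsilon\big(\omega_{\rm o}(s_0-s_1),\mathbf{k},\mathbf{k}'\big)\hat G_1(\omega_{\rm o},\mathbf{k},z_{\rm obs}-z_{\rm int})\hat G_0(\omega_{\rm o},\mathbf{k}',z_{\rm int})\hat\Psi(\mathbf{k}')\,d\mathbf{k}'d\mathbf{k}.$$ Matched field template (oscillatory integral): $$U_{\rm mf}(\mathbf{x};\mathbf{y})=\frac{1}{(2\pi)^2}\int\hat G_1(\omega_{\rm o},\mathbf{k},z_{\rm obs}-z_{\rm int})\hat G_0(\omega_{\rm o},\mathbf{k},z_{\rm int})e^{i\mathbf{k}\cdot(\mathbf{x}-\mathbf{y})}d\mathbf{k}.$$ Imaging functional: $\mathcal{I}_{\rm mf}(\mathbf{y})=\int U^\varepsilon_{\rm obs}(\mathbf{x})\overline{U_{\rm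 mf}(\mathbf{x};\mathbf{y})}\,d\mathbf{x}$. *)

(* Defs.v *)
From HB Require Import structures.
From mathcomp Require Import all_boot all_order all_algebra.
From mathcomp Require Import complex.
From mathcomp Require Import all_classical all_reals all_analysis.

Set Implicit Arguments.
Unset Strict Implicit.
Unset Printing Implicit Defensive.

Import Order.TTheory GRing.Theory Num.Theory.
Import numFieldNormedType.Exports.

Local Open Scope classical_set_scope.
Local Open Scope ring_scope.
Local Open Scope complex_scope.

(* The library norm of R * R is the sup norm, hence the explicit Euclidean
   structure. *)
Definition dot (R : realType) (x y : R * R) : R := x.1 * y.1 + x.2 * y.2.

Definition enorm (R : realType) (x : R * R) : R := Num.sqrt (dot x x).

Definition rotate (R : realType) (theta : R) (x : R * R) : R * R :=
  (cos theta * x.1 - sin theta * x.2, sin theta * x.1 + cos theta * x.2).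

(* R^2 as a measurable space, R carrying the sigma-algebra on which the library
   builds lebesgue_measure. *)
Definition plane (R : realType) :=
  (measurableTypeR R * measurableTypeR R)%type.

Definition leb2 (R : realType) : {measure set (plane R) -> \bar R} :=
  (@lebesgue_measure R \x @lebesgue_measure R)%E.
Arguments leb2 R : clear implicits.

Definition expi (R : realType) (t : R) : R[i] := cos t +i* sin t.

Definition modulus (R : realType) (z : R[i]) : R := Normc.normc z.

Definition cintegral (d : measure_display) (T : measurableType d)
    (R : realType) (mu : {measure set T -> \bar R}) (f : T -> R[i]) : R[i] :=
  Rintegral mu setT (fun x => complex.Re (f x))
  +i* Rintegral mu setT (fun x => complex.Im (f x)).

Definition cvariance (d : measure_display) (T : measurableType d)
    (R : realType) (P : probability T R) (Z : T -> R[i]) : R :=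
  Rintegral P setT (fun w => modulus (Z w) ^+ 2)
  - modulus (cintegral P Z) ^+ 2.

Definition coord_dir (R : realType) (i : 'I_2) : R * R :=
  if i == ord0 then (1, 0) else (0, 1).

Definition partial (R : realType) (i : 'I_2) (f : R * R -> R) : R * R -> R :=
  fun x => 'D_(coord_dir R i) f x.

Definition iter_partial (R : realType) (s : seq 'I_2) (f : R * R -> R) :
    R * R -> R :=
  foldr (@partial R) f s.

Definition smooth (R : realType) (f : R * R -> R) : Prop :=
  forall s : seq 'I_2,
    continuous (iter_partial s f) /\
    forall (i : 'I_2) (x : R * R),
      derivable (iter_partial s f) x (coord_dir R i).

Definition rapidly_decaying (R : realType) (f : R * R -> R) : Prop :=
  forall (N : nat) (s : seq 'I_2), exists C : R,
    forall x : R * R, enorm x ^+ N * `|iter_partial s f x| <= C.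

Definition schwartz (R : realType) (f : R * R -> R[i]) : Prop :=
  let re := fun x => complex.Re (f x) in
  let im := fun x => complex.Im (f x) in
  [/\ smooth re, smooth im, rapidly_decaying re & rapidly_decaying im].

Definition fourier (R : realType) (f : R * R -> R[i]) (k : R * R) : R[i] :=
  cintegral (leb2 R) (fun x => expi (- dot k x) * f x).

Definition inv_fourier (R : realType) (g : R * R -> R[i]) (x : R * R) : R[i] :=
  (((2 * pi) ^- 2 : R)%:C)
  * cintegral (leb2 R) (fun k => expi (dot k x) * g k).

(* Oscillatory integrals: the common limit, as delta tends to 0+, of the
   integrals damped by chi (delta *: k), over all Schwartz cutoffs chi with
   chi 0 = 1. *)
Definition is_oscillatory_integral (R : realType) (f : R * R -> R[i])
    (l : R[i]) : Prop :=
  forall chi : R * R -> R[i], schwartz chi -> chi 0 = 1 ->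
    modulus (cintegral (leb2 R) (fun k => chi (delta *: k) * f k) - l)
      @[delta --> 0^'+] --> (0 : R).

Definition oscillatory_integral (R : realType) (f : R * R -> R[i]) : R[i] :=
  xget 0 [set l | is_oscillatory_integral f l].

(* The law of a random field is the measure induced on the space of functions
   R^2 -> R equipped with the sigma-algebra generated by the evaluations. *)
Definition field_measurable (R : realType) : set (set (R * R -> R)) :=
  <<s [set E | exists (x : R * R) (B : set R),
         measurable B /\ E = [set f | B (f x)]] >>.

Definition same_law (d : measure_display) (T : measurableType d)
    (R : realType) (P : probability T R) (X Y : R * R -> T -> R) : Prop :=
  forall E : set (R * R -> R), @field_measurable R E ->
    P [set w | E (fun x => X x w)] = P [set w | E (fun x => Y x w)].

Definition mean_zero (d : measure_display) (T : measurableType d)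
    (R : realType) (P : probability T R) (V : R * R -> {RV P >-> R}) : Prop :=
  forall x : R * R, ('E_P[V x] = 0)%E.

Definition stationary (d : measure_display) (T : measurableType d)
    (R : realType) (P : probability T R) (V : R * R -> {RV P >-> R}) : Prop :=
  forall h : R * R, same_law P (fun x => V (x + h)) V.

Definition isotropic (d : measure_display) (T : measurableType d)
    (R : realType) (P : probability T R) (V : R * R -> {RV P >-> R}) : Prop :=
  forall theta : R, same_law P (fun x => V (rotate theta x)) V.

Definition bounded_field (d : measure_display) (T : measurableType d)
    (R : realType) (P : probability T R) (V : R * R -> {RV P >-> R}) : Prop :=
  exists M : R, forall (x : R * R) (w : T), `|V x w| <= M.

Definition smooth_field (d : measure_display) (T : measurableType d)
    (R : realType) (P : probability T R) (V : R * R -> {RV P >-> R}) : Prop :=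
  forall w : T, smooth (fun x => V x w).

Definition bounded_second_derivatives (d : measure_display)
    (T : measurableType d) (R : realType) (P : probability T R)
    (V : R * R -> {RV P >-> R}) : Prop :=
  exists M : R, forall (i j : 'I_2) (x : R * R) (w : T),
    `|iter_partial [:: i; j] (fun x' => V x' w) x| <= M.

Definition field_events (d : measure_display) (T : measurableType d)
    (R : realType) (P : probability T R) (V : R * R -> {RV P >-> R})
    (A : set (R * R)) : set (set T) :=
  <<s [set E | exists (x : R * R) (B : set R),
         [/\ A x, measurable B & E = V x @^-1` B]] >>.

(* Strong (alpha-) mixing coefficient at distance r. *)
Definition mixing_coef (d : measure_display) (T : measurableType d)
    (R : realType) (P : probability T R) (V : R * R -> {RV P >-> R})
    (r : R) : R :=
  sup [set a | exists (A B : set (R * R)) (E F : set T),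
        [/\ forall x y, A x -> B y -> r <= enorm (x - y),
            field_events V A E, field_events V B F &
            a = `|fine (P (E `&` F)) - fine (P E) * fine (P F)|]].

(* "Rapidly" means faster than any power of the distance. *)
Definition rapidly_mixing (d : measure_display) (T : measurableType d)
    (R : realType) (P : probability T R) (V : R * R -> {RV P >-> R}) : Prop :=
  forall N : nat, exists C : R,
    forall r : R, 0 < r -> r ^+ N * mixing_coef V r <= C.

Definition phi_V (d : measure_display) (T : measurableType d)
    (R : realType) (P : probability T R) (V : R * R -> {RV P >-> R})
    (tau : R) : R[i] :=
  cintegral P (fun w => expi (tau * V 0 w)).

(* Based at x' = 0; by stationarity the base point is irrelevant. *)
Definition phi_DeltaV (d : measure_display) (T : measurableType d)
    (R : realType) (P : probability T R) (V : R * R -> {RV P >-> R})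
    (tau : R) (x : R * R) : R[i] :=
  cintegral P (fun w => expi (tau * (V x w - V 0 w))).

(* The tempered distribution kappa (tau, .) = (2 pi)^-2 times the Fourier
   transform of phi_DeltaV (tau, .), through its action on test functions:
   the Fourier transform is moved onto the test function. *)
Definition kappa (d : measure_display) (T : measurableType d)
    (R : realType) (P : probability T R) (V : R * R -> {RV P >-> R})
    (tau : R) (f : R * R -> R[i]) : R[i] :=
  (((2 * pi) ^- 2 : R)%:C)
  * cintegral (leb2 R) (fun r => phi_DeltaV V tau r * fourier f r).

Definition represented_by (R : realType)
    (u : (R * R -> R[i]) -> R[i])
    (mu : {finite_measure set (plane R) -> \bar R}) : Prop :=
  forall f : R * R -> R[i], schwartz f -> u f = cintegral mu f.

Definition propagator (R : realType) (omega c : R) (k : R * R) (z : R) :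
    R[i] :=
  expi (- (z * c * dot k k / (2 * omega))).

Definition scaled_field (d : measure_display) (T : measurableType d)
    (R : realType) (P : probability T R) (V : R * R -> {RV P >-> R})
    (gamma eps : R) (w : T) (x : R * R) : R :=
  V ((eps `^ (gamma - 2^-1))^-1 *: x) w.

(* The operator with the distributional kernel K(tau, k, k') associated with
   the realisation W: it sends the Fourier transform of f to that of
   x |-> e^(i tau W(x)) f(x). *)
Definition scattering_operator (R : realType) (W : R * R -> R) (tau : R)
    (fhat : R * R -> R[i]) (k : R * R) : R[i] :=
  fourier (fun x => expi (tau * W x) * inv_fourier fhat x) k.

Definition U_obs (d : measure_display) (T : measurableType d)
    (R : realType) (P : probability T R) (V : R * R -> {RV P >-> R})
    (omega c0 c1 z_int z_obs : R) (Psi : R * R -> R[i]) (gamma eps : R)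
    (w : T) (x : R * R) : R[i] :=
  inv_fourier (fun k =>
    scattering_operator (scaled_field V gamma eps w)
      (omega * (c0^-1 - c1^-1))
      (fun k' => propagator omega c0 k' z_int * fourier Psi k') k
    * propagator omega c1 k (z_obs - z_int)) x.

Definition U_mf (R : realType) (omega c0 c1 z_int z_obs : R)
    (x y : R * R) : R[i] :=
  (((2 * pi) ^- 2 : R)%:C)
  * oscillatory_integral (fun k =>
      propagator omega c1 k (z_obs - z_int) * propagator omega c0 k z_int
      * expi (dot k (x - y))).

Definition I_mf (d : measure_display) (T : measurableType d)
    (R : realType) (P : probability T R) (V : R * R -> {RV P >-> R})
    (omega c0 c1 z_int z_obs : R) (Psi : R * R -> R[i]) (gamma eps : R)
    (y : R * R) (w : T) : R[i] :=
  cintegral (leb2 R) (fun x =>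
    U_obs V omega c0 c1 z_int z_obs Psi gamma eps w x
    * (U_mf omega c0 c1 z_int z_obs x y)^*).

Definition Delta_k (R : realType) (omega c0 c1 : R) : R :=
  omega * `|c0^-1 - c1^-1|.

(* Main.v *)
(* Propagation through either medium and the matched field template are Fresnel
   multipliers, that is, convolutions with quadratic chirps, and they compose:
   up to a unimodular constant, the imaging functional is (2 pi)^-2 times the
   integral over R^2 of e^(i tau V(s x)) times the Fourier transform of
   Theta(k) = e^(i |y + a k|^2 / (2 a)) Psi(y + a k), where a = c0 z_int / omega
   and s = eps^(1/2 - gamma).  Stationarity and Fourier inversion give the mean
   phi_V Psi(y) up to a phase; Fubini and Parseval give the second moment
   (2 pi)^-2 int phi_DeltaV(s r) F[|Theta|^2](r) dr.  For gamma = 1/2 this is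
   kappa tested against |Theta|^2; otherwise dominated convergence applies, with
   phi_DeltaV(s r) tending to 1 by continuity as s -> 0, and to |phi_V|^2 by
   mixing as s -> oo.
   The delicate point is the absolute convergence of the inverse transform that
   defines the observed field: V has only two bounded derivatives, so the
   transform of h = e^(i tau V) f is not controlled by decay estimates, but
   (1 + i k_0)(1 + i k_1) times it is the transform of an integrable bounded
   function, hence square integrable. *)
Require Import Defs.
From HB Require Import structures.
From mathcomp Require Import all_boot all_order all_algebra.
From mathcomp Require Import complex ring lra.
From mathcomp Require Import all_classical all_reals all_analysis.
From mathcomp Require Import measurable_realfun.

Set Implicit Arguments.
Unset Strict Implicit.
Unset Printing Implicit Defensive.

Import Order.TTheory GRing.Theory Num.Theory.
Import numFieldNormedType.Exports.

Local Open Scope classical_set_scope.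
Local Open Scope ring_scope.
Local Open Scope complex_scope.

(** Everything oscillatory is reached through complex Gaussians. In dimension two the Gaussian of
    parameter [d + i a] has integral [2 pi / (d + i a)], with no square root to choose, and its
    transform is again Gaussian. Letting [d] tend to 0 gives the Fresnel convolution formula when
    [a] is nonzero and Fourier inversion when [a = 0]; a real Gaussian weight gives the square
    integrability behind the delicate point. The factor [(1 + i k_0)(1 + i k_1)] is chosen because,
    on the physical side, it meets only the first derivatives of the phase and its mixed second one.
    Bounded second derivatives let the first ones grow at most linearly, and Schwartz decay absorbs
    that growth. Mixing speaks of events, while [phi_DeltaV] involves cosines and sines of the
    field: step functions on cells of the bounded range of [V] transfer one to the other. The phase
    carries the signed number [omega (s0 - s1)] and the result its absolute value: the variance is
    even in [tau], by conjugation for [|phi_V|], and by stationarity and the rotation of angle [pi]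
    for [phi_DeltaV]. *)

Local Notation Re := complex.Re.
Local Notation Im := complex.Im.

(** * Complex numbers through their real and imaginary parts *)

Section ComplexNumbers.
Context {R : realType}.
Implicit Types (z u v : R[i]) (s t : R).

Lemma ReD u v : Re (u + v) = Re u + Re v. Proof. by case: u; case: v. Qed.
Lemma ImD u v : Im (u + v) = Im u + Im v. Proof. by case: u; case: v. Qed.
Lemma ReN u : Re (- u) = - Re u. Proof. by case: u. Qed.
Lemma ImN u : Im (- u) = - Im u. Proof. by case: u. Qed.
Lemma ReM u v : Re (u * v) = Re u * Re v - Im u * Im v.
Proof. by case: u; case: v. Qed.
Lemma ImM u v : Im (u * v) = Re u * Im v + Im u * Re v.
Proof. by case: u; case: v. Qed.
Lemma ReJ u : Re u^* = Re u. Proof. by case: u. Qed.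
Lemma ImJ u : Im u^* = - Im u. Proof. by case: u. Qed.

Lemma complexP u v : Re u = Re v -> Im u = Im v -> u = v.
Proof. by case: u; case: v => a b c d /= -> ->. Qed.

Lemma modulusE z : modulus z = Num.sqrt (Re z ^+ 2 + Im z ^+ 2).
Proof. by case: z. Qed.

Lemma modulus_ge0 z : 0 <= modulus z.
Proof. by rewrite modulusE sqrtr_ge0. Qed.

Lemma modulusM u v : modulus (u * v) = modulus u * modulus v.
Proof. exact: Normc.normcM. Qed.

Lemma modulusD u v : modulus (u + v) <= modulus u + modulus v.
Proof. exact: le_normcD. Qed.

Lemma modulusV u : modulus u^-1 = (modulus u)^-1.
Proof. exact: Normc.normcV. Qed.

Lemma modulusJ u : modulus u^* = modulus u.
Proof. by rewrite !modulusE ReJ ImJ sqrrN. Qed.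

Lemma modulus0 : modulus (0 : R[i]) = 0. Proof. exact: Normc.normc0. Qed.
Lemma modulus1 : modulus (1 : R[i]) = 1. Proof. exact: Normc.normc1. Qed.

Lemma modulus_eq0 u : modulus u = 0 -> u = 0.
Proof. exact: Normc.eq0_normc. Qed.

Lemma modulus_neq0 u : u != 0 -> modulus u != 0.
Proof. by apply: contra => /eqP/modulus_eq0 ->. Qed.

Lemma modulusR t : modulus t%:C = `|t|.
Proof. by rewrite modulusE/= expr0n addr0 sqrtr_sqr. Qed.

Lemma modulus_sqr z : modulus z ^+ 2 = Re z ^+ 2 + Im z ^+ 2.
Proof. by rewrite modulusE sqr_sqrtr// addr_ge0// sqr_ge0. Qed.

Lemma mulcJ z : z * z^* = (modulus z ^+ 2)%:C.
Proof.
apply: complexP; rewrite ?ReM ?ImM ReJ ImJ ?modulus_sqr/=; ring.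
Qed.

Lemma Re_le_modulus z : `|Re z| <= modulus z.
Proof. by rewrite modulusE -sqrtr_sqr ler_wsqrtr// lerDl sqr_ge0. Qed.

Lemma Im_le_modulus z : `|Im z| <= modulus z.
Proof. by rewrite modulusE -sqrtr_sqr ler_wsqrtr// lerDr sqr_ge0. Qed.

Lemma modulus_leD z : modulus z <= `|Re z| + `|Im z|.
Proof.
rewrite modulusE -(@ler_pXn2r _ 2)// ?nnegrE ?sqrtr_ge0 ?addr_ge0//.
rewrite sqr_sqrtr ?addr_ge0 ?sqr_ge0// -(real_normK (num_real (Re z))).
rewrite -(real_normK (num_real (Im z))) sqrrD lerD2r lerDl.
by rewrite mulrn_wge0// mulr_ge0.
Qed.

Lemma expiD s t : expi (s + t) = expi s * expi t.
Proof.
by apply: complexP; rewrite ?ReM ?ImM/= ?cosD ?sinD//; ring.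
Qed.

Lemma expi0 : expi (0 : R) = 1.
Proof. by rewrite /expi cos0 sin0. Qed.

Lemma expiJ t : (expi t)^* = expi (- t).
Proof. by apply: complexP; rewrite ?ReJ ?ImJ/= ?cosN ?sinN. Qed.

Lemma modulus_expi t : modulus (expi t) = 1.
Proof. by rewrite modulusE /= cos2Dsin2 sqrtr1. Qed.

Lemma RCD s t : (s + t)%:C = s%:C + t%:C. Proof. exact: rmorphD. Qed.
Lemma RCM s t : (s * t)%:C = s%:C * t%:C. Proof. exact: rmorphM. Qed.
Lemma RCN s : (- s)%:C = - s%:C. Proof. exact: rmorphN. Qed.
Lemma RCV s : (s^-1)%:C = (s%:C)^-1. Proof. exact: fmorphV. Qed.
Lemma RC0 : (0 : R)%:C = 0. Proof. by []. Qed.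

End ComplexNumbers.

(** * Limits of complex-valued families *)

Section ComplexLimits.
Context {R : realType} {I : Type} (F : set_system I) {FF : ProperFilter F}.
Implicit Types (f g : I -> R[i]) (z u v : R[i]).

(** Convergence is taken componentwise because [cintegral] is itself defined by components;
    [ccvg_modulusP] converts to the norm form in which [is_oscillatory_integral] is phrased. *)
Definition ccvg f z :=
  (Re (f i) @[i --> F] --> Re z) /\ (Im (f i) @[i --> F] --> Im z).

Lemma ccvg_cst z : ccvg (fun=> z) z.
Proof. by split; exact: cvg_cst. Qed.

Lemma ccvgD f g u v : ccvg f u -> ccvg g v -> ccvg (fun i => f i + g i) (u + v).
Proof.
move=> [fr fi] [gr gi]; split.
  by under eq_fun do rewrite ReD; rewrite ReD; exact: cvgD.
by under eq_fun do rewrite ImD; rewrite ImD; exact: cvgD.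
Qed.

Lemma ccvgM f g u v : ccvg f u -> ccvg g v -> ccvg (fun i => f i * g i) (u * v).
Proof.
move=> [fr fi] [gr gi]; split.
  by under eq_fun do rewrite ReM; rewrite ReM; apply: cvgB; exact: cvgM.
by under eq_fun do rewrite ImM; rewrite ImM; apply: cvgD; exact: cvgM.
Qed.

Lemma ccvgJ f u : ccvg f u -> ccvg (fun i => (f i)^*) u^*.
Proof.
move=> [fr fi]; split.
  by under eq_fun do rewrite ReJ; rewrite ReJ.
by under eq_fun do rewrite ImJ; rewrite ImJ; exact: cvgN.
Qed.

Lemma ccvg_real (f : I -> R) (a : R) :
  f i @[i --> F] --> a -> ccvg (fun i => (f i)%:C) a%:C.
Proof. by move=> fa; split => //=; exact: cvg_cst. Qed.

Lemma ccvg_modulus f u : ccvg f u -> modulus (f i) @[i --> F] --> modulus u.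
Proof.
move=> [fr fi]; under eq_fun do rewrite modulusE; rewrite modulusE.
apply: continuous_cvg; first exact: sqrt_continuous.
by apply: cvgD; rewrite !expr2; apply: cvgM.
Qed.

Lemma ccvg_uniq f u v : ccvg f u -> ccvg f v -> u = v.
Proof.
move=> [ur ui] [vr vi]; apply: complexP.
  exact: (@cvg_unique _ (@norm_hausdorff _ _) _ _ _ _ ur vr).
exact: (@cvg_unique _ (@norm_hausdorff _ _) _ _ _ _ ui vi).
Qed.

Lemma ccvg_expi (f : I -> R) (a : R) :
  f i @[i --> F] --> a -> ccvg (fun i => expi (f i)) (expi a).
Proof.
move=> fa; split => /=; apply: continuous_cvg => //.
  exact: continuous_cos.
exact: continuous_sin.
Qed.

Lemma ccvg_modulusP f u :
  modulus (f i - u) @[i --> F] --> (0 : R) <-> ccvg f u.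
Proof.
split=> [fu|fu]; last first.
  by have /ccvg_modulus := ccvgD fu (ccvg_cst (- u)); rewrite subrr modulus0.
split; apply/subr_cvg0; apply: norm_cvg0;
  apply: (@squeeze_cvgr _ _ _ _ (cst 0) (fun i => modulus (f i - u))) => //;
  rewrite ?(_ : cst 0 @ F --> 0)//; try exact: cvg_cst;
  apply: nearW => i; rewrite normr_ge0/=.
  by have := Re_le_modulus (f i - u); rewrite ReD ReN.
by have := Im_le_modulus (f i - u); rewrite ImD ImN.
Qed.

End ComplexLimits.

(** * Integration of complex-valued functions *)

Section ComplexIntegral.
Context d (T : measurableType d) (R : realType).
Implicit Types (mu : {measure set T -> \bar R}) (f g : T -> R[i]).

Definition cmeasurable f :=
  measurable_fun setT (fun x => Re (f x)) /\
  measurable_fun setT (fun x => Im (f x)).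

Definition rintegrable mu (h : T -> R) := mu.-integrable setT (EFin \o h).

Definition cintegrable mu f :=
  rintegrable mu (fun x => Re (f x)) /\ rintegrable mu (fun x => Im (f x)).

Lemma cmeasurable_cst z : cmeasurable (fun=> z).
Proof. by split; exact: measurable_cst. Qed.

Lemma cmeasurable_real (h : T -> R) :
  measurable_fun setT h -> cmeasurable (fun x => (h x)%:C).
Proof. by split => //=; exact: measurable_cst. Qed.

Lemma cmeasurableM f g :
  cmeasurable f -> cmeasurable g -> cmeasurable (fun x => f x * g x).
Proof.
move=> [fr fi] [gr gi]; split.
  by under eq_fun do rewrite ReM; apply: measurable_funB; exact: measurable_funM.
by under eq_fun do rewrite ImM; apply: measurable_funD; exact: measurable_funM.
Qed.

Lemma cmeasurableJ f : cmeasurable f -> cmeasurable (fun x => (f x)^*).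
Proof.
move=> [fr fi]; split.
  by under eq_fun do rewrite ReJ.
under eq_fun do rewrite ImJ; exact: measurableT_comp.
Qed.

Lemma cmeasurable_expi (h : T -> R) :
  measurable_fun setT h -> cmeasurable (fun x => expi (h x)).
Proof.
move=> mh; split => /=.
  apply: (measurableT_comp (f := @cos R)) => //.
  by apply: continuous_measurable_fun; exact: continuous_cos.
apply: (measurableT_comp (f := @sin R)) => //.
by apply: continuous_measurable_fun; exact: continuous_sin.
Qed.

Lemma measurable_modulus f :
  cmeasurable f -> measurable_fun setT (fun x => modulus (f x)).
Proof.
move=> [fr fi]; under eq_fun do rewrite modulusE.
apply: (measurableT_comp (f := @Num.sqrt R)).
  by apply: continuous_measurable_fun; exact: sqrt_continuous.
by apply: measurable_funD; exact: measurable_funX.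
Qed.

Lemma rintegrable_measurable mu h : rintegrable mu h -> measurable_fun setT h.
Proof. by move=> /measurable_int/measurable_EFinP. Qed.

Lemma cintegrable_measurable mu f : cintegrable mu f -> cmeasurable f.
Proof.
by move=> [fr fi]; split;
  [exact: rintegrable_measurable fr|exact: rintegrable_measurable fi].
Qed.

Lemma rintegrable_le mu (h k : T -> R) : measurable_fun setT h ->
  (forall x, `|h x| <= k x) -> rintegrable mu k -> rintegrable mu h.
Proof.
move=> mh hk ik; apply: (le_integrable measurableT _ _ ik).
  exact/measurable_EFinP.
move=> x _ /=; rewrite lee_fin (le_trans (hk x))//.
by rewrite ler_norm.
Qed.

Lemma rintegrableD mu (h k : T -> R) :
  rintegrable mu h -> rintegrable mu k -> rintegrable mu (fun x => h x + k x).
Proof. by move=> ih ik; have := integrableD measurableT ih ik. Qed.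

Lemma rintegrableZ mu (c : R) (h : T -> R) :
  rintegrable mu h -> rintegrable mu (fun x => c * h x).
Proof. by move=> ih; have := integrableZl measurableT c ih. Qed.

Lemma cintegrable_le mu f (k : T -> R) : cmeasurable f ->
  (forall x, modulus (f x) <= k x) -> rintegrable mu k -> cintegrable mu f.
Proof.
move=> [fr fi] fk ik; split.
  by apply: rintegrable_le ik => // x; rewrite (le_trans (Re_le_modulus _)).
by apply: rintegrable_le ik => // x; rewrite (le_trans (Im_le_modulus _)).
Qed.

Lemma cintegrable_modulus mu f :
  cintegrable mu f -> rintegrable mu (fun x => modulus (f x)).
Proof.
move=> [fr fi]; apply: (@rintegrable_le _ _ (fun x => `|Re (f x)| + `|Im (f x)|)).
- by apply: measurable_modulus; split;
    [exact: rintegrable_measurable fr|exact: rintegrable_measurable fi].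
- by move=> x; rewrite ger0_norm ?modulus_ge0// modulus_leD.
- by apply: rintegrableD; exact: integrable_norm.
Qed.

Lemma cintegrableD mu f g :
  cintegrable mu f -> cintegrable mu g -> cintegrable mu (fun x => f x + g x).
Proof.
move=> [fr fi] [gr gi]; split; rewrite /rintegrable.
  by under eq_fun do rewrite ReD; exact: rintegrableD.
by under eq_fun do rewrite ImD; exact: rintegrableD.
Qed.

Lemma cintegrable_bounded_mul mu f g (M : R) : cmeasurable f ->
  (forall x, modulus (f x) <= M) -> cintegrable mu g ->
  cintegrable mu (fun x => f x * g x).
Proof.
move=> mf fM ig; apply: (@cintegrable_le _ _ (fun x => M * modulus (g x))).
- by apply: cmeasurableM => //; exact: cintegrable_measurable ig.
- by move=> x; rewrite modulusM ler_wpM2r// modulus_ge0.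
- by apply: rintegrableZ; exact: cintegrable_modulus.
Qed.

Lemma cintegrableZ mu z f : cintegrable mu f -> cintegrable mu (fun x => z * f x).
Proof.
move=> fi; apply: (@cintegrable_bounded_mul _ (fun=> z) _ (modulus z)) => //.
Qed.

Lemma cintegrableJ mu f : cintegrable mu f -> cintegrable mu (fun x => (f x)^*).
Proof.
move=> fi; apply: (@cintegrable_le _ _ (fun x => modulus (f x))).
- by apply: cmeasurableJ; exact: cintegrable_measurable fi.
- by move=> x; rewrite modulusJ.
- exact: cintegrable_modulus.
Qed.

Lemma eq_cintegral mu f g : f =1 g -> cintegral mu f = cintegral mu g.
Proof. by move=> fg; congr cintegral; exact/funext. Qed.

Lemma cintegralD mu f g : cintegrable mu f -> cintegrable mu g ->
  cintegral mu (fun x => f x + g x) = cintegral mu f + cintegral mu g.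
Proof.
move=> [fr fi] [gr gi]; apply: complexP; rewrite /cintegral/=.
  by rewrite -RintegralD//; apply: eq_Rintegral => x _; rewrite ReD.
by rewrite -RintegralD//; apply: eq_Rintegral => x _; rewrite ImD.
Qed.

Lemma cintegralZ mu z f : cintegrable mu f ->
  cintegral mu (fun x => z * f x) = z * cintegral mu f.
Proof.
move=> [fr fi]; apply: complexP; rewrite ?ReM ?ImM /cintegral/=.
  rewrite -!RintegralZl// -RintegralB//; try exact: rintegrableZ.
  by apply: eq_Rintegral => x _; rewrite ReM.
rewrite -!RintegralZl// -RintegralD//; try exact: rintegrableZ.
by apply: eq_Rintegral => x _; rewrite ImM.
Qed.

Lemma cintegralZr mu z f : cintegrable mu f ->
  cintegral mu (fun x => f x * z) = cintegral mu f * z.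
Proof.
move=> fi; rewrite mulrC -cintegralZ//.
by apply: eq_cintegral => x; rewrite mulrC.
Qed.

Lemma cintegralJ mu f : cintegrable mu f ->
  cintegral mu (fun x => (f x)^*) = (cintegral mu f)^*.
Proof.
move=> [fr fi]; apply: complexP; rewrite ?ReJ ?ImJ /cintegral/=.
  by apply: eq_Rintegral => x _; rewrite ReJ.
rewrite -mulN1r -RintegralZl//.
by apply: eq_Rintegral => x _; rewrite ImJ mulN1r.
Qed.

Lemma cintegral_real mu (h : T -> R) :
  cintegral mu (fun x => (h x)%:C) = (Rintegral mu setT h)%:C.
Proof.
rewrite /cintegral; congr (_ +i* _) => /=.
by rewrite /Rintegral integral0.
Qed.

(** Multiplying by the conjugate of the integral [J] rotates it onto the real axis, where only a
    real part has to be estimated; this keeps the constant 1. One then divides by [|J|], whence the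
    separate case [J = 0]. *)
Lemma modulus_cintegral mu f : cintegrable mu f ->
  modulus (cintegral mu f) <= Rintegral mu setT (fun x => modulus (f x)).
Proof.
move=> fi; set J := cintegral mu f.
have [J0|J0] := eqVneq (modulus J) 0.
  by rewrite J0 Rintegral_ge0// => x _; exact: modulus_ge0.
have Jp : 0 < modulus J by rewrite lt_neqAle eq_sym J0 modulus_ge0.
rewrite -(ler_pM2l Jp) -expr2.
have -> : modulus J ^+ 2 = Re (J^* * J) by rewrite mulrC mulcJ.
rewrite -cintegralZ// /cintegral/=.
have ? := cintegrable_modulus fi.
rewrite -RintegralZl//; apply: le_Rintegral => //.
- by have [] := cintegrableZ J^* fi.
- exact: rintegrableZ.
- move=> x _; rewrite (le_trans (ler_norm _))// (le_trans (Re_le_modulus _))//.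
  by rewrite modulusM modulusJ.
Qed.

(** The real theorem is run once for a functional [p] bounded by the modulus, then used for [Re] and
    [Im]. Convergence almost everywhere is the form that [dilation_integral_cvg] calls for, where
    the origin is exceptional. *)
Lemma cintegral_dominated mu (f_ : nat -> T -> R[i]) f (k : T -> R) :
  (forall n, cmeasurable (f_ n)) -> cmeasurable f ->
  {ae mu, forall x, ccvg \oo (f_ ^~ x) (f x)} ->
  (forall n x, modulus (f_ n x) <= k x) -> rintegrable mu k ->
  cintegrable mu f /\
  ccvg \oo (fun n => cintegral mu (f_ n)) (cintegral mu f).
Proof.
move=> mf_ mf ff fk ik.
have main (p : R[i] -> R) : (forall z, `|p z| <= modulus z) ->
    (forall n, measurable_fun setT (fun x => p (f_ n x))) ->
    measurable_fun setT (fun x => p (f x)) ->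
    {ae mu, forall x, p (f_ n x) @[n --> \oo] --> p (f x)} ->
    rintegrable mu (fun x => p (f x)) /\
    (Rintegral mu setT (fun x => p (f_ n x)) @[n --> \oo] -->
     Rintegral mu setT (fun x => p (f x))).
  move=> pm mp_ mp cp.
  have := @dominated_convergence _ T R mu setT measurableT
    (fun n x => (p (f_ n x))%:E) (fun x => (p (f x))%:E) (EFin \o k).
  case=> //.
  - by move=> n; exact/measurable_EFinP.
  - exact/measurable_EFinP.
  - apply: filterS cp => x px _.
    exact: cvg_EFin (nearW _ _) px.
  - by apply: aeW => x n _; rewrite lee_fin (le_trans (pm _))// fk.
  - move=> ip _ cvp; split; first exact: ip.
    rewrite /Rintegral; apply: fine_cvg.
    by rewrite fineK//; exact: integrable_fin_num.
have [mr mi] := mf.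
have [] := main (@Re R) (@Re_le_modulus R) (fun n => (mf_ n).1) mr.
  by apply: filterS ff => x [].
have [] := main (@Im R) (@Im_le_modulus R) (fun n => (mf_ n).2) mi.
  by apply: filterS ff => x [].
by move=> ? ? ? ?; split; split.
Qed.

End ComplexIntegral.

Lemma cmeasurable_comp d1 d2 (T1 : measurableType d1) (T2 : measurableType d2)
    (R : realType) (f : T2 -> R[i]) (g : T1 -> T2) :
  measurable_fun setT g -> cmeasurable f -> cmeasurable (fun x => f (g x)).
Proof.
move=> mg [fr fi]; split.
  exact: (measurableT_comp (f := fun x => Re (f x)) fr mg).
exact: (measurableT_comp (f := fun x => Im (f x)) fi mg).
Qed.

(** * Fubini under domination by a product *)

Section ComplexFubini.
Context d1 d2 (T1 : measurableType d1) (T2 : measurableType d2) (R : realType).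
Variable m1 : {sigma_finite_measure set T1 -> \bar R}.
Variable m2 : {sigma_finite_measure set T2 -> \bar R}.
Variables (f : T1 * T2 -> R[i]) (a : T1 -> R) (b : T2 -> R).
Hypotheses (mf : cmeasurable f) (ia : rintegrable m1 a) (ib : rintegrable m2 b).
Hypothesis fab : forall x y, modulus (f (x, y)) <= a x * b y.

(** Domination by a product [a x * b y] makes every section integrable, not merely almost every one.
    Hence [fine] never meets an infinite inner integral, and the extended-real theorem passes to
    [Rintegral] pointwise. *)
Let rfubini (h : T1 * T2 -> R) : measurable_fun setT h ->
  (forall x y, `|h (x, y)| <= a x * b y) ->
  rintegrable m1 (fun x => Rintegral m2 setT (fun y => h (x, y))) /\
      Rintegral m1 setT (fun x => Rintegral m2 setT (fun y => h (x, y))) =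
      Rintegral m2 setT (fun y => Rintegral m1 setT (fun x => h (x, y))).
Proof.
move=> mh hab.
have hi : (m1 \x m2)%E.-integrable setT (EFin \o h).
  apply/integrable12ltyP; first exact/measurable_EFinP.
  apply: (@le_lt_trans _ _ (\int[m1]_x (`|a x|%:E * \int[m2]_y `|b y|%:E))%E).
    apply: ge0_le_integral => //.
    - by move=> x _; exact: integral_ge0.
    - apply: (measurable_fun_fubini_tonelli_F (fun z => `|(EFin \o h) z|%E)) => //.
      by apply/measurable_EFinP; exact: measurableT_comp.
    - apply: emeasurable_funM; last exact: measurable_cst.
      apply/measurable_EFinP; apply: measurableT_comp => //.
      exact: rintegrable_measurable ia.
    - move=> x _; rewrite -ge0_integralZl//.
      + apply: ge0_le_integral => //.
        * apply/measurable_EFinP; apply: measurableT_comp => //.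
          exact: measurableT_comp.
        * apply: emeasurable_funM; first exact: measurable_cst.
          apply/measurable_EFinP; apply: measurableT_comp => //.
          exact: rintegrable_measurable ib.
        * by move=> y _; rewrite /= lee_fin (le_trans (hab x y))// -normrM ler_norm.
      + apply/measurable_EFinP; apply: measurableT_comp => //.
        exact: rintegrable_measurable ib.
  rewrite ge0_integralZr//.
  - by apply: lte_mul_pinfty; [exact: integral_ge0| |];
      [move/integrableP : ia => -[_ ialt];
       rewrite ge0_fin_numE//; exact: integral_ge0|
       by move/integrableP : ib => -[]].
  - apply/measurable_EFinP; apply: measurableT_comp => //.
    exact: rintegrable_measurable ia.
  - by apply: integral_ge0 => y _; rewrite lee_fin.
have fin2 x : (\int[m2]_y (h (x, y))%:E)%E \is a fin_num.
  apply: integrable_fin_num => //.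
  apply: (rintegrable_le (k := fun y => a x * b y)) => //.
    exact: measurableT_comp.
  exact: rintegrableZ.
have fin1 y : (\int[m1]_x (h (x, y))%:E)%E \is a fin_num.
  apply: integrable_fin_num => //.
  apply: (rintegrable_le (k := fun x => b y * a x)) => //.
  - exact: measurableT_comp.
  - by move=> x; rewrite mulrC.
  - exact: rintegrableZ.
have E2 : EFin \o (fun x => Rintegral m2 setT (fun y => h (x, y))) =
    (fun x => \int[m2]_y (h (x, y))%:E)%E.
  by apply/funext => x; rewrite /= /Rintegral fineK.
have E1 : EFin \o (fun y => Rintegral m1 setT (fun x => h (x, y))) =
    (fun y => \int[m1]_x (h (x, y))%:E)%E.
  by apply/funext => y; rewrite /= /Rintegral fineK.
split.
- by rewrite /rintegrable E2; exact: (integrable_fubini_F hi).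
- rewrite [LHS]/Rintegral [RHS]/Rintegral.
  under eq_integral do rewrite /Rintegral fineK//.
  under [in RHS]eq_integral do rewrite /Rintegral fineK//.
  by rewrite (Fubini hi).
Qed.

Lemma cintegrable_fubini :
  cintegrable m1 (fun x => cintegral m2 (fun y => f (x, y))).
Proof.
have [mr mi] := mf; split.
  by have [] := rfubini mr (fun x y => le_trans (Re_le_modulus _) (fab x y)).
by have [] := rfubini mi (fun x y => le_trans (Im_le_modulus _) (fab x y)).
Qed.

Lemma cfubini :
  cintegral m1 (fun x => cintegral m2 (fun y => f (x, y))) =
  cintegral m2 (fun y => cintegral m1 (fun x => f (x, y))).
Proof.
have [mr mi] := mf; apply: complexP; rewrite /cintegral/=.
  by have [] := rfubini mr (fun x y => le_trans (Re_le_modulus _) (fab x y)).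
by have [] := rfubini mi (fun x y => le_trans (Im_le_modulus _) (fab x y)).
Qed.

End ComplexFubini.

(** * Joint measurability from continuity in one variable *)

Section SeparatelyMeasurable.
Context {R : realType} d (T : measurableType d).
Variable f : measurableTypeR R * T -> R.
Hypothesis fc : forall t, continuous (fun x : R => f (x, t)).
Hypothesis fm : forall x, measurable_fun setT (fun t => f (x, t)).

Let grid (n : nat) (x : R) : R := (Num.floor (x * n.+1%:R))%:~R / n.+1%:R.

Let grid_cvg x : grid ^~ x @ \oo --> x.
Proof.
apply/cvgrPdist_le => e e0.
have := near_infty_natSinv_lt (PosNum e0); apply: filterS => n /= ne.
have n0 : (0 : R) < n.+1%:R by rewrite ltr0n.
rewrite (_ : x - grid n x = (x * n.+1%:R - (Num.floor (x * n.+1%:R))%:~R) / n.+1%:R); last first.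
  by rewrite /grid mulrBl mulfK// gt_eqF.
have /andP[h1 h2] := floor_itv (x * n.+1%:R).
rewrite ger0_norm; last by rewrite divr_ge0 ?subr_ge0// ltW.
apply: le_trans (ltW ne); rewrite ler_pdivrMr// mulVf ?gt_eqF//.
by move: h2; rewrite intrD => /ltW h2; rewrite lerBlDl.
Qed.

(* Caratheodory: approximate the first variable by its grid points. *)
Lemma measurable_caratheodory : measurable_fun setT f.
Proof.
apply: (@measurable_fun_cvg _ _ _ setT (fun n z => f (grid n z.1, z.2))); last first.
  move=> [x t] _ /=; apply: (@cvg_comp _ _ _ (fun n => grid n x) (fun x => f (x, t))).
    exact: grid_cvg.
  exact: fc.
move=> n _ B mB; rewrite setTI.
(* On a strip where the grid point is constant the function depends on the second variable alone, so
   a preimage is a countable union of measurable rectangles. *)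
have -> : (fun z => f (grid n z.1, z.2)) @^-1` B =
    \bigcup_(j : int) ([set x : R | Num.floor (x * n.+1%:R) = j] `*`
      ((fun t => f (j%:~R / n.+1%:R, t)) @^-1` B)).
  apply/seteqP; split => [[x t] /= h|[x t] [j _ [/= xj h]]].
    by exists (Num.floor (x * n.+1%:R)).
  by rewrite /grid xj.
apply: countable_bigcupT_measurable; first exact: countableP.
move=> j; apply: measurableX; last first.
  by rewrite -[X in measurable X]setTI; exact: fm.
have n0 : (0 : R) < n.+1%:R by rewrite ltr0n.
rewrite (_ : [set x | _] = `[(j%:~R / n.+1%:R), ((j + 1)%:~R / n.+1%:R)[%classic).
  exact: measurable_itv.
apply/seteqP; split => x /=; rewrite in_itv/= ler_pdivrMr// ltr_pdivlMr//.
  by move/eqP; rewrite floor_eq.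
by rewrite -floor_eq => /eqP.
Qed.

End SeparatelyMeasurable.

Notation pmeasurable f := (@cmeasurable _ (plane _) _ f).

Section PlaneMeasurability.
Context {R : realType}.

Lemma continuous_section1 (f : R * R -> R) (t : R) : continuous f ->
  continuous (fun x : R => f (x, t)).
Proof.
move=> cf x; apply: (@continuous_comp _ _ _ (fun x : R => (x, t)) f); last exact: cf.
by apply: (@cvg_pair _ _ _ _ (nbhs x) (nbhs t) _ _ _ (fun x => x) (fun=> t));
  [exact: cvg_id|exact: cvg_cst].
Qed.

Lemma continuous_section2 (f : R * R -> R) (t : R) : continuous f ->
  continuous (fun x : R => f (t, x)).
Proof.
move=> cf x; apply: (@continuous_comp _ _ _ (fun x : R => (t, x)) f); last exact: cf.
by apply: (@cvg_pair _ _ _ _ (nbhs t) (nbhs x) _ _ _ (fun=> t) (fun x => x));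
  [exact: cvg_cst|exact: cvg_id].
Qed.

Lemma continuous_measurable_plane (f : R * R -> R) : continuous f ->
  measurable_fun [set: plane R] f.
Proof.
move=> cf; apply: measurable_caratheodory => [t|x].
  exact: continuous_section1.
by apply: continuous_measurable_fun; exact: continuous_section2.
Qed.

(** The Caratheodory argument is applied twice, one real coordinate at a time, after reassociating
    the triple product. It provides the joint measurability of the field in position and sample. *)
Lemma measurable_plane_family d (T : measurableType d) (f : plane R * T -> R) :
  (forall t, continuous (fun x : R * R => f (x, t))) ->
  (forall x, measurable_fun setT (fun t => f (x, t))) -> measurable_fun setT f.
Proof.
move=> cf mf.
pose g (z : measurableTypeR R * (measurableTypeR R * T)) := f ((z.1, z.2.1), z.2.2).
have mg : measurable_fun setT g.
  apply: measurable_caratheodory => [[x2 t]|x1].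
    exact: (continuous_section1 (f := fun x : R * R => f (x, t))).
  apply: measurable_caratheodory => [t|x2].
    exact: (continuous_section2 (f := fun x : R * R => f (x, t))).
  exact: (mf (x1, x2)).
have -> : f = g \o (fun z : plane R * T => (z.1.1, (z.1.2, z.2))).
  by apply/funext => -[[x1 x2] t].
apply: (measurableT_comp mg).
apply: measurable_fun_pair.
  by apply: (measurableT_comp (f := fst)) => //; exact: measurable_fst.
apply: measurable_fun_pair; last exact: measurable_snd.
by apply: (measurableT_comp (f := snd)) => //; exact: measurable_fst.
Qed.

End PlaneMeasurability.

(** * Affine changes of variable in the plane *)

Section AffineChange.
Context {R : realType}.
Variable a : R.
Hypothesis a0 : a != 0.

Let aff1 (y x : R) : R := y + a * x.

Let maff1 y : measurable_fun [set: measurableTypeR R] (aff1 y : _ -> measurableTypeR R).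
Proof. by apply: measurable_funD => //; exact: measurable_funM. Qed.

Let absa : {nonneg R} := NngNum (normr_ge0 a).

(** Uniqueness of Lebesgue measure reduces the claim to half-open intervals. A negative [a] moves
    the closed end to the other side, which the length does not see. *)
Let lebesgue_affine1 y (A : set (measurableTypeR R)) : measurable A ->
  lebesgue_measure A = (`|a|%:E * lebesgue_measure (aff1 y @^-1` A))%E.
Proof.
move=> mA.
pose phi : _ -> measurableTypeR R := aff1 y.
pose nu : {measure set (measurableTypeR R) -> \bar R} :=
  measure_function_pushforward__canonical__measure_function_Measure lebesgue_measure (maff1 y).
transitivity (mscale absa nu A); last by [].
apply: lebesgue_measure_unique => //= _ [[u v]] _ <-.
rewrite /mscale/= /pushforward.
have [a_gt0|a_lt0] : 0 < a \/ a < 0 by move: a0; rewrite neq_lt => /orP[]; [right|left].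
  have -> : aff1 y @^-1` `]u, v] = `]((u - y) / a), ((v - y) / a)]%classic.
    apply/seteqP; split => x /=; rewrite !in_itv/= /aff1 ltr_pdivrMr// ler_pdivlMr//;
      by rewrite ltrBlDl lerBrDl (mulrC x).
  rewrite !lebesgue_measure_itv/= !lte_fin ltr_pM2r ?invr_gt0// ltrBlDr subrK.
  case: ifPn => uv; last by rewrite mule0.
  by rewrite !EFinN -!EFinB -EFinM gtr0_norm//; congr EFin; field.
have -> : aff1 y @^-1` `]u, v] = `[((v - y) / a), ((u - y) / a)[%classic.
  apply/seteqP; split => x /=; rewrite !in_itv/= /aff1 ltr_ndivlMr// ler_ndivrMr//;
    by rewrite ltrBlDl lerBrDl (mulrC x) andbC.
rewrite !lebesgue_measure_itv/= !lte_fin ltr_nM2r ?invr_lt0// ltrBlDr subrK.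
case: ifPn => uv; last by rewrite mule0.
by rewrite !EFinN -!EFinB -EFinM ltr0_norm//; congr EFin; field.
Qed.

Definition plane_affine (y x : plane R) : plane R :=
  (y.1 + a * x.1, y.2 + a * x.2).

Lemma measurable_plane_affine y : measurable_fun setT (plane_affine y).
Proof.
apply: measurable_fun_pair.
  exact: (measurableT_comp (maff1 y.1) measurable_fst).
exact: (measurableT_comp (maff1 y.2) measurable_snd).
Qed.

Let asq : {nonneg R} := NngNum (sqr_ge0 a).

Let push y : {measure set (plane R) -> \bar R} :=
  mscale asq (measure_function_pushforward__canonical__measure_function_Measure
    (leb2 R) (measurable_plane_affine y)).

Let leb2_affine y (A : set (plane R)) : measurable A -> leb2 R A = push y A.
Proof.
move=> mA; apply: product_measure_unique => // B1 B2 mB1 mB2.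
transitivity ((a ^+ 2)%:E * (@lebesgue_measure R \x @lebesgue_measure R)
  ((aff1 y.1 @^-1` B1) `*` (aff1 y.2 @^-1` B2)))%E; first by [].
rewrite product_measure1E; last 2 first.
- by rewrite -[X in measurable X]setTI; exact: maff1.
- by rewrite -[X in measurable X]setTI; exact: maff1.
transitivity (lebesgue_measure B1 * lebesgue_measure B2)%E; last by [].
rewrite (lebesgue_affine1 y.1 mB1) (lebesgue_affine1 y.2 mB2).
rewrite -(real_normK (num_real a)) expr2 EFinM.
by rewrite muleACA.
Qed.

Lemma ge0_integral_affine y (f : plane R -> \bar R) :
  measurable_fun setT f -> (forall x, 0 <= f x)%E ->
  (\int[leb2 R]_x f x = (a ^+ 2)%:E * \int[leb2 R]_x f (plane_affine y x))%E.
Proof.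
move=> mf f0.
rewrite (eq_measure_integral (push y)); last by move=> A mA _; exact: leb2_affine.
have f0' : (forall x, setT x -> (0 <= f x)%E) by move=> x _; exact: f0.
rewrite /push (ge0_integral_mscale _ measurableT asq mf f0').
have f0'' : {in [set: plane R], forall x, (0 <= f x)%E} by move=> x _; exact: f0.
by rewrite (ge0_integral_pushforward (measurable_plane_affine y) (leb2 R) measurableT mf f0'').
Qed.

Lemma rintegrable_affine y (f : plane R -> R) :
  rintegrable (leb2 R) f -> rintegrable (leb2 R) (fun x => f (plane_affine y x)).
Proof.
move=> fi; have mf := rintegrable_measurable fi.
have mfa : measurable_fun setT (fun x => f (plane_affine y x)).
  exact: (measurableT_comp mf (measurable_plane_affine y)).
apply/integrableP; split; first exact/measurable_EFinP.
have a2 : 0 < a ^+ 2 by rewrite exprn_even_gt0.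
have /integrableP[_] := fi.
rewrite (ge0_integral_affine y)//; last first.
  by apply/measurable_EFinP; exact: measurableT_comp.
have {1}-> : (+oo = (a ^+ 2)%:E * +oo)%E by rewrite gt0_muley// lte_fin.
by rewrite lte_pmul2l.
Qed.

Lemma Rintegral_affine y (f : plane R -> R) :
  rintegrable (leb2 R) f ->
  Rintegral (leb2 R) setT f =
  a ^+ 2 * Rintegral (leb2 R) setT (fun x => f (plane_affine y x)).
Proof.
move=> fi; have mf := rintegrable_measurable fi.
have fai := rintegrable_affine y fi.
rewrite /Rintegral -[a ^+ 2]/(fine (a ^+ 2)%:E) -fineM//; last first.
  exact: integrable_fin_num.
congr fine; rewrite integralE [in RHS]integralE.
have mE : measurable_fun setT (EFin \o f) by exact/measurable_EFinP.
rewrite (ge0_integral_affine y (measurable_funepos mE))//.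
rewrite (ge0_integral_affine y (measurable_funeneg mE))//.
rewrite [in RHS]muleBr.
- by congr (_ * _ - _ * _)%E; apply: eq_integral => x _;
    rewrite ?funeposE ?funenegE.
- by [].
- have h : (leb2 R).-integrable setT (EFin \o (fun x => f (plane_affine y x))) := fai.
  exact: (integrable_add_def measurableT h).
Qed.

Lemma cintegrable_affine y (f : R * R -> R[i]) :
  cintegrable (leb2 R) f -> cintegrable (leb2 R) (fun x => f (plane_affine y x)).
Proof.
by move=> [fr fi]; split; [exact: (rintegrable_affine y fr)|exact: (rintegrable_affine y fi)].
Qed.

Lemma cintegral_affine y (f : R * R -> R[i]) :
  cintegrable (leb2 R) f ->
  cintegral (leb2 R) f =
  (a ^+ 2)%:C * cintegral (leb2 R) (fun x => f (plane_affine y x)).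
Proof.
move=> [fr fi]; apply: complexP; rewrite ?ReM ?ImM/= mul0r ?subr0 ?addr0.
  exact: (Rintegral_affine y fr).
exact: (Rintegral_affine y fi).
Qed.

End AffineChange.

(** * Product integrals and the reference weight *)

Section PlaneIntegral.
Context {R : realType}.

Lemma plane_prod_integral (a b : R -> R) :
  rintegrable (@lebesgue_measure R) a -> rintegrable (@lebesgue_measure R) b ->
  rintegrable (leb2 R) (fun x => a x.1 * b x.2) /\
  Rintegral (leb2 R) setT (fun x => a x.1 * b x.2) =
    Rintegral (@lebesgue_measure R) setT a * Rintegral (@lebesgue_measure R) setT b.
Proof.
move=> ia ib.
have ma := rintegrable_measurable ia; have mb := rintegrable_measurable ib.
have mab : measurable_fun [set: plane R] (fun x => a x.1 * b x.2).
  by apply: measurable_funM;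
    [exact: (measurableT_comp ma measurable_fst)|exact: (measurableT_comp mb measurable_snd)].
have ia' := integrable_norm ia; have ib' := integrable_norm ib.
have finb := integrable_fin_num measurableT ib.
have i1 : (@lebesgue_measure R \x @lebesgue_measure R)%E.-integrable setT
    (EFin \o (fun x => a x.1 * b x.2)).
  apply/integrable12ltyP; first exact/measurable_EFinP.
  have E x : (\int[@lebesgue_measure R]_y `|(EFin \o (fun z : R * R => a z.1 * b z.2)%R) (x, y)| =
      `|a x|%:E * \int[@lebesgue_measure R]_y `|b y|%:E)%E.
    rewrite -ge0_integralZl//; last by apply/measurable_EFinP; exact: measurableT_comp.
    by apply: eq_integral => y _; rewrite /= normrM EFinM.
  under eq_integral do rewrite E.
  have finb' := integrable_fin_num measurableT ib'.
  rewrite -(fineK finb') ge0_integralZr//.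
  - by rewrite lte_mul_pinfty ?integral_ge0//;
      [exact: (integrable_fin_num measurableT ia')|rewrite ltry].
  - by apply/measurable_EFinP; exact: measurableT_comp.
  - by rewrite lee_fin; apply: fine_ge0; apply: integral_ge0 => x _; rewrite /= lee_fin.
split; first exact: i1.
rewrite -[RHS]mulrC -RintegralZl// /Rintegral; congr fine.
transitivity (\int[(@lebesgue_measure R \x @lebesgue_measure R)%E]_x
    (EFin \o (fun z : R * R => a z.1 * b z.2)%R) x)%E; first by [].
rewrite -(integral12_prod_meas1 i1); apply: eq_integral => x _.
rewrite /fubini_F /=.
transitivity (\int[@lebesgue_measure R]_y ((a x)%:E * (b y)%:E))%E.
  by apply: eq_integral => y _; rewrite EFinM.
by rewrite (integralZl measurableT ib) -(fineK finb) -EFinM mulrC.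
Qed.

Definition weight1 (t : R) : R := (1 + t ^+ 2)^-1.

(** The common dominating function: integrable over the plane, while its reciprocal is a polynomial,
    so that every Schwartz function is bounded by a multiple of it. The product form reduces its
    integral to dimension one. *)
Definition weight (x : R * R) : R := weight1 x.1 * weight1 x.2.

Lemma weight1_gt0 t : 0 < weight1 t.
Proof. by rewrite invr_gt0 ltr_pwDl// sqr_ge0. Qed.

Lemma weight1_le1 t : weight1 t <= 1.
Proof. by rewrite invf_le1 ?lerDl ?sqr_ge0// ltr_pwDl// sqr_ge0. Qed.

Lemma weight_gt0 x : 0 < weight x.
Proof. by rewrite mulr_gt0// weight1_gt0. Qed.

Lemma weight_le1 x : weight x <= 1.
Proof. by rewrite mulr_ile1// ?weight1_le1// ltW// weight1_gt0. Qed.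

Lemma rintegrable_weight1 : rintegrable (@lebesgue_measure R) weight1.
Proof.
have E : weight1 = (fun t => (oneDsqr t)^-1) by [].
have mw : measurable_fun setT weight1.
  by rewrite E; apply: continuous_measurable_fun; exact: continuous_oneDsqrV.
apply/integrableP; split; first exact/measurable_EFinP.
under eq_integral do rewrite /= ger0_norm ?ltW ?weight1_gt0//.
rewrite ge0_symfun_integralT//.
- rewrite (_ : [set x | _] = `[0, +oo[%classic); last first.
    by apply/seteqP; split => x/=; rewrite in_itv/= andbT.
  by rewrite E integral0y_oneDsqr -EFinM ltry.
- by move=> t; exact/ltW/weight1_gt0.
- by rewrite E; exact: continuous_oneDsqrV.
- by move=> t; rewrite /weight1/= sqrrN.
Qed.

Lemma rintegrable_weight : rintegrable (leb2 R) weight.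
Proof. by have [] := plane_prod_integral rintegrable_weight1 rintegrable_weight1. Qed.

Lemma weight1_shift (t h : R) : `|h| <= 1 -> weight1 (t + h) <= 3 * weight1 t.
Proof.
move=> h1; have h2 : h ^+ 2 <= 1.
  by rewrite -(real_normK (num_real h)) expr_le1.
rewrite /weight1 ler_pdivlMr; last by rewrite ltr_pwDl// sqr_ge0.
rewrite mulrC ler_pdivrMr; last by rewrite ltr_pwDl// sqr_ge0.
(* Cleared of denominators, the difference of the two sides is
   [(t + 2 h)^2 + (t + h)^2 + 2 (1 - h^2)]. *)
by have := sqr_ge0 (t + 2 * h); have := sqr_ge0 (t + h); nra.
Qed.

Lemma weight_shift (x y : R * R) : `|y.1| <= 1 -> `|y.2| <= 1 ->
  weight (x + y) <= 9 * weight x.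
Proof.
move=> h1 h2; rewrite /weight (_ : 9 * _ = (3 * weight1 x.1) * (3 * weight1 x.2)); last by ring.
by apply: ler_pM; rewrite ?weight1_shift// ltW// weight1_gt0.
Qed.

(** Peetre's inequality for this weight, one factor 2 per coordinate. It bounds an autocorrelation
    by a product of weights in [corr_swap]. *)
Lemma weight_peetre (x y : R * R) : weight (x + y) * weight x <= 4 * weight y.
Proof.
have w1 s t : weight1 (s + t) * weight1 s <= 2 * weight1 t.
  rewrite /weight1 -invfM ler_pdivlMr; last by rewrite ltr_pwDl// sqr_ge0.
  rewrite mulrC ler_pdivrMr; last by rewrite mulr_gt0// ltr_pwDl// sqr_ge0.
  (* The difference of the two sides is [1 + (2 s + t)^2 + 2 (s (s + t))^2]. *)
  have := sqr_ge0 (s * (s + t)); have := sqr_ge0 (2 * s + t); nra.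
rewrite /weight (_ : _ * _ = (weight1 (x.1 + y.1) * weight1 x.1) * (weight1 (x.2 + y.2) * weight1 x.2)); last by rewrite /=; ring.
rewrite (_ : 4 * _ = (2 * weight1 y.1) * (2 * weight1 y.2)); last by ring.
by apply: ler_pM; rewrite ?w1// mulr_ge0// ltW// weight1_gt0.
Qed.

End PlaneIntegral.

(** * Fubini on the plane and on the plane times a probability space *)

Section PlaneFubini.
Context {R : realType}.

Lemma leb2_sigma_finite : sigma_finite setT (leb2 R).
Proof.
pose I n : set (measurableTypeR R) := `[- n%:R, n%:R]%classic.
have mI n : measurable (I n) by exact: measurable_itv.
exists (fun n => I n `*` I n).
  apply/seteqP; split => // -[x y] _.
  exists (Num.truncn (`|x| + `|y|)).+1 => //=.
  have /ltW h := truncnS_gt (`|x| + `|y|); rewrite /I /= !in_itv/=.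
  by split; rewrite -ler_norml; apply: le_trans h; rewrite ?lerDl ?lerDr.
move=> k; split; first exact: measurableX.
rewrite [leb2 R _]product_measure1E//.
have Ik : (lebesgue_measure (I k) < +oo)%E.
  by rewrite lebesgue_measure_itv; case: ifP => // _; rewrite -EFinB ltry.
by rewrite lte_mul_pinfty// ge0_fin_numE.
Qed.

(** A second name for the same set function, to which the sigma-finite structure demanded by the
    Fubini lemmas is attached. *)
Definition sleb2 : set (plane R) -> \bar R := leb2 R.

HB.instance Definition _ := Measure.on sleb2.
HB.instance Definition _ := Measure_isSigmaFinite.Build _ _ _ sleb2 leb2_sigma_finite.

Lemma plane_fubini (f : R * R -> R * R -> R[i]) (a b : R * R -> R) :
  @cmeasurable _ (plane R * plane R)%type R (fun z => f z.1 z.2) ->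
  rintegrable (leb2 R) a -> rintegrable (leb2 R) b ->
  (forall x y, modulus (f x y) <= a x * b y) ->
  cintegral (leb2 R) (fun x => cintegral (leb2 R) (f x)) =
  cintegral (leb2 R) (fun y => cintegral (leb2 R) (f^~ y)).
Proof.
move=> mf ia ib fab.
exact: (@cfubini _ _ (plane R) (plane R) R sleb2 sleb2 (fun z => f z.1 z.2) a b).
Qed.

Lemma plane_fubini_integrable (f : R * R -> R * R -> R[i]) (a b : R * R -> R) :
  @cmeasurable _ (plane R * plane R)%type R (fun z => f z.1 z.2) ->
  rintegrable (leb2 R) a -> rintegrable (leb2 R) b ->
  (forall x y, modulus (f x y) <= a x * b y) ->
  cintegrable (leb2 R) (fun x => cintegral (leb2 R) (f x)).
Proof.
move=> mf ia ib fab.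
exact: (@cintegrable_fubini _ _ (plane R) (plane R) R sleb2 sleb2 (fun z => f z.1 z.2) a b).
Qed.

Lemma plane_prob_fubini d (T : measurableType d) (P : probability T R)
    (f : R * R -> T -> R[i]) (a : R * R -> R) (b : T -> R) :
  @cmeasurable _ (plane R * T)%type R (fun z => f z.1 z.2) ->
  rintegrable (leb2 R) a -> rintegrable P b ->
  (forall x w, modulus (f x w) <= a x * b w) ->
  cintegral (leb2 R) (fun x => cintegral P (f x)) =
  cintegral P (fun w => cintegral (leb2 R) (f^~ w)).
Proof.
move=> mf ia ib fab.
exact: (@cfubini _ _ (plane R) T R sleb2 P (fun z => f z.1 z.2) a b).
Qed.

End PlaneFubini.

(** * Calculus of directional derivatives *)

Section PointwiseDerivative.
Context {R : realType} {V : normedModType R}.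
Implicit Types (f g : V -> R) (x v : V).

Lemma is_derive_ext f g x v a b :
  f =1 g -> a = b -> is_derive x v f a -> is_derive x v g b.
Proof. by move=> /funext -> ->. Qed.

Lemma is_derive_add f g x v a b : is_derive x v f a -> is_derive x v g b ->
  is_derive x v (fun y => f y + g y) (a + b).
Proof. by move=> fa gb; exact: (is_deriveD (f := f) (g := g)). Qed.

Lemma is_derive_sub f g x v a b : is_derive x v f a -> is_derive x v g b ->
  is_derive x v (fun y => f y - g y) (a - b).
Proof. by move=> fa gb; exact: (is_deriveB (f := f) (g := g)). Qed.

Lemma is_derive_opp f x v a : is_derive x v f a ->
  is_derive x v (fun y => - f y) (- a).
Proof. by move=> fa; exact: (is_deriveN (f := f)). Qed.

Lemma is_derive_mul f g x v a b : is_derive x v f a -> is_derive x v g b ->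
  is_derive x v (fun y => f y * g y) (f x * b + g x * a).
Proof. by move=> fa gb; exact: (is_deriveM (f := f) (g := g)). Qed.

Lemma is_derive_const (c : R) x v : is_derive x v (fun=> c) 0.
Proof. exact: is_derive_cst. Qed.

Lemma is_derive_scale (c : R) f x v a : is_derive x v f a ->
  is_derive x v (fun y => c * f y) (c * a).
Proof.
move=> fa; apply: is_derive_ext (is_derive_mul (is_derive_const c x v) fa) => //.
by rewrite mulr0 addr0.
Qed.

End PointwiseDerivative.

Section DirectionalDerivative.
Context {R : realType}.
Implicit Types (F G : R * R -> R) (x v : R * R) (i : 'I_2).

Lemma difference_quotient_line F x v :
  (fun h : R => h^-1 *: ((F \o shift x) (h *: v) - F x)) =
  (fun h : R => h^-1 *: (((fun t : R => F (x + t *: v)) \o shift (0 : R)) (h *: (1 : R))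
     - F (x + (0 : R) *: v))).
Proof.
by apply/funext => h; rewrite /= scale0r !addr0 (_ : h%:A = h) ?(addrC x)//; exact: mulr1.
Qed.

Lemma is_derive_lineP F x v l :
  is_derive x v F l <-> is_derive (0 : R) 1 (fun t : R => F (x + t *: v)) l.
Proof.
split=> -[] dF eF; split; move: dF eF; rewrite /derivable /derive;
  by rewrite difference_quotient_line.
Qed.

Lemma is_derive_line_at F x v (t l : R) : is_derive (x + t *: v) v F l ->
  is_derive t 1 (fun t : R => F (x + t *: v)) l.
Proof.
move=> /is_derive_lineP h.
have : is_derive ((fun s : R => s - t) t) 1 (fun t0 : R => F (x + t *: v + t0 *: v)) l.
  by rewrite /= subrr.
move=> h2; have := @is_derive1_comp _ _ (fun s : R => s - t) t _ _ h2 _.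
have hd : is_derive t 1 (fun s : R => s - t) (1 : R).
  by rewrite -[1 in X in is_derive _ _ _ X]subr0; apply: is_deriveB.
move=> /(_ _ hd); rewrite mulr1; congr is_derive.
apply/funext => s; rewrite /= -addrA -scalerDl; congr (F (_ + _ *: _)).
by rewrite addrC subrK.
Qed.

Lemma is_derive_chain (f : R -> R) F x v (a b : R) :
  is_derive (F x) 1 f a -> is_derive x v F b -> is_derive x v (fun y => f (F y)) (a * b).
Proof.
move=> fa /is_derive_lineP Fb; apply/is_derive_lineP.
have fa' : is_derive ((fun t : R => F (x + t *: v)) 0) 1 f a.
  by rewrite /= scale0r addr0.
exact: (is_derive1_comp fa' Fb).
Qed.

Lemma derivable_mean_value F x v (g : R * R -> R) :
  (forall y, is_derive y v F (g y)) -> forall h : R,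
  exists2 c : R, `|c| <= `|h| & F (x + h *: v) - F x = g (x + c *: v) * h.
Proof.
move=> dF h; pose f (t : R) := F (x + t *: v).
have df (t : R) : is_derive t 1 f (g (x + t *: v)) by exact: is_derive_line_at.
have cf : continuous f.
  move=> t; apply: differentiable_continuous; apply/derivable1_diffP.
  by have [] := df t.
have f0 : f 0 = F x by rewrite /f scale0r addr0.
have [h0|h0] := leP 0 h.
  have [c] := MVT_segment h0 (fun t _ => df t) (continuous_subspaceT cf).
  rewrite in_itv/= => /andP[c0 ch] E; exists c; first by rewrite !ger0_norm.
  by rewrite -f0 -[F _]/(f h) E subr0.
have [c] := MVT_segment (ltW h0) (fun t _ => df t) (continuous_subspaceT cf).
rewrite in_itv/= => /andP[ch c0] E; exists c.
  by rewrite !ler0_norm ?lerN2// ltW.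
by rewrite -f0 -[F _]/(f h) -opprB E sub0r mulrN opprK.
Qed.

Definition crd i x : R := if i == ord0 then x.1 else x.2.

Lemma ord2P i : i = ord0 \/ i = ord_max.
Proof. by case: i => -[|[|//]] ?; [left|right]; exact/val_inj. Qed.

Lemma is_derive_crd i j x :
  is_derive x (coord_dir R i) (crd j) ((i == j)%:R : R).
Proof.
apply/is_derive_lineP.
have -> : (fun t : R => crd j (x + t *: coord_dir R i)) =
    (fun t : R => crd j x + t * (i == j)%:R).
  apply/funext => t; rewrite /crd /coord_dir.
  by have [->|->] := ord2P i; have [->|->] := ord2P j => /=;
    rewrite ?[_ *: 1]mulr1 ?[_ *: 0]mulr0 ?mulr1 ?mulr0.
apply: is_derive_ext (is_derive_add (is_derive_const (crd j x) (0 : R) 1)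
  (is_derive_scale (i == j)%:R (is_derive_id (0 : R) 1))) => [t|].
  by rewrite mulrC.
by rewrite add0r mulr1.
Qed.

End DirectionalDerivative.

(** * Integrals of derivatives over the plane vanish *)

Section DerivativeIntegral.
Context {R : realType}.

Lemma coord_dir_affine (i : 'I_2) (h : R) (x : R * R) :
  plane_affine 1 (h *: coord_dir R i) x = x + h *: coord_dir R i.
Proof. by rewrite /plane_affine !mul1r [RHS]addrC. Qed.

Lemma coord_dir_norm (i : 'I_2) (c : R) :
  `|(c *: coord_dir R i).1| <= `|c| /\ `|(c *: coord_dir R i).2| <= `|c|.
Proof.
by have [->|->] := ord2P i; rewrite /= ?[_ *: 1]mulr1 ?[_ *: 0]mulr0 normr0 normr_ge0.
Qed.

(* Translation invariance makes the integral of every difference quotient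
   vanish. *)
Lemma Rintegral_partial0 (i : 'I_2) (F g : R * R -> R) (C : R) :
  (forall x, is_derive x (coord_dir R i) F (g x)) ->
  rintegrable (leb2 R) F -> (forall x, `|g x| <= C * weight x) ->
  rintegrable (leb2 R) g /\ Rintegral (leb2 R) setT g = 0.
Proof.
move=> dF iF gC.
have mF := rintegrable_measurable iF.
pose e n : R * R := (n.+1%:R^-1 : R) *: coord_dir R i.
pose q n (x : plane R) : R := n.+1%:R * (F (plane_affine 1 (e n) x) - F x).
have C0 : 0 <= C.
  rewrite -(pmulr_lge0 _ (weight_gt0 (0 : R * R))).
  exact: le_trans (normr_ge0 _) (gC 0).
have iq n : rintegrable (leb2 R) (q n).
  apply: rintegrableZ; under eq_fun do rewrite -mulN1r.
  apply: rintegrableD; last exact: rintegrableZ.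
  by apply: rintegrable_affine => //; exact: oner_neq0.
have q0 n : Rintegral (leb2 R) setT (q n) = 0.
  rewrite RintegralZl//; last first.
    under eq_fun do rewrite -mulN1r.
    apply: rintegrableD; last exact: rintegrableZ.
    by apply: rintegrable_affine => //; exact: oner_neq0.
  rewrite RintegralB//; last first.
    by apply: rintegrable_affine => //; exact: oner_neq0.
  rewrite [X in X - _](_ : _ = Rintegral (leb2 R) setT F) ?subrr ?mulr0//.
  by rewrite (Rintegral_affine (oner_neq0 R) (e n) iF) expr1n mul1r.
have cq x : q n x @[n --> \oo] --> g x.
  have [/cvg_ex[l hl] <-] := dF x.
  have -> : 'D_(coord_dir R i) F x = l by exact: cvg_lim hl.
  have /cvgr_dnbhsP/(_ (fun n => n.+1%:R^-1)) := hl.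
  have hn : (forall n, (n.+1%:R^-1 : R) != 0) /\ ((n.+1%:R^-1 : R) @[n --> \oo] --> (0 : R)).
    by split; [move=> n; rewrite invr_eq0 pnatr_eq0|exact: cvg_harmonic].
  move=> /(_ hn); apply: cvg_trans; apply: near_eq_cvg; apply: nearW => n.
  by rewrite /q invrK coord_dir_affine /= [x + _]addrC.
(* By the mean value theorem the quotient is a value of [g] at distance at most 1 along an axis,
   where the weight is at most 9 times its value at [x]. *)
have qC n x : `|q n x| <= 9 * C * weight x.
  rewrite /q coord_dir_affine.
  have [c ch ->] := derivable_mean_value x dF n.+1%:R^-1.
  rewrite mulrCA mulfV ?pnatr_eq0// mulr1.
  have c1 : `|c| <= 1.
    by rewrite (le_trans ch)// ger0_norm ?invr_ge0// invf_le1 ?ltr0n// ler1n.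
  apply: (le_trans (gC _)); rewrite (_ : 9 * C * _ = C * (9 * weight x)); last by ring.
  rewrite ler_wpM2l//.
  have [h1 h2] := coord_dir_norm i c.
  by apply: weight_shift; rewrite (le_trans h1, le_trans h2).
have mg : measurable_fun [set: plane R] g.
  apply: (@measurable_fun_cvg _ _ _ setT q) => [n|x _]; last exact: cq.
  exact: rintegrable_measurable (iq n).
have ig : rintegrable (leb2 R) g.
  apply: (rintegrable_le mg gC).
  apply: rintegrableZ; exact: rintegrable_weight.
split => //.
have [] := @cintegral_dominated _ _ _ (leb2 R) (fun n x => (q n x)%:C) (fun x => (g x)%:C)
  (fun x => 9 * C * weight x).
- by move=> n; apply: cmeasurable_real; exact: rintegrable_measurable (iq n).
- exact: cmeasurable_real.
- by apply: aeW => x; apply: ccvg_real; exact: cq.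
- by move=> n x; rewrite modulusR.
- by apply: rintegrableZ; exact: rintegrable_weight.
move=> _; under eq_fun do rewrite cintegral_real q0.
by rewrite cintegral_real => /(ccvg_uniq (ccvg_cst _))/(congr1 (@Re R)) /= <-.
Qed.

End DerivativeIntegral.

(** * Partial derivatives and continuity of complex functions *)

Section ComplexPartial.
Context {R : realType}.
Implicit Types (f g : R * R -> R[i]) (x : R * R) (i j : 'I_2) (z l m : R[i]).

Definition iC : R[i] := 0 +i* 1.

Lemma modulus_iC : modulus iC = 1.
Proof. by rewrite modulusE/= expr0n add0r expr1n sqrtr1. Qed.

Lemma iC_sqr : iC * iC = -1.
Proof. by apply: complexP; rewrite ?ReM ?ImM ?ReN ?ImN/=; ring. Qed.

Definition is_cpartial i f x l :=
  is_derive x (coord_dir R i) (fun y => Re (f y)) (Re l) /\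
  is_derive x (coord_dir R i) (fun y => Im (f y)) (Im l).

Lemma is_cpartial_ext i f g x l m :
  f =1 g -> l = m -> is_cpartial i f x l -> is_cpartial i g x m.
Proof. by move=> /funext -> ->. Qed.

Lemma is_cpartial_cst i z x : is_cpartial i (fun=> z) x 0.
Proof. by split; exact: is_derive_const. Qed.

Lemma is_cpartialD i f g x l m : is_cpartial i f x l -> is_cpartial i g x m ->
  is_cpartial i (fun y => f y + g y) x (l + m).
Proof.
move=> [fr fi] [gr gi]; split.
  by apply: is_derive_ext (is_derive_add fr gr) => [y|]; rewrite ReD.
by apply: is_derive_ext (is_derive_add fi gi) => [y|]; rewrite ImD.
Qed.

Lemma is_cpartialM i f g x l m : is_cpartial i f x l -> is_cpartial i g x m ->
  is_cpartial i (fun y => f y * g y) x (l * g x + f x * m).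
Proof.
move=> [fr fi] [gr gi]; split.
  apply: is_derive_ext (is_derive_sub (is_derive_mul fr gr) (is_derive_mul fi gi)) => [y|].
    by rewrite ReM.
  by rewrite ReD !ReM; ring.
apply: is_derive_ext (is_derive_add (is_derive_mul fr gi) (is_derive_mul fi gr)) => [y|].
  by rewrite ImM.
by rewrite ImD !ImM; ring.
Qed.

Lemma is_cpartialZ i f x z l : is_cpartial i f x l ->
  is_cpartial i (fun y => z * f y) x (z * l).
Proof.
move=> fl; apply: is_cpartial_ext (is_cpartialM (is_cpartial_cst i z x) fl) => //.
by rewrite mul0r add0r.
Qed.

Lemma is_cpartialJ i f x l : is_cpartial i f x l ->
  is_cpartial i (fun y => (f y)^*) x l^*.
Proof.
move=> [fr fi]; split; first by apply: is_derive_ext fr => [y|]; rewrite ReJ.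
by apply: is_derive_ext (is_derive_opp fi) => [y|]; rewrite ImJ.
Qed.

Lemma is_cpartial_real i (h : R * R -> R) x a :
  is_derive x (coord_dir R i) h a -> is_cpartial i (fun y => (h y)%:C) x a%:C.
Proof. by move=> ha; split => //; exact: is_derive_const. Qed.

Lemma is_cpartial_crd i j x :
  is_cpartial i (fun y => (crd j y)%:C) x ((i == j)%:R : R)%:C.
Proof. by apply: is_cpartial_real; exact: is_derive_crd. Qed.

Lemma is_cpartial_expi i (h : R * R -> R) x a :
  is_derive x (coord_dir R i) h a ->
  is_cpartial i (fun y => expi (h y)) x (iC * a%:C * expi (h x)).
Proof.
move=> ha; split => /=.
  apply: is_derive_ext (is_derive_chain (is_derive_cos (h x)) ha) => //.
  by rewrite ?ReM ?ImM/=; ring.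
apply: is_derive_ext (is_derive_chain (is_derive_sin (h x)) ha) => //.
by rewrite ?ReM ?ImM/=; ring.
Qed.

Lemma is_cpartial_affine i f (a : R) (y x : R * R) l :
  is_cpartial i f (plane_affine a y x) l ->
  is_cpartial i (fun x => f (plane_affine a y x)) x (a%:C * l).
Proof.
have E (t : R) : plane_affine a y (x + t *: coord_dir R i) =
    plane_affine a y x + (a * t) *: coord_dir R i.
  have [->|->] := ord2P i; rewrite /plane_affine/=; congr pair => /=;
    rewrite /= ?[_ *: 1]mulr1 ?[_ *: 0]mulr0; ring.
have lin : is_derive (0 : R) 1 (fun t : R => a * t) a.
  apply: is_derive_ext (is_derive_scale a (is_derive_id (0 : R) 1)) => //.
  by rewrite mulr1.
have main (h : R * R -> R) b : is_derive (plane_affine a y x) (coord_dir R i) h b ->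
    is_derive x (coord_dir R i) (fun x => h (plane_affine a y x)) (a * b).
  move=> /is_derive_lineP hb; apply/is_derive_lineP.
  under eq_fun do rewrite E.
  have hb' : is_derive (a * (0 : R)) 1 (fun t : R => h (plane_affine a y x + t *: coord_dir R i)) b.
    by rewrite mulr0.
  by apply: is_derive_ext (is_derive1_comp hb' lin) => //; rewrite mulrC.
move=> [fr fi]; split.
  by apply: is_derive_ext (main _ _ fr) => //; rewrite ReM/= mul0r subr0.
by apply: is_derive_ext (main _ _ fi) => //; rewrite ImM/= mul0r addr0.
Qed.

Lemma cintegral_partial0 i f g (C : R) :
  (forall x, is_cpartial i f x (g x)) -> cintegrable (leb2 R) f ->
  (forall x, modulus (g x) <= C * weight x) ->
  cintegrable (leb2 R) g /\ cintegral (leb2 R) g = 0.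
Proof.
move=> df [fr fi] gC.
have [ir r0] := Rintegral_partial0 (fun x => (df x).1) fr
  (fun x => le_trans (Re_le_modulus _) (gC x)).
have [ii i0] := Rintegral_partial0 (fun x => (df x).2) fi
  (fun x => le_trans (Im_le_modulus _) (gC x)).
by split => //; apply: complexP.
Qed.

Definition ccontinuous f :=
  continuous (fun x => Re (f x)) /\ continuous (fun x => Im (f x)).

Lemma ccontinuous_pmeasurable f : ccontinuous f -> pmeasurable f.
Proof. by move=> [fr fi]; split; exact: continuous_measurable_plane. Qed.

Lemma ccontinuousP f : ccontinuous f <-> forall x, ccvg (nbhs x) f (f x).
Proof.
split=> [[fr fi] x|fc]; first by split; [exact: fr|exact: fi].
by split => x; have [] := fc x.
Qed.

Lemma ccontinuousD f g : ccontinuous f -> ccontinuous g ->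
  ccontinuous (fun x => f x + g x).
Proof.
by move=> /ccontinuousP fc /ccontinuousP gc; apply/ccontinuousP => x; exact: ccvgD.
Qed.

Lemma ccontinuousM f g : ccontinuous f -> ccontinuous g ->
  ccontinuous (fun x => f x * g x).
Proof.
by move=> /ccontinuousP fc /ccontinuousP gc; apply/ccontinuousP => x; exact: ccvgM.
Qed.

Lemma ccontinuousJ f : ccontinuous f -> ccontinuous (fun x => (f x)^*).
Proof. by move=> /ccontinuousP fc; apply/ccontinuousP => x; exact: ccvgJ. Qed.

Lemma ccontinuous_cst z : ccontinuous (fun=> z).
Proof. by apply/ccontinuousP => x; exact: ccvg_cst. Qed.

Lemma ccontinuous_expi (h : R * R -> R) : continuous h ->
  ccontinuous (fun x => expi (h x)).
Proof. by move=> hc; apply/ccontinuousP => x; apply: ccvg_expi; exact: hc. Qed.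

Lemma ccontinuous_real (h : R * R -> R) : continuous h ->
  ccontinuous (fun x => (h x)%:C).
Proof. by move=> hc; apply/ccontinuousP => x; apply: ccvg_real; exact: hc. Qed.

Lemma continuous_crd i : continuous (crd i : R * R -> R).
Proof.
by rewrite /crd; case: (i == ord0) => x; [exact: cvg_fst|exact: cvg_snd].
Qed.

Lemma continuous_plane_affine a y :
  continuous (plane_affine a y : R * R -> R * R).
Proof.
move=> x; apply: (@cvg_pair _ _ _ _ (nbhs (y.1 + a * x.1)) (nbhs (y.2 + a * x.2)) _ _ _
    (fun x : R * R => y.1 + a * x.1) (fun x : R * R => y.2 + a * x.2)).
  by apply: cvgD; [exact: cvg_cst|apply: cvgMr; exact: cvg_fst].
by apply: cvgD; [exact: cvg_cst|apply: cvgMr; exact: cvg_snd].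
Qed.

Lemma ccontinuous_affine f a y : ccontinuous f ->
  ccontinuous (fun x => f (plane_affine a y x)).
Proof.
move=> [fr fi]; split => x.
  exact: (continuous_comp (@continuous_plane_affine a y x) (fr _)).
exact: (continuous_comp (@continuous_plane_affine a y x) (fi _)).
Qed.

End ComplexPartial.

Lemma weight_integrable {R : realType} (f : R * R -> R[i]) (M : R) : pmeasurable f ->
  (forall x, modulus (f x) <= M * weight x) -> cintegrable (leb2 R) f.
Proof.
move=> mf fM; apply: (@cintegrable_le _ _ _ (leb2 R) f _ mf fM).
by apply: rintegrableZ; exact: rintegrable_weight.
Qed.

(** * The Schwartz class by closure properties *)

Section SchwartzClass.
Context {R : realType}.
Implicit Types (f g h : R * R -> R[i]) (x k : R * R) (i : 'I_2) (z : R[i]).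

(* The Schwartz class as the greatest class of bounded continuous functions
   stable under multiplication by coordinates and partial derivatives: each
   closure property then reduces to exhibiting a stable class. *)
Definition stable (C : set (R * R -> R[i])) := forall f, C f ->
  [/\ ccontinuous f, exists M, forall x, modulus (f x) <= M,
      forall i, C (fun x => (crd i x)%:C * f x) &
      forall i, exists2 g, C g & forall x, is_cpartial i f x (g x)].

Definition sch f := exists2 C, stable C & C f.

Lemma sch_stable : stable sch.
Proof.
move=> f [C sC Cf]; have [fc fb fx fd] := sC _ Cf; split => //.
- by move=> i; exists C.
- by move=> i; have [g Cg fg] := fd i; exists g => //; exists C.
Qed.

Lemma sch_ccontinuous f : sch f -> ccontinuous f.
Proof. by case/sch_stable. Qed.

Lemma sch_bounded f : sch f -> exists M, forall x, modulus (f x) <= M.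
Proof. by case/sch_stable. Qed.

Lemma sch_crd f i : sch f -> sch (fun x => (crd i x)%:C * f x).
Proof. by case/sch_stable. Qed.

Lemma sch_partial f i : sch f ->
  exists2 g, sch g & forall x, is_cpartial i f x (g x).
Proof. by case/sch_stable. Qed.

Lemma sch_ext f g : f =1 g -> sch f -> sch g.
Proof. by move=> /funext ->. Qed.

Lemma schD f g : sch f -> sch g -> sch (fun x => f x + g x).
Proof.
move=> sf sg; exists [set h | exists f g, [/\ sch f, sch g & h = fun x => f x + g x]];
  last by exists f, g.
move=> _ [{sf}f [{sg}g [sf sg ->]]]; split.
- by apply: ccontinuousD; exact: sch_ccontinuous.
- have [M fM] := sch_bounded sf; have [N gN] := sch_bounded sg.
  by exists (M + N) => x; rewrite (le_trans (modulusD _ _))// lerD.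
- move=> i; exists (fun x => (crd i x)%:C * f x), (fun x => (crd i x)%:C * g x).
  by split; [exact: sch_crd|exact: sch_crd|apply/funext => x; rewrite mulrDr].
- move=> i; have [f' sf' ff'] := sch_partial i sf; have [g' sg' gg'] := sch_partial i sg.
  exists (fun x => f' x + g' x); first by exists f', g'.
  by move=> x; exact: is_cpartialD.
Qed.

Lemma schZ z f : sch f -> sch (fun x => z * f x).
Proof.
move=> sf; exists [set h | exists2 f, sch f & h = fun x => z * f x]; last by exists f.
move=> _ [{sf}f sf ->]; split.
- by apply: ccontinuousM; [exact: ccontinuous_cst|exact: sch_ccontinuous].
- have [M fM] := sch_bounded sf; exists (modulus z * M) => x.
  by rewrite modulusM ler_wpM2l// modulus_ge0.
- move=> i; exists (fun x => (crd i x)%:C * f x); first exact: sch_crd.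
  by apply/funext => x; rewrite mulrCA.
- move=> i; have [f' sf' ff'] := sch_partial i sf.
  exists (fun x => z * f' x); first by exists f'.
  by move=> x; exact: is_cpartialZ.
Qed.

Lemma schJ f : sch f -> sch (fun x => (f x)^*).
Proof.
move=> sf; exists [set h | exists2 f, sch f & h = fun x => (f x)^*]; last by exists f.
move=> _ [{sf}f sf ->]; split.
- by apply: ccontinuousJ; exact: sch_ccontinuous.
- by have [M fM] := sch_bounded sf; exists M => x; rewrite modulusJ.
- move=> i; exists (fun x => (crd i x)%:C * f x); first exact: sch_crd.
  by apply/funext => x; apply: complexP; rewrite !(ReM, ImM, ReJ, ImJ)/=; ring.
- move=> i; have [f' sf' ff'] := sch_partial i sf.
  exists (fun x => (f' x)^*); first by exists f'.
  by move=> x; exact: is_cpartialJ.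
Qed.

(** The Leibniz rule takes a product to a sum of two products, so the stable class for [schM] has to
    be the additive span of products. *)
Inductive product_span : (R * R -> R[i]) -> Prop :=
| span_mul f g : sch f -> sch g -> product_span (fun x => f x * g x)
| span_add f g : product_span f -> product_span g -> product_span (fun x => f x + g x).

Lemma schM f g : sch f -> sch g -> sch (fun x => f x * g x).
Proof.
move=> sf sg; exists product_span; last exact: span_mul.
move=> {f g sf sg} h; elim => [f g sf sg|f g _ [fc [M fM] fx fd] _ [gc [N gN] gx gd]].
  split.
  - by apply: ccontinuousM; exact: sch_ccontinuous.
  - have [M fM] := sch_bounded sf; have [N gN] := sch_bounded sg.
    by exists (M * N) => x; rewrite modulusM ler_pM// modulus_ge0.
  - move=> i; rewrite (_ : (fun x => _) = (fun x => ((crd i x)%:C * f x) * g x)).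
      by apply: span_mul => //; exact: sch_crd.
    by apply/funext => x; rewrite mulrA.
  - move=> i; have [f' sf' ff'] := sch_partial i sf; have [g' sg' gg'] := sch_partial i sg.
    exists (fun x => f' x * g x + f x * g' x).
      by apply: span_add; exact: span_mul.
    by move=> x; exact: is_cpartialM.
split.
- exact: ccontinuousD.
- by exists (M + N) => x; rewrite (le_trans (modulusD _ _))// lerD.
- move=> i; rewrite (_ : (fun x => _) = (fun x => (crd i x)%:C * f x + (crd i x)%:C * g x)).
    exact: span_add.
  by apply/funext => x; rewrite mulrDr.
- move=> i; have [f' sf' ff'] := fd i; have [g' sg' gg'] := gd i.
  exists (fun x => f' x + g' x); first exact: span_add.
  by move=> x; exact: is_cpartialD.
Qed.

Definition chirp (c : R) x : R[i] := expi (c * dot x x / 2).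

Lemma dot_crd x : dot x x = crd ord0 x * crd ord0 x + crd ord_max x * crd ord_max x.
Proof. by []. Qed.

Lemma is_derive_dot i x :
  is_derive x (coord_dir R i) (fun y : R * R => dot y y) (2 * crd i x).
Proof.
apply: is_derive_ext (is_derive_add
  (is_derive_mul (is_derive_crd i ord0 x) (is_derive_crd i ord0 x))
  (is_derive_mul (is_derive_crd i ord_max x) (is_derive_crd i ord_max x))) => //.
by have [->|->] := ord2P i; rewrite /=; ring.
Qed.

Lemma is_derive_chirp_phase (c : R) i x :
  is_derive x (coord_dir R i) (fun y : R * R => c * dot y y / 2) (c * crd i x).
Proof.
apply: is_derive_ext (is_derive_scale (c / 2) (is_derive_dot i x)) => [y|]; by field.
Qed.

Lemma is_cpartial_chirp (c : R) i x :
  is_cpartial i (chirp c) x (iC * (c * crd i x)%:C * chirp c x).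
Proof. by apply: is_cpartial_expi; exact: is_derive_chirp_phase. Qed.

Lemma continuous_dot : continuous (fun x : R * R => dot x x).
Proof.
by move=> x; apply: cvgD; apply: cvgM; first [exact: cvg_fst|exact: cvg_snd].
Qed.

Lemma continuous_chirp_phase (c : R) : continuous (fun x : R * R => c * dot x x / 2).
Proof.
move=> x; apply: cvgM; last exact: cvg_cst.
by apply: cvgM; [exact: cvg_cst|exact: continuous_dot].
Qed.

Lemma ccontinuous_chirp (c : R) : ccontinuous (chirp c).
Proof. by apply: ccontinuous_expi; exact: continuous_chirp_phase. Qed.

Lemma modulus_chirp (c : R) x : modulus (chirp c x) = 1.
Proof. exact: modulus_expi. Qed.

(** Differentiating the chirp only brings down a linear factor, which the Schwartz factor absorbs;
    hence the products of this one chirp with the class form a stable class. *)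
Lemma sch_chirp (c : R) f : sch f -> sch (fun x => chirp c x * f x).
Proof.
move=> sf; exists [set h | exists2 f, sch f & h = fun x => chirp c x * f x]; last by exists f.
move=> _ [{sf}f sf ->]; split.
- by apply: ccontinuousM; [exact: ccontinuous_chirp|exact: sch_ccontinuous].
- have [M fM] := sch_bounded sf; exists M => x.
  by rewrite modulusM modulus_chirp mul1r.
- move=> i; exists (fun x => (crd i x)%:C * f x); first exact: sch_crd.
  by apply/funext => x; rewrite mulrCA.
- move=> i; have [f' sf' ff'] := sch_partial i sf.
  exists (fun x => chirp c x * ((iC * c%:C) * ((crd i x)%:C * f x) + f' x)).
    by eexists; last reflexivity; apply: schD => //; apply: schZ; exact: sch_crd.
  move=> x; apply: is_cpartial_ext (is_cpartialM (is_cpartial_chirp c i x) (ff' x)) => //.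
  by rewrite RCM; ring.
Qed.

Lemma sch_affine (a : R) (y : R * R) f : a != 0 -> sch f ->
  sch (fun x => f (plane_affine a y x)).
Proof.
move=> a0 sf; exists [set h | exists2 f, sch f & h = fun x => f (plane_affine a y x)];
  last by exists f.
move=> _ [{sf}f sf ->]; split.
- by apply: ccontinuous_affine; exact: sch_ccontinuous.
- by have [M fM] := sch_bounded sf; exists M => x.
(* A coordinate of [x] is an affine function of the same coordinate of [plane_affine a y x]; this is
   where [a != 0] enters. *)
- move=> i; exists (fun x => (a^-1)%:C * ((crd i x)%:C * f x) + (- (crd i y) / a)%:C * f x).
    by apply: schD; apply: schZ => //; exact: sch_crd.
  apply/funext => x; rewrite (_ : crd i (plane_affine a y x) = crd i y + a * crd i x); last first.
    by rewrite /crd; case: ifP.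
  rewrite mulrA -mulrDl -RCM -RCD; congr (_%:C * _); by field.
- move=> i; have [f' sf' ff'] := sch_partial i sf.
  exists (fun x => a%:C * f' (plane_affine a y x)).
    by exists (fun x => a%:C * f' x) => //; exact: schZ.
  by move=> x; exact: is_cpartial_affine.
Qed.

Lemma sch_inv_weight f : sch f -> sch (fun x => ((weight x)^-1)%:C * f x).
Proof.
move=> sf.
have s0 := sch_crd ord0 (sch_crd ord0 sf).
have s1 := schD sf s0.
apply: sch_ext (schD s1 (sch_crd ord_max (sch_crd ord_max s1))) => x.
by rewrite /weight /weight1 invfM !invrK RCM !RCD !expr2 !RCM /crd/=; ring.
Qed.

Lemma sch_decay f : sch f -> exists2 M, 0 <= M & forall x, modulus (f x) <= M * weight x.
Proof.
move=> sf; have [M fM] := sch_bounded (sch_inv_weight sf); exists M => [|x].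
  exact: le_trans (modulus_ge0 _) (fM 0).
rewrite -ler_pdivrMr ?weight_gt0//; apply: le_trans (fM x).
by rewrite modulusM modulusR ger0_norm; [rewrite mulrC|rewrite invr_ge0 ltW// weight_gt0].
Qed.

Lemma sch_integrable f : sch f -> cintegrable (leb2 R) f.
Proof.
move=> sf; have [M _ fM] := sch_decay sf.
apply: (weight_integrable _ fM).
by apply: ccontinuous_pmeasurable; exact: sch_ccontinuous.
Qed.

End SchwartzClass.

(** * The Fourier transform: exchange rules and multiplication formula *)

Section FourierBasics.
Context {R : realType}.
Implicit Types (f g h : R * R -> R[i]) (x y k : R * R) (i : 'I_2) (z : R[i]).

Lemma le_of_eq (a b : R) : a = b -> a <= b. Proof. by move=> ->. Qed.

Lemma eq_plane_cintegral f g : f =1 g -> cintegral (leb2 R) f = cintegral (leb2 R) g.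
Proof. by move=> /funext ->. Qed.

Lemma dotC x y : dot x y = dot y x.
Proof. by rewrite /dot mulrC (mulrC x.2). Qed.

Lemma dotDr k x y : dot k (x + y) = dot k x + dot k y.
Proof. by rewrite /dot /=; ring. Qed.

Lemma dotNr k x : dot k (- x) = - dot k x.
Proof. by rewrite /dot /=; ring. Qed.

Lemma dotZr k (a : R) x : dot k (a *: x) = a * dot k x.
Proof.
transitivity (k.1 * (a * x.1) + k.2 * (a * x.2)); first by [].
by rewrite /dot; ring.
Qed.

Lemma dot_coord_dir k i : dot k (coord_dir R i) = crd i k.
Proof. by have [->|->] := ord2P i; rewrite /dot /crd /=; ring. Qed.

Lemma is_derive_dotr k i x :
  is_derive x (coord_dir R i) (fun x => dot k x) (crd i k).
Proof.
apply: is_derive_ext (is_derive_add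
  (is_derive_scale k.1 (is_derive_crd i ord0 x))
  (is_derive_scale k.2 (is_derive_crd i ord_max x))) => //.
by have [->|->] := ord2P i; rewrite /crd /=; ring.
Qed.

Lemma continuous_dotr k : continuous (fun x : R * R => dot k x).
Proof.
by move=> x; apply: cvgD; apply: cvgMr; first [exact: cvg_fst|exact: cvg_snd].
Qed.

Lemma pmeasurable_wave k : pmeasurable (fun x : R * R => expi (dot k x)).
Proof.
by apply: ccontinuous_pmeasurable; apply: ccontinuous_expi; exact: continuous_dotr.
Qed.

Lemma pmeasurable_waveN k : pmeasurable (fun x : R * R => expi (- dot k x)).
Proof.
apply: ccontinuous_pmeasurable; apply: ccontinuous_expi => x.
by apply: cvgN; exact: continuous_dotr.
Qed.

Lemma cintegrable_waveM k f : cintegrable (leb2 R) f ->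
  cintegrable (leb2 R) (fun x => expi (- dot k x) * f x).
Proof.
apply: (@cintegrable_bounded_mul _ _ _ _ _ _ 1); first exact: pmeasurable_waveN.
by move=> x; rewrite modulus_expi.
Qed.

Lemma cintegrable_wave k f : cintegrable (leb2 R) f ->
  cintegrable (leb2 R) (fun x => expi (dot k x) * f x).
Proof.
apply: (@cintegrable_bounded_mul _ _ _ _ _ _ 1); first exact: pmeasurable_wave.
by move=> x; rewrite modulus_expi.
Qed.

Lemma modulus_fourier f k : cintegrable (leb2 R) f ->
  modulus (fourier f k) <= Rintegral (leb2 R) setT (fun x => modulus (f x)).
Proof.
move=> fi; apply: le_trans (modulus_cintegral (cintegrable_waveM k fi)) _.
apply: le_of_eq; apply: eq_Rintegral => x _.
by rewrite modulusM modulus_expi mul1r.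
Qed.

Lemma fourierD f g k : cintegrable (leb2 R) f -> cintegrable (leb2 R) g ->
  fourier (fun x => f x + g x) k = fourier f k + fourier g k.
Proof.
move=> fi gi; rewrite -cintegralD; try exact: cintegrable_waveM.
by apply: eq_cintegral => x; rewrite mulrDr.
Qed.

Lemma fourierZ z f k : cintegrable (leb2 R) f ->
  fourier (fun x => z * f x) k = z * fourier f k.
Proof.
move=> fi; rewrite -cintegralZ; last exact: cintegrable_waveM.
by apply: eq_cintegral => x; rewrite mulrCA.
Qed.

(** Integration by parts, read off from the vanishing integral of the derivative of
    [expi (- dot k x) * f x]. Bounds by [weight] replace Schwartz regularity so that the rule also
    covers the scattered field in [fourier_integrable]. *)
Lemma fourier_partial i f g (C : R) k : cintegrable (leb2 R) f ->
  (forall x, is_cpartial i f x (g x)) ->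
  (forall x, modulus (f x) <= C * weight x) ->
  (forall x, modulus (g x) <= C * weight x) -> pmeasurable g ->
  fourier g k = iC * (crd i k)%:C * fourier f k.
Proof.
move=> fi fg fC gC mg.
have gi : cintegrable (leb2 R) g by exact: (weight_integrable mg gC).
have dw x : is_cpartial i (fun x => expi (- dot k x) * f x) x
    ((iC * (- crd i k)%:C) * (expi (- dot k x) * f x) + expi (- dot k x) * g x).
  apply: is_cpartial_ext (is_cpartialM (is_cpartial_expi
    (is_derive_opp (is_derive_dotr k i x))) (fg x)) => //.
  by rewrite mulrA.
have dC x : modulus (iC * (- crd i k)%:C * (expi (- dot k x) * f x) +
    expi (- dot k x) * g x) <= (`|crd i k| * C + C) * weight x.
  apply: le_trans (modulusD _ _) _.
  rewrite !modulusM modulus_expi modulus_iC modulusR normrN !mul1r mulrDl lerD//.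
  by rewrite -mulrA ler_wpM2l.
have [_] := cintegral_partial0 dw (cintegrable_waveM k fi) dC.
rewrite cintegralD; [|exact/cintegrableZ/cintegrable_waveM|exact: cintegrable_waveM].
rewrite cintegralZ; last exact: cintegrable_waveM.
move=> h; have : iC * (- crd i k)%:C * fourier f k + fourier g k = 0 := h.
by move/eqP; rewrite addrC addr_eq0 => /eqP ->; rewrite RCN mulrN mulNr opprK.
Qed.

Lemma mean_value0 (f df : R -> R) : (forall t : R, is_derive t 1 f (df t)) ->
  forall h : R, exists2 c : R, `|c| <= `|h| & f h - f 0 = df c * h.
Proof.
move=> fdf h.
have cf : continuous f.
  move=> t; apply: differentiable_continuous; apply/derivable1_diffP.
  by have [] := fdf t.
have [h0|h0] := leP 0 h.
  have [c] := MVT_segment h0 (fun t _ => fdf t) (continuous_subspaceT cf).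
  rewrite in_itv/= subr0 => /andP[c0 ch] E; exists c => //.
  by rewrite !ger0_norm.
have [c] := MVT_segment (ltW h0) (fun t _ => fdf t) (continuous_subspaceT cf).
rewrite in_itv/= => /andP[ch c0] E; exists c.
  by rewrite !ler0_norm ?lerN2// ltW.
by rewrite -opprB E sub0r mulrN opprK.
Qed.

Lemma sin_norm_le (t : R) : `|sin t| <= `|t|.
Proof.
have [c _] := mean_value0 (@is_derive_sin R) t; rewrite sin0 subr0 => ->.
by rewrite normrM ler_piMl// ler_norml cos_geN1 cos_le1.
Qed.

Lemma cosB1_norm_le1 (t : R) : `|cos t - 1| <= `|t|.
Proof.
have [c _] := mean_value0 (@is_derive_cos R) t; rewrite cos0 => ->.
by rewrite normrM normrN ler_piMl// ler_norml sin_geN1 sin_le1.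
Qed.

Lemma cosB1_norm_le2 (t : R) : `|cos t - 1| <= t ^+ 2.
Proof.
have [c ct] := mean_value0 (@is_derive_cos R) t; rewrite cos0 => ->.
rewrite normrM normrN -(real_normK (num_real t)) expr2 ler_wpM2r//.
exact: le_trans (sin_norm_le _) ct.
Qed.

Lemma sinBid_norm_le2 (t : R) : `|sin t - t| <= t ^+ 2.
Proof.
have ds (s : R) : is_derive s 1 (fun s => sin s - s) (cos s - 1).
  by apply: is_derive_sub.
have [c ct] := mean_value0 ds t; rewrite sin0 !subr0 => ->.
rewrite normrM -(real_normK (num_real t)) expr2 ler_wpM2r//.
exact: le_trans (cosB1_norm_le1 _) ct.
Qed.

Lemma modulus_expiB1 (t : R) : modulus (expi t - 1) <= 2 * `|t|.
Proof.
apply: le_trans (modulus_leD _) _; rewrite /= oppr0 addr0 mulr2n mulrDl mul1r.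
by rewrite lerD// ?cosB1_norm_le1 ?sin_norm_le.
Qed.

(** Two applications of the mean value theorem give a second-order remainder. The constant is crude,
    but [is_derive_quadratic] asks only for a quadratic order. *)
Lemma modulus_expi_taylor (t : R) : modulus (expi t - 1 - iC * t%:C) <= 2 * t ^+ 2.
Proof.
apply: le_trans (modulus_leD _) _.
rewrite (_ : Re _ = cos t - 1); last by rewrite !(ReD, ReN, ReM)/=; ring.
rewrite (_ : Im _ = sin t - t); last by rewrite !(ImD, ImN, ImM)/=; ring.
by rewrite mulr2n mulrDl mul1r lerD// ?cosB1_norm_le2 ?sinBid_norm_le2.
Qed.

Lemma is_derive_quadratic (F : R * R -> R) x v (l B : R) :
  (forall t : R, `|F (x + t *: v) - F x - t * l| <= B * t ^+ 2) -> is_derive x v F l.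
Proof.
move=> FB; apply/is_derive_lineP.
have cv : (fun h : R => h^-1 *: (((fun t : R => F (x + t *: v)) \o shift (0 : R)) (h *: (1 : R))
     - F (x + (0 : R) *: v))) @ 0^' --> l.
  apply/cvgrPdist_le => e e0.
  have B0 : 0 <= B by have := FB 1; rewrite expr1n mulr1; apply: le_trans.
  near=> h.
  have h0 : h != 0 by near: h; exact: nbhs_dnbhs_neq.
  rewrite /= scale0r !addr0 (_ : h%:A = h); last exact: mulr1.
  have -> : l - h^-1 *: (F (x + h *: v) - F x) =
      - (h^-1 * (F (x + h *: v) - F x - h * l)).
    by rewrite [in RHS]mulrBr mulrA mulVf// mul1r opprB.
  rewrite normrN normrM normfV mulrC ler_pdivrMr ?normr_gt0//.
  apply: le_trans (FB h) _.
  rewrite -(real_normK (num_real h)) expr2 mulrA ler_wpM2r//.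
  (* Dividing by [B + 1] avoids the case [B = 0]. *)
  have hd : `|h| <= e / (B + 1).
    by near: h; apply: dnbhs0_le; rewrite divr_gt0// ltr_wpDl.
  apply: (@le_trans _ _ (B * (e / (B + 1)))); first by rewrite ler_wpM2l.
  by rewrite mulrCA ler_piMr ?(ltW e0)// ler_pdivrMr ?ltr_wpDl// mul1r lerDl.
split; first by apply/cvg_ex; exists l.
exact: cvg_lim cv.
Unshelve. all: by end_near. Qed.

(** Differentiation under the integral sign with an explicit remainder: the second moment of [q]
    controls it. It is used with [q] minus a coordinate for the derivative of a transform, and with
    [q x = - |x|^2 / 2] for a Gaussian integral as a function of its imaginary parameter. *)
Lemma phase_integral_taylor (q : R * R -> R) f : continuous q ->
  cintegrable (leb2 R) f ->
  cintegrable (leb2 R) (fun x => (q x)%:C * f x) ->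
  cintegrable (leb2 R) (fun x => (q x)%:C * ((q x)%:C * f x)) ->
  exists B : R, forall t : R,
  modulus (cintegral (leb2 R) (fun x => expi (t * q x) * f x) - cintegral (leb2 R) f
    - t%:C * cintegral (leb2 R) (fun x => iC * ((q x)%:C * f x))) <= B * t ^+ 2.
Proof.
move=> qc f0 f1 f2.
exists (Rintegral (leb2 R) setT (fun x => 2 * modulus ((q x)%:C * ((q x)%:C * f x)))) => t.
pose r x := (expi (t * q x) - 1 - iC * (t * q x)%:C) * f x.
have rE x : expi (t * q x) * f x + ((-1) * f x + (- t%:C) * (iC * ((q x)%:C * f x))) = r x.
  by rewrite /r RCM; ring.
have i1 : cintegrable (leb2 R) (fun x => expi (t * q x) * f x).
  apply: (@cintegrable_bounded_mul _ _ _ _ _ _ 1) f0 => [|x]; last by rewrite modulus_expi.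
  apply: ccontinuous_pmeasurable; apply: ccontinuous_expi => x.
  by apply: cvgM; [exact: cvg_cst|exact: qc].
have i3 : cintegrable (leb2 R) (fun x => iC * ((q x)%:C * f x)) by exact: cintegrableZ.
have ri : cintegrable (leb2 R) r.
  rewrite (_ : r = fun x => expi (t * q x) * f x
      + ((-1) * f x + (- t%:C) * (iC * ((q x)%:C * f x))));
    last by apply/funext => x; rewrite rE.
  by apply: cintegrableD => //; apply: cintegrableD; exact: cintegrableZ.
rewrite [X in modulus X](_ : _ = cintegral (leb2 R) r); last first.
  rewrite -(eq_plane_cintegral rE) cintegralD//; last first.
    by apply: cintegrableD; exact: cintegrableZ.
  rewrite cintegralD; [|exact: cintegrableZ|exact: cintegrableZ].
  by rewrite !(cintegralZ _ f0) !(cintegralZ _ i3) mulN1r mulNr addrA.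
apply: le_trans (modulus_cintegral ri) _.
rewrite mulrC -RintegralZl//; last first.
  by apply: rintegrableZ; exact: cintegrable_modulus.
apply: le_Rintegral => //.
- exact: cintegrable_modulus.
- by apply: rintegrableZ; apply: rintegrableZ; exact: cintegrable_modulus.
- move=> x _; rewrite /r !modulusM !modulusR.
  apply: le_trans (ler_wpM2r (modulus_ge0 _) (modulus_expi_taylor _)) _.
  rewrite exprMn -(real_normK (num_real (q x))).
  by apply: le_of_eq; ring.
Qed.

Lemma is_cpartial_quadratic i f x (l : R[i]) (B : R) :
  (forall t : R, modulus (f (x + t *: coord_dir R i) - f x - t%:C * l) <= B * t ^+ 2) ->
  is_cpartial i f x l.
Proof.
move=> bound; split; apply: (is_derive_quadratic (B := B)) => t; apply: le_trans (bound t).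
  apply: le_trans (Re_le_modulus _); apply: le_of_eq; congr `|_|.
  by rewrite !(ReD, ReN, ReM)/= mul0r subr0.
apply: le_trans (Im_le_modulus _); apply: le_of_eq; congr `|_|.
by rewrite !(ImD, ImN, ImM)/= mul0r addr0.
Qed.

Lemma fourier_deriv i f k : cintegrable (leb2 R) f ->
  cintegrable (leb2 R) (fun x => (crd i x)%:C * f x) ->
  cintegrable (leb2 R) (fun x => (crd i x)%:C * ((crd i x)%:C * f x)) ->
  is_cpartial i (fourier f) k (fourier (fun x => - iC * ((crd i x)%:C * f x)) k).
Proof.
move=> f0 f1 f2; pose u x := expi (- dot k x) * f x.
have u1 : cintegrable (leb2 R) (fun x => (- crd i x)%:C * u x).
  rewrite (_ : (fun x => _) = fun x => (-1) * (expi (- dot k x) * ((crd i x)%:C * f x))).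
    by apply: cintegrableZ; exact: cintegrable_waveM.
  by apply/funext => x; rewrite /u RCN; ring.
have u2 : cintegrable (leb2 R) (fun x => (- crd i x)%:C * ((- crd i x)%:C * u x)).
  rewrite (_ : (fun x => _) = fun x => expi (- dot k x) * ((crd i x)%:C * ((crd i x)%:C * f x))).
    exact: cintegrable_waveM.
  by apply/funext => x; rewrite /u RCN; ring.
have qc : continuous (fun x : R * R => - crd i x).
  by move=> x; apply: cvgN; exact: continuous_crd.
have [B bound] := phase_integral_taylor qc (cintegrable_waveM k f0) u1 u2.
apply: (is_cpartial_quadratic (B := B)) => t; apply: le_trans (bound t).
apply: le_of_eq; congr modulus; congr (_ - _ - _ * _); apply: eq_plane_cintegral => x.
  rewrite dotC dotDr dotZr dot_coord_dir opprD addrC expiD (dotC x k) mulrN.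
  by rewrite mulrA.
by rewrite /u RCN; ring.
Qed.

Lemma fourier_continuous f : cintegrable (leb2 R) f ->
  cintegrable (leb2 R) (fun x => (crd ord0 x)%:C * f x) ->
  cintegrable (leb2 R) (fun x => (crd ord_max x)%:C * f x) ->
  ccontinuous (fourier f).
Proof.
move=> f0 f1 f2; apply/ccontinuousP => k; apply/ccvg_modulusP.
pose B i := Rintegral (leb2 R) setT (fun x => modulus ((crd i x)%:C * f x)).
pose b k' := 2 * (`|(k' - k).1| * B ord0 + `|(k' - k).2| * B ord_max).
have bound k' : modulus (fourier f k' - fourier f k) <= b k'.
  pose r x := (expi (- dot (k' - k) x) - 1) * (expi (- dot k x) * f x).
  have rE x : expi (- dot k' x) * f x + (-1) * (expi (- dot k x) * f x) = r x.
    rewrite /r -{1}(subrK k k') dotC dotDr dotC (dotC x k) opprD expiD; ring.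
  have i1 := cintegrable_waveM k' f0; have i2 := cintegrable_waveM k f0.
  have ri : cintegrable (leb2 R) r.
    rewrite (_ : r = fun x => expi (- dot k' x) * f x + (-1) * (expi (- dot k x) * f x));
      last by apply/funext => x; rewrite rE.
    by apply: cintegrableD => //; exact: cintegrableZ.
  have -> : fourier f k' - fourier f k = cintegral (leb2 R) r.
    rewrite -(eq_plane_cintegral rE) cintegralD//; last exact: cintegrableZ.
    by rewrite cintegralZ// mulN1r.
  apply: le_trans (modulus_cintegral ri) _.
  have m1 := cintegrable_modulus f1; have m2 := cintegrable_modulus f2.
  rewrite /b /B -!RintegralZl// -RintegralD//; try exact: rintegrableZ.
  rewrite -RintegralZl//; last by apply: rintegrableD; exact: rintegrableZ.
  apply: le_Rintegral => //.
  - exact: cintegrable_modulus.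
  - by apply: rintegrableZ; apply: rintegrableD; exact: rintegrableZ.
  - move=> x _; rewrite /r !modulusM modulus_expi mul1r !modulusR.
    apply: le_trans (ler_wpM2r (modulus_ge0 _) (modulus_expiB1 _)) _.
    rewrite normrN -mulrA ler_wpM2l// !mulrA -mulrDl ler_wpM2r ?modulus_ge0//.
    by rewrite -!normrM; exact: ler_normD.
have b0 : b k' @[k' --> k] --> (0 : R).
  have n1 : `|(k' - k).1| @[k' --> k] --> (0 : R).
    rewrite -(normr0 R); apply: cvg_norm; rewrite -(subrr k.1).
    by apply: cvgB; [exact: cvg_fst|exact: cvg_cst].
  have n2 : `|(k' - k).2| @[k' --> k] --> (0 : R).
    rewrite -(normr0 R); apply: cvg_norm; rewrite -(subrr k.2).
    by apply: cvgB; [exact: cvg_snd|exact: cvg_cst].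
  have : b k' @[k' --> k] --> 2 * (0 * B ord0 + 0 * B ord_max).
    by apply: cvgM; [exact: cvg_cst|apply: cvgD; apply: cvgM => //; exact: cvg_cst].
  by rewrite !mul0r addr0 mulr0.
apply: (@squeeze_cvgr _ _ _ _ (cst 0) b) => //; last exact: cvg_cst.
by apply: nearW => k'; rewrite modulus_ge0 bound.
Qed.

(** The transforms form a stable class: multiplication by [k_i] comes from a derivative of [f], and
    a derivative in [k_i] from multiplication by [x_i]. *)
Lemma sch_fourier f : sch f -> sch (fourier f).
Proof.
move=> sf; exists [set h | exists2 f, sch f & h = fourier f]; last by exists f.
move=> _ [{sf}f sf ->]; split.
- apply: fourier_continuous; apply: sch_integrable => //; exact: sch_crd.
- eexists => k; exact: (modulus_fourier k (sch_integrable sf)).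
- move=> i; have [g sg fg] := sch_partial i sf.
  exists (fun x => - iC * g x); first exact: schZ.
  apply/funext => k; rewrite fourierZ; last exact: sch_integrable.
  have [C1 C10 fC] := sch_decay sf; have [C2 C20 gC] := sch_decay sg.
  rewrite (@fourier_partial i f g (C1 + C2)) => [|||x|x|].
  + by rewrite !mulrA mulNr iC_sqr opprK mul1r.
  + exact: sch_integrable.
  + exact: fg.
  + by rewrite (le_trans (fC x))// ler_wpM2r ?lerDl// ltW// weight_gt0.
  + by rewrite (le_trans (gC x))// ler_wpM2r ?lerDr// ltW// weight_gt0.
  + by apply: ccontinuous_pmeasurable; exact: sch_ccontinuous.
- move=> i; exists (fourier (fun x => - iC * ((crd i x)%:C * f x))).
    by eexists; last reflexivity; apply: schZ; exact: sch_crd.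
  move=> k; apply: fourier_deriv; apply: sch_integrable => //; do ?exact: sch_crd.
  by do 2 apply: sch_crd.
Qed.

Lemma pmeasurable_wave2 : @cmeasurable _ (plane R * plane R)%type R
  (fun z : plane R * plane R => expi (- @dot R z.1 z.2)).
Proof.
apply: cmeasurable_expi; apply: measurableT_comp => //.
have m11 : measurable_fun [set: plane R * plane R] (fun u => u.1.1 : measurableTypeR R).
  exact: (measurableT_comp measurable_fst measurable_fst).
have m12 : measurable_fun [set: plane R * plane R] (fun u => u.1.2 : measurableTypeR R).
  exact: (measurableT_comp measurable_snd measurable_fst).
have m21 : measurable_fun [set: plane R * plane R] (fun u => u.2.1 : measurableTypeR R).
  exact: (measurableT_comp measurable_fst measurable_snd).
have m22 : measurable_fun [set: plane R * plane R] (fun u => u.2.2 : measurableTypeR R).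
  exact: (measurableT_comp measurable_snd measurable_snd).
by apply: measurable_funD; exact: measurable_funM.
Qed.

(** Fubini yields measurability of an inner integral, but asks for integrability in [k] as well; the
    weight in [k] supplies it and is divided out afterwards. *)
Lemma fourier_measurable f : cintegrable (leb2 R) f -> pmeasurable (fourier f).
Proof.
move=> fi.
have mw : pmeasurable (fun k : R * R => (weight k)%:C).
  by apply: cmeasurable_real; exact: rintegrable_measurable rintegrable_weight.
have mwV : pmeasurable (fun k : R * R => ((weight k)^-1)%:C).
  apply: ccontinuous_pmeasurable; apply: ccontinuous_real.
  rewrite /weight /weight1; under eq_fun do rewrite invfM !invrK.
  by move=> x; apply: cvgM; (apply: cvgD; [exact: cvg_cst|]; rewrite expr2; apply: cvgM; first [exact: cvg_fst|exact: cvg_snd]).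
have mf := cintegrable_measurable fi.
have mj : @cmeasurable _ (plane R * plane R)%type R
    (fun u => (weight u.1)%:C * (expi (- @dot R u.1 u.2) * f u.2)).
  apply: cmeasurableM; first exact: (cmeasurable_comp measurable_fst mw).
  by apply: cmeasurableM; [exact: pmeasurable_wave2|exact: (cmeasurable_comp measurable_snd mf)].
have bd k x : modulus ((weight k)%:C * (expi (- dot k x) * f x)) <= weight k * modulus (f x).
  by rewrite !modulusM modulus_expi mul1r modulusR ger0_norm// ltW// weight_gt0.
have h := cintegrable_measurable (plane_fubini_integrable mj rintegrable_weight
  (cintegrable_modulus fi) bd).
have -> : fourier f = fun k => ((weight k)^-1)%:C *
    cintegral (leb2 R) (fun x => (weight k)%:C * (expi (- dot k x) * f x)).
  apply/funext => k; rewrite cintegralZ; last exact: cintegrable_waveM.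
  by rewrite mulrA -RCM mulVf ?mul1r// gt_eqF// weight_gt0.
exact: cmeasurableM.
Qed.

(** The multiplication formula, with a translation by [x] built in. Inversion, the Fresnel
    convolution, the square bound and the autocorrelation identity all start from it. *)
Lemma fourier_mul f g x : cintegrable (leb2 R) f -> cintegrable (leb2 R) g ->
  cintegral (leb2 R) (fun k => expi (dot k x) * (g k * fourier f k)) =
  cintegral (leb2 R) (fun y => f y * fourier g (y - x)).
Proof.
move=> fi gi.
have mf := cintegrable_measurable fi; have mg := cintegrable_measurable gi.
transitivity (cintegral (leb2 R) (fun k => cintegral (leb2 R)
    (fun y => (expi (dot k x) * g k) * (expi (- dot k y) * f y)))).
  apply: eq_plane_cintegral => k; rewrite cintegralZ; last exact: cintegrable_waveM.
  by rewrite mulrA.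
rewrite (@plane_fubini R _ (fun k => modulus (g k)) (fun y => modulus (f y))).
- apply: eq_plane_cintegral => y; rewrite -cintegralZ; last exact: cintegrable_waveM.
  apply: eq_plane_cintegral => k.
  rewrite (_ : - dot (y - x) k = dot k x - dot k y); last by rewrite /dot/=; ring.
  by rewrite expiD; ring.
- apply: cmeasurableM; last first.
    by apply: cmeasurableM; [exact: pmeasurable_wave2|exact: (cmeasurable_comp measurable_snd mf)].
  apply: (@cmeasurable_comp _ _ _ _ _ (fun k : plane R => expi (dot k x) * g k) fst).
    exact: measurable_fst.
  apply: cmeasurableM => //.
  have := pmeasurable_wave x; congr cmeasurable; apply/funext => k; by rewrite dotC.
- exact: cintegrable_modulus.
- exact: cintegrable_modulus.
- by move=> k y; rewrite !modulusM !modulus_expi !mul1r.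
Qed.

End FourierBasics.

(** * Complex Gaussians: integral and transform *)

Section Gaussian.
Context {R : realType}.
Implicit Types (f g h : R * R -> R[i]) (x y k : R * R) (i : 'I_2) (d a : R).

Definition rgauss d x : R := expR (- (d * dot x x / 2)).

(* exp (- (d + i a) |x|^2 / 2) *)
Definition gauss d a x : R[i] := chirp (- a) x * (rgauss d x)%:C.

Lemma dot_ge0 x : 0 <= dot x x.
Proof. by rewrite addr_ge0// -expr2 sqr_ge0. Qed.

Lemma rgauss_gt0 d x : 0 < rgauss d x.
Proof. exact: expR_gt0. Qed.

Lemma rgauss_le1 d x : 0 <= d -> rgauss d x <= 1.
Proof. by move=> d0; rewrite -expR0 ler_expR oppr_le0 divr_ge0// mulr_ge0// dot_ge0. Qed.

Lemma modulus_gauss d a x : modulus (gauss d a x) = rgauss d x.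
Proof. by rewrite modulusM modulus_chirp mul1r modulusR gtr0_norm// rgauss_gt0. Qed.

Lemma is_derive_rgauss d i x :
  is_derive x (coord_dir R i) (rgauss d) (- (d * crd i x) * rgauss d x).
Proof.
apply: is_derive_ext (is_derive_chain (is_derive_expR _)
  (is_derive_opp (is_derive_chirp_phase d i x))) => //.
by rewrite mulrC.
Qed.

Lemma continuous_rgauss d : continuous (rgauss d).
Proof.
move=> x; apply: (continuous_comp (f := fun x : R * R => - (d * dot x x / 2))).
  by apply: cvgN; exact: continuous_chirp_phase.
exact: continuous_expR.
Qed.

Lemma is_cpartial_rgauss d i x :
  is_cpartial i (fun x => (rgauss d x)%:C) x (- d%:C * ((crd i x)%:C * (rgauss d x)%:C)).
Proof.
apply: is_cpartial_ext (is_cpartial_real (is_derive_rgauss d i x)) => //.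
by rewrite RCM RCN RCM; ring.
Qed.

Lemma rgaussD d1 d2 x : rgauss (d1 + d2) x = rgauss d1 x * rgauss d2 x.
Proof. by rewrite -expRD; congr expR; ring. Qed.

Lemma crd_rgauss_bounded i d : 0 < d -> exists M, forall x, `|crd i x| * rgauss d x <= M.
Proof.
(* With [q = dot x x] one has [(1 + 2 / d)(1 + d q / 2) >= 1 + q >= |x_i|], and the second factor is
   below the reciprocal Gaussian because [expR u >= 1 + u]. *)
move=> d0; exists (1 + 2 / d) => x.
have c2 : `|crd i x| <= 1 + dot x x.
  have : `|crd i x| <= 1 + crd i x ^+ 2.
    rewrite -(real_normK (num_real (crd i x))).
    have := sqr_ge0 (`|crd i x| - 1); have := sqr_ge0 (`|crd i x|); nra.
  move=> /le_trans; apply; rewrite lerD2l /dot -!expr2.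
  by have [->|->] := ord2P i; rewrite /crd/= ?lerDl ?lerDr sqr_ge0.
have e1 : 1 + d * dot x x / 2 <= (rgauss d x)^-1.
  by rewrite -expRN opprK; exact: expR_ge1Dx.
rewrite -ler_pdivlMr ?rgauss_gt0//; apply: le_trans c2 _.
apply: le_trans (_ : (1 + 2 / d) * (1 + d * dot x x / 2) <= _); last first.
  by rewrite ler_wpM2l// addr_ge0// divr_ge0// ltW.
have -> : (1 + 2 / d) * (1 + d * dot x x / 2) = 1 + dot x x + 2 / d + d * dot x x / 2.
  by field; rewrite gt_eqF.
by rewrite -addrA lerDl addr_ge0// divr_ge0 ?(ltW d0)// mulr_ge0 ?dot_ge0// ltW.
Qed.

Inductive gauss_span d : (R * R -> R[i]) -> Prop :=
| gspan_base : gauss_span d (fun x => (rgauss d x)%:C)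
| gspan_crd i f : gauss_span d f -> gauss_span d (fun x => (crd i x)%:C * f x)
| gspan_scale z f : gauss_span d f -> gauss_span d (fun x => z * f x)
| gspan_add f g : gauss_span d f -> gauss_span d g -> gauss_span d (fun x => f x + g x).

(** Each coordinate factor costs half of the gap between [e] and [d], so the induction has to carry
    all [e < d] at once. The value [e = 0] is the boundedness asked for by [stable]. *)
Lemma gauss_span_bound d f : gauss_span d f -> forall e : R, 0 <= e -> e < d ->
  exists M, forall x, modulus (f x) <= M * rgauss e x.
Proof.
elim => {f} [e e0 ed|i f _ IH e e0 ed|z f _ IH e e0 ed|f g _ IHf _ IHg e e0 ed].
- exists 1 => x; rewrite mul1r modulusR gtr0_norm ?rgauss_gt0// ler_expR lerN2.
  by rewrite ler_pM2r// ler_wpM2r ?dot_ge0// ltW.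
- have [M fM] := IH ((e + d) / 2) ltac:(lra) ltac:(lra).
  have [N hN] := @crd_rgauss_bounded i ((d - e) / 2) ltac:(lra).
  have M0 : 0 <= M.
    rewrite -(pmulr_lge0 _ (rgauss_gt0 ((e + d) / 2) 0)).
    exact: le_trans (modulus_ge0 _) (fM 0).
  exists (N * M) => x; rewrite modulusM modulusR.
  apply: le_trans (ler_wpM2l (normr_ge0 _) (fM x)) _.
  rewrite (_ : (e + d) / 2 = (d - e) / 2 + e); last by field.
  rewrite rgaussD (_ : _ * _ = (`|crd i x| * rgauss ((d - e) / 2) x) * (M * rgauss e x)); last by ring.
  by rewrite -[leRHS]mulrA ler_wpM2r// mulr_ge0// ltW// rgauss_gt0.
- have [M fM] := IH e e0 ed; exists (modulus z * M) => x.
  by rewrite modulusM -mulrA ler_wpM2l// modulus_ge0.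
- have [M fM] := IHf e e0 ed; have [N gN] := IHg e e0 ed.
  by exists (M + N) => x; rewrite (le_trans (modulusD _ _))// mulrDl lerD.
Qed.

Lemma sch_rgauss d : 0 < d -> sch (fun x => (rgauss d x)%:C).
Proof.
move=> d0; exists (gauss_span d); last exact: gspan_base.
move=> f sf; split; last 2 first.
- by move=> i; exact: gspan_crd.
- move=> i; elim: sf => {f} [|j f sf [g sg fg]|z f sf [g sg fg]|f1 f2 sf1 [g1 sg1 fg1] sf2 [g2 sg2 fg2]].
  + exists (fun x => - d%:C * ((crd i x)%:C * (rgauss d x)%:C)).
      by apply: gspan_scale; apply: gspan_crd; exact: gspan_base.
    exact: is_cpartial_rgauss.
  + exists (fun x => ((i == j)%:R : R)%:C * f x + (crd j x)%:C * g x).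
      by apply: gspan_add; [exact: gspan_scale|exact: gspan_crd].
    by move=> x; apply: is_cpartialM => //; exact: is_cpartial_crd.
  + exists (fun x => z * g x); first exact: gspan_scale.
    by move=> x; exact: is_cpartialZ.
  + exists (fun x => g1 x + g2 x); first exact: gspan_add.
    by move=> x; exact: is_cpartialD.
- elim: sf => {f} [|j f sf fc|z f sf fc|f g sf fc sg gc].
  + by apply: ccontinuous_real; exact: continuous_rgauss.
  + by apply: ccontinuousM => //; apply: ccontinuous_real; exact: continuous_crd.
  + by apply: ccontinuousM => //; exact: ccontinuous_cst.
  + exact: ccontinuousD.
- have [M fM] := gauss_span_bound sf (lexx 0) d0; exists M => x.
  by rewrite (le_trans (fM x))// /rgauss mul0r mul0r oppr0 expR0 mulr1.
Qed.

Lemma sch_gauss d a : 0 < d -> sch (gauss d a).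
Proof. by move=> d0; apply: sch_chirp; exact: sch_rgauss. Qed.

Lemma gauss0 d a : gauss d a 0 = 1.
Proof.
by rewrite /gauss /chirp /rgauss /dot /= !mulr0 addr0 !mulr0 !mul0r oppr0 expR0 expi0 mul1r.
Qed.

Definition cpx d a : R[i] := d%:C + iC * a%:C.

Lemma is_cpartial_gauss d a i x :
  is_cpartial i (gauss d a) x (- cpx d a * ((crd i x)%:C * gauss d a x)).
Proof.
apply: is_cpartial_ext (is_cpartialM (is_cpartial_chirp (- a) i x)
  (is_cpartial_rgauss d i x)) => //.
by rewrite /cpx /gauss RCM RCN; ring.
Qed.

Lemma sch_integral_partial i f g : sch f -> sch g ->
  (forall x, is_cpartial i f x (g x)) -> cintegral (leb2 R) g = 0.
Proof.
move=> sf sg fg; have [C _ gC] := sch_decay sg.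
by have [] := cintegral_partial0 fg (sch_integrable sf) gC.
Qed.

Lemma cpx_neq0 d a : 0 < d -> cpx d a != 0.
Proof.
move=> d0; apply/eqP => /(congr1 (@complex.Re R)); rewrite /cpx !(ReD, ReM)/=.
by move=> /eqP; rewrite mul0r mulr0 subrr addr0 gt_eqF.
Qed.

(** Moving along one axis and then the other. Two first-order equations are solved this way, one for
    the Gaussian integral in its parameter and one for the Gaussian transform in frequency: a
    suitable product is shown to have zero derivatives. *)
Lemma partial_zero_cst f : (forall i x, is_cpartial i f x 0) -> forall x, f x = f 0.
Proof.
move=> df.
have step i x (t : R) : f (x + t *: coord_dir R i) = f x.
  apply: complexP; apply/eqP; rewrite -subr_eq0.
    have [c _ ->] := derivable_mean_value x (fun x => (df i x).1) t.
    by rewrite /= mul0r.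
  have [c _ ->] := derivable_mean_value x (fun x => (df i x).2) t.
  by rewrite /= mul0r.
move=> [x1 x2].
have -> : (x1, x2) = 0 + x1 *: coord_dir R ord0 + x2 *: coord_dir R ord_max.
  by congr pair; rewrite /= ?[_ *: 1]mulr1 ?[_ *: 0]mulr0 ?add0r ?addr0.
by rewrite !step.
Qed.

Let J d a := cintegral (leb2 R) (gauss d a).

Lemma rgauss_integral d : 0 < d -> Rintegral (leb2 R) setT (rgauss d) = 2 * pi / d.
Proof.
move=> d0; have [ig Ig] := plane_prod_integral (@integrableT_gauss R) (@integrableT_gauss R).
have ge : Rintegral (@lebesgue_measure R) setT gauss_fun = Num.sqrt pi.
  by rewrite /Rintegral integralT_gauss.
rewrite ge -expr2 sqr_sqrtr ?pi_ge0// in Ig.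
have s0 : Num.sqrt (d / 2) != 0 by rewrite gt_eqF// sqrtr_gt0 divr_gt0.
have := Rintegral_affine s0 (0 : R * R) ig.
rewrite Ig sqr_sqrtr; last by rewrite ltW// divr_gt0.
rewrite [X in _ = _ * X -> _](_ : _ = Rintegral (leb2 R) setT (rgauss d)); last first.
  apply: eq_Rintegral => x _; rewrite /plane_affine/= !add0r /gauss_fun -expRD.
  congr expR; rewrite !exprMn sqr_sqrtr; last by rewrite ltW// divr_gt0.
  by rewrite /dot; field.
by move=> ->; field; rewrite gt_eqF.
Qed.

(** The left side is constant in [a]. Integration by parts in either coordinate gives [J d a] as
    [cpx d a] times a second moment, and differentiating [J] in [a] brings down [- i |x|^2 / 2]; the
    two terms of the product rule then cancel. At [a = 0] the integral is the real Gaussian one. *)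
Lemma gauss_integral d a : 0 < d -> cpx d a * J d a = (2 * pi)%:C.
Proof.
move=> d0.
have sg b := sch_gauss b d0.
have moment b i : J d b = cpx d b *
    cintegral (leb2 R) (fun x => (crd i x)%:C * ((crd i x)%:C * gauss d b x)).
  have s2 := sch_crd i (sch_crd i (sg b)).
  have := @sch_integral_partial i (fun x => (crd i x)%:C * gauss d b x)
    (fun x => gauss d b x + (- cpx d b) * ((crd i x)%:C * ((crd i x)%:C * gauss d b x)))
    (sch_crd i (sg b)) (schD (sg b) (schZ _ s2)).
  rewrite cintegralD; [|exact: sch_integrable|exact/cintegrableZ/sch_integrable].
  rewrite cintegralZ ?mulNr; last exact: sch_integrable.
  move=> h; apply/eqP; rewrite -subr_eq0; apply/eqP; apply: h => x.
  apply: is_cpartial_ext (is_cpartialM (is_cpartial_crd i i x) (is_cpartial_gauss d b i x)) => //.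
  by rewrite eqxx (_ : (true%:R : R)%:C = 1)//; ring.
(* The second coordinate is a dummy: [F] lives on the plane so that [partial_zero_cst] applies to
   it. *)
pose F (p : R * R) := cpx d p.1 * J d p.1.
pose q (x : R * R) : R := - (dot x x / 2).
have qc : continuous q.
  by move=> x; apply: cvgN; apply: cvgM; [exact: continuous_dot|exact: cvg_cst].
have sq f : sch f -> sch (fun x => (q x)%:C * f x).
  move=> sf; have s2 i := sch_crd i (sch_crd i sf).
  apply: sch_ext (schZ (- (2^-1 : R)%:C) (schD (s2 ord0) (s2 ord_max))) => x.
  by rewrite /q /dot RCN RCM RCD !RCM /crd/=; ring.
have FE i (p : R * R) : is_cpartial i F p 0.
  have [->|->] := ord2P i; last first.
    apply: (is_cpartial_quadratic (B := 0)) => t.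
    rewrite (_ : F _ = F p) ?subrr ?mulr0 ?subr0 ?modulus0 ?mul0r//.
    by rewrite /F /= [_ *: 0]mulr0 addr0.
  have [B bound] := phase_integral_taylor qc (sch_integrable (sg p.1))
    (sch_integrable (sq _ (sg p.1))) (sch_integrable (sq _ (sq _ (sg p.1)))).
  pose L := cintegral (leb2 R) (fun x => iC * ((q x)%:C * gauss d p.1 x)).
  have dJ : is_cpartial ord0 (fun p : R * R => J d p.1) p L.
    apply: (is_cpartial_quadratic (B := B)) => t; apply: le_trans (bound t).
    apply: le_of_eq; congr modulus; congr (_ - _ - _ * _).
    apply: eq_plane_cintegral => x; rewrite /gauss mulrA /chirp -expiD.
    by congr (expi _ * _); rewrite /q /= [t *: 1]mulr1; field.
  have dc : is_cpartial ord0 (fun p : R * R => cpx d p.1) p iC.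
    apply: is_cpartial_ext (is_cpartialD (is_cpartial_cst ord0 d%:C p)
      (is_cpartialZ iC (is_cpartial_crd ord0 ord0 p))) => //.
    by rewrite mulr1 add0r.
  apply: is_cpartial_ext (is_cpartialM dc dJ) => //.
  set S := fun i => cintegral (leb2 R) (fun x => (crd i x)%:C * ((crd i x)%:C * gauss d p.1 x)).
  have s2 i' := sch_integrable (sch_crd i' (sch_crd i' (sg p.1))).
  have -> : L = (iC * - (2^-1 : R)%:C) * (S ord0 + S ord_max).
    rewrite -cintegralD// -cintegralZ; last exact: cintegrableD.
    apply: eq_plane_cintegral => x.
    by rewrite /q /dot RCN RCM RCD !RCM /crd/=; ring.
  have h2 : (2^-1 : R)%:C + (2^-1 : R)%:C = 1 :> R[i].
    by rewrite -RCD; congr (_%:C); field.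
  rewrite [LHS](_ : _ = iC * (J d p.1 - (2^-1 : R)%:C * (cpx d p.1 * S ord0)
    - (2^-1 : R)%:C * (cpx d p.1 * S ord_max))); last by ring.
  by rewrite -!(moment p.1) -addrA -opprD -mulrDl h2 mul1r subrr mulr0.
have -> : cpx d a * J d a = F (a, 0) by [].
rewrite (partial_zero_cst FE) /F /J.
rewrite (eq_plane_cintegral (g := fun x => (rgauss d x)%:C)); last first.
  by move=> x; rewrite /gauss /chirp oppr0 !mul0r expi0 mul1r.
rewrite cintegral_real rgauss_integral// /cpx mulr0 addr0 -RCM.
by congr (_%:C); rewrite mulrC divfK// gt_eqF.
Qed.

Definition inv_den d a : R := (d ^+ 2 + a ^+ 2)^-1.

(* 1 / (d + i a) = (d - i a) / (d^2 + a^2) *)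
Lemma cpxV d a : 0 < d -> cpx (d * inv_den d a) (- (a * inv_den d a)) = (cpx d a)^-1.
Proof.
move=> d0; apply: (mulfI (cpx_neq0 a d0)); rewrite mulfV ?cpx_neq0//.
have h : d ^+ 2 + a ^+ 2 != 0.
  by rewrite gt_eqF// ltr_pwDl ?exprn_gt0// sqr_ge0.
rewrite /inv_den; apply: complexP; rewrite !(ReM, ReD, ImM, ImD)/=; by field.
Qed.

Lemma gaussM d1 a1 d2 a2 x : gauss d1 a1 x * gauss d2 a2 x = gauss (d1 + d2) (a1 + a2) x.
Proof.
rewrite /gauss rgaussD RCM (_ : chirp (- (a1 + a2)) x = chirp (- a1) x * chirp (- a2) x); last first.
  by rewrite /chirp -expiD; congr expi; ring.
by ring.
Qed.

Lemma gauss00 x : gauss 0 0 x = 1.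
Proof. by rewrite /gauss /chirp /rgauss !(mul0r, oppr0) expR0 expi0 mul1r. Qed.

(* The transform of a complex Gaussian of parameter b solves
   d_i h = - (k_i / b) h. *)
Lemma fourier_gauss d a k : 0 < d ->
  fourier (gauss d a) k = (2 * pi)%:C / cpx d a *
    gauss (d * inv_den d a) (- (a * inv_den d a)) k.
Proof.
move=> d0; have sg := sch_gauss a d0; have b0 := cpx_neq0 a d0.
pose d' := d * inv_den d a; pose a' := - (a * inv_den d a).
(* [gauss (- d') (- a')] is the reciprocal of the expected Gaussian; it grows, but it is only
   differentiated, never integrated. *)
pose F k := fourier (gauss d a) k * gauss (- d') (- a') k.
have F0 i x : is_cpartial i F x 0.
  have dg := fourier_deriv x (sch_integrable sg) (sch_integrable (sch_crd i sg))
    (sch_integrable (sch_crd i (sch_crd i sg))).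
  apply: is_cpartial_ext (is_cpartialM dg (is_cpartial_gauss (- d') (- a') i x)) => //.
  rewrite fourierZ; last by apply: sch_integrable; exact: sch_crd.
  have [C C0 gC] := sch_decay sg; have [C' C0' gC'] := sch_decay (sch_crd i sg).
  have w0 y : 0 <= weight y :> R by exact/ltW/weight_gt0.
  have := @fourier_partial _ i (gauss d a) _ (C + modulus (- cpx d a) * C') x (sch_integrable sg)
    (is_cpartial_gauss d a i).
  rewrite fourierZ; last by apply: sch_integrable; exact: sch_crd.
  move=> E; have {}E : - cpx d a * fourier (fun x => (crd i x)%:C * gauss d a x) x
      = iC * (crd i x)%:C * fourier (gauss d a) x.
    apply: E => [y|y|].
    + by rewrite mulrDl (le_trans (gC y))// lerDl; do 2 apply: mulr_ge0 => //; exact: modulus_ge0.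
    + rewrite modulusM mulrDl -[X in _ + X]mulrA.
      have := ler_wpM2l (modulus_ge0 (- cpx d a)) (gC' y); move=> /le_trans; apply.
      by rewrite lerDr mulr_ge0.
    + apply: cmeasurableM; first exact: cmeasurable_cst.
      by apply: ccontinuous_pmeasurable; apply: sch_ccontinuous; exact: sch_crd.
  have {E}-> : fourier (fun x => (crd i x)%:C * gauss d a x) x
      = - (iC * (crd i x)%:C * fourier (gauss d a) x) / cpx d a.
    by rewrite -E; field.
  have -> : cpx (- d') (- a') = - (cpx d a)^-1.
    by rewrite -cpxV// -/d' -/a' /cpx (RCN d') (RCN a'); ring.
  set G := gauss (- d') (- a') x; set Fx := fourier _ _.
  rewrite [LHS](_ : _ = (iC * iC + 1) * (cpx d a)^-1 * (crd i x)%:C * Fx * G); last by ring.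
  by rewrite iC_sqr addNr !mul0r.
have Fk := partial_zero_cst F0 k.
have E : gauss d' a' k * gauss (- d') (- a') k = 1.
  by rewrite gaussM !subrr gauss00.
apply: (mulIf (x := gauss (- d') (- a') k)).
  by apply/eqP => h; move: E; rewrite h mulr0 => /eqP; rewrite eq_sym oner_eq0.
rewrite -/d' -/a' -[RHS]mulrA E mulr1 -/(F k) Fk /F gauss0 mulr1.
rewrite -(gauss_integral a d0) mulrC mulrA mulVf// mul1r.
by apply: eq_plane_cintegral => x; rewrite /dot/= !mul0r addr0 oppr0 expi0 mul1r.
Qed.

End Gaussian.

(** * Gaussian regularisation: Fresnel multipliers and Fourier inversion *)

Section Inversion.
Context {R : realType}.
Implicit Types (f g h : R * R -> R[i]) (x y k : R * R) (i : 'I_2) (d a b : R).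

Lemma plane_dominated (f_ : nat -> R * R -> R[i]) f (M : R * R -> R) :
  (forall n, pmeasurable (f_ n)) -> pmeasurable f ->
  (forall x, ccvg \oo (f_ ^~ x) (f x)) ->
  (forall n x, modulus (f_ n x) <= M x) -> rintegrable (leb2 R) M ->
  ccvg \oo (fun n => cintegral (leb2 R) (f_ n)) (cintegral (leb2 R) f).
Proof.
move=> mf_ mf ff fM iM.
have ff' : {ae leb2 R, forall x, ccvg \oo (f_ ^~ x) (f x)} by apply: aeW => x.
by have [] := @cintegral_dominated _ (plane R) R (leb2 R) f_ f M mf_ mf ff' fM iM.
Qed.

Lemma gauss_ccvg (d_ a_ : nat -> R) d a x :
  d_ n @[n --> \oo] --> d -> a_ n @[n --> \oo] --> a ->
  ccvg \oo (fun n => gauss (d_ n) (a_ n) x) (gauss d a x).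
Proof.
move=> dd aa; apply: ccvgM.
  apply: ccvg_expi; apply: cvgM; last exact: cvg_cst.
  by apply: cvgM; [exact: cvgN|exact: cvg_cst].
apply: ccvg_real; rewrite /rgauss; apply: continuous_cvg; first exact: continuous_expR.
by apply: cvgN; apply: cvgM; [apply: cvgM => //; exact: cvg_cst|exact: cvg_cst].
Qed.

Lemma cpx_ccvg (d_ a_ : nat -> R) d a :
  d_ n @[n --> \oo] --> d -> a_ n @[n --> \oo] --> a ->
  ccvg \oo (fun n => cpx (d_ n) (a_ n)) (cpx d a).
Proof.
move=> dd aa; apply: ccvgD; first exact: ccvg_real.
by apply: ccvgM; [exact: ccvg_cst|exact: ccvg_real].
Qed.

Let harm n : R := n.+1%:R^-1.

Let harm_gt0 n : 0 < harm n.
Proof. by rewrite invr_gt0 ltr0n. Qed.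

Let harm_cvg : harm n @[n --> \oo] --> (0 : R).
Proof. exact: cvg_harmonic. Qed.

Lemma pmeasurable_gauss d a : pmeasurable (gauss d a : R * R -> R[i]).
Proof.
apply: ccontinuous_pmeasurable; apply: ccontinuousM; first exact: ccontinuous_chirp.
by apply: ccontinuous_real; exact: continuous_rgauss.
Qed.

Lemma pmeasurable_translate f y : pmeasurable f -> pmeasurable (fun x => f (x - y)).
Proof.
move=> mf; rewrite (_ : (fun x => _) = fun x => f (plane_affine 1 (- y) x)).
  exact: (@cmeasurable_comp _ _ (plane R) (plane R) R f _ (measurable_plane_affine 1 (- y)) mf).
apply/funext => x; congr f; rewrite /plane_affine !mul1r addrC.
by case: x => x1 x2; case: y => y1 y2.
Qed.

Lemma gauss_regularized d b g x : 0 < d -> cintegrable (leb2 R) g ->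
  cintegral (leb2 R) (fun k => expi (dot k x) * (gauss d b k * fourier g k)) =
  cintegral (leb2 R) (fun y => g y * ((2 * pi)%:C *
    cpx (d * inv_den d b) (- (b * inv_den d b)) *
    gauss (d * inv_den d b) (- (b * inv_den d b)) (y - x))).
Proof.
move=> d0 gi; rewrite fourier_mul//; last exact/sch_integrable/sch_gauss.
by apply: eq_plane_cintegral => y; rewrite fourier_gauss// cpxV.
Qed.

(** One side of the limit [d -> 0], shared by [chirp_multiplier], where [b != 0], and by
    [fourier_inversion], where [b = 0]. *)
Lemma regularization_cvg b g x : cintegrable (leb2 R) (fourier g) ->
  forall d_ : nat -> R, (forall n, 0 < d_ n) -> d_ n @[n --> \oo] --> (0 : R) ->
  ccvg \oo (fun n => cintegral (leb2 R)
      (fun k => expi (dot k x) * (gauss (d_ n) b k * fourier g k)))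
    (cintegral (leb2 R) (fun k => expi (dot k x) * (chirp (- b) k * fourier g k))).
Proof.
move=> gi d_ d0 dc.
have mg := cintegrable_measurable gi.
have mw : pmeasurable (fun k => expi (dot k x)).
  by under eq_fun do rewrite dotC; exact: pmeasurable_wave.
apply: (plane_dominated (M := fun k => modulus (fourier g k))).
- by move=> n; apply: cmeasurableM => //; apply: cmeasurableM => //; exact: pmeasurable_gauss.
- apply: cmeasurableM => //; apply: cmeasurableM => //.
  by apply: ccontinuous_pmeasurable; exact: ccontinuous_chirp.
- move=> k; apply: ccvgM; first exact: ccvg_cst.
  apply: ccvgM; last exact: ccvg_cst.
  have cb : b @[n --> \oo] --> b by exact: cvg_cst.
  have := gauss_ccvg k dc cb.
  by rewrite [X in ccvg _ _ X]/gauss /rgauss !mul0r oppr0 expR0 mulr1.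
- move=> n k; rewrite modulusM modulus_expi mul1r modulusM modulus_gauss.
  by rewrite ler_piMl ?modulus_ge0// rgauss_le1// ltW.
- exact: cintegrable_modulus.
Qed.

(* Fresnel propagation: the multiplier chirp (- b) acts as convolution with
   the transform of the chirp. *)
Lemma chirp_multiplier b g x : b != 0 -> cintegrable (leb2 R) g ->
  cintegrable (leb2 R) (fourier g) ->
  cintegral (leb2 R) (fun k => expi (dot k x) * (chirp (- b) k * fourier g k)) =
  (2 * pi)%:C * (iC * (- b^-1)%:C) *
    cintegral (leb2 R) (fun y => g y * chirp b^-1 (y - x)).
Proof.
move=> b0 gi ghi; apply: (ccvg_uniq (regularization_cvg b x ghi harm_gt0 harm_cvg)).
under eq_fun do rewrite gauss_regularized//.
(* Real and imaginary parts of [1 / (d + i b)] along [d = harm n]; they tend to 0 and [- 1 / b]. *)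
pose d_ n := harm n * inv_den (harm n) b; pose a_ n := - (b * inv_den (harm n) b).
have ci : inv_den (harm n) b @[n --> \oo] --> (b ^+ 2)^-1.
  apply: cvgV; first by rewrite sqrf_eq0.
  rewrite -[X in _ --> X]add0r; apply: cvgD; last exact: cvg_cst.
  have := cvgM harm_cvg harm_cvg; rewrite mulr0 => h; exact: h.
have cd : d_ n @[n --> \oo] --> (0 : R) by rewrite -(mul0r (b ^+ 2)^-1); exact: cvgM.
have ca : a_ n @[n --> \oo] --> - b^-1.
  have -> : - b^-1 = - (b * (b ^+ 2)^-1) by field.
  by apply: cvgN; apply: cvgM => //; exact: cvg_cst.
rewrite -cintegralZ; last first.
  apply: (@cintegrable_le _ (plane R) R _ _ (fun y => modulus (g y))).
  - apply: cmeasurableM; first exact: cintegrable_measurable gi.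
    apply: (pmeasurable_translate (f := chirp b^-1)).
    by apply: ccontinuous_pmeasurable; exact: ccontinuous_chirp.
  - by move=> y; rewrite modulusM modulus_chirp mulr1.
  - exact: cintegrable_modulus.
have mgi := cintegrable_measurable gi.
apply: (plane_dominated (M := fun y => `|2 * pi| * `|b|^-1 * modulus (g y))).
- move=> n; apply: cmeasurableM => //; apply: cmeasurableM; first exact: cmeasurable_cst.
  by apply: (pmeasurable_translate (f := gauss _ _)); exact: pmeasurable_gauss.
- apply: cmeasurableM; first exact: cmeasurable_cst.
  apply: cmeasurableM => //; apply: (pmeasurable_translate (f := chirp b^-1)).
  by apply: ccontinuous_pmeasurable; exact: ccontinuous_chirp.
- move=> y.
  rewrite [X in ccvg _ _ X](_ : _ = g y * ((2 * pi)%:C * cpx 0 (- b^-1) *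
      gauss 0 (- b^-1) (y - x))); last first.
    by rewrite /cpx RC0 add0r /gauss /rgauss !mul0r oppr0 expR0 mulr1 opprK; ring.
  apply: ccvgM; first exact: ccvg_cst.
  apply: ccvgM; last exact: (gauss_ccvg (y - x) cd ca).
  by apply: ccvgM; [exact: ccvg_cst|exact: (cpx_ccvg cd ca)].
(* The bound is uniform in [n]: the Gaussian is at most 1, and [|d + i b| >= |b|]. *)
- move=> n y; rewrite 3!modulusM modulusR modulus_gauss cpxV// modulusV.
  rewrite mulrC; apply: ler_wpM2r; first exact: modulus_ge0.
  rewrite -[leRHS]mulr1; apply: ler_pM.
  + by rewrite mulr_ge0// invr_ge0 modulus_ge0.
  + exact/ltW/rgauss_gt0.
  + rewrite ler_wpM2l// lef_pV2 ?posrE ?normr_gt0//; last first.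
      by rewrite lt_neqAle eq_sym modulus_ge0 andbT modulus_neq0// cpx_neq0.
    apply: le_trans (Im_le_modulus _).
    by rewrite /cpx !(ImD, ImM)/= add0r mul0r add0r mul1r.
  + apply: rgauss_le1; rewrite mulr_ge0 ?(ltW (harm_gt0 _))//.
    by rewrite invr_ge0 addr_ge0// sqr_ge0.
- by apply: rintegrableZ; exact: cintegrable_modulus.
Qed.

Lemma fourier_rgauss d z : 0 < d ->
  fourier (gauss d 0) z = (2 * pi / d * rgauss d^-1 z)%:C.
Proof.
move=> d0; rewrite fourier_gauss//.
have -> : d * inv_den d 0 = d^-1.
  by rewrite /inv_den expr0n addr0 expr2 invfM mulrA mulfV ?mul1r// gt_eqF.
rewrite mul0r oppr0 /cpx mulr0 addr0 /gauss /chirp oppr0 !mul0r expi0 mul1r.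
by rewrite -RCV -!RCM.
Qed.

Lemma plane_affine_translate (s : R) x u : plane_affine s x u - x = s *: u.
Proof.
case: x => x1 x2; case: u => u1 u2; congr pair; rewrite /plane_affine /=.
  by rewrite addrAC subrr add0r.
by rewrite addrAC subrr add0r.
Qed.

Lemma ccvg_comp_continuous g (u_ : nat -> R * R) x : ccontinuous g ->
  u_ n @[n --> \oo] --> x -> ccvg \oo (fun n => g (u_ n)) (g x).
Proof.
move=> [gr gi] ux; split.
  by apply: (@cvg_comp _ _ _ u_ (fun x => Re (g x)) \oo (nbhs x)); [exact: ux|exact: gr].
by apply: (@cvg_comp _ _ _ u_ (fun x => Im (g x)) \oo (nbhs x)); [exact: ux|exact: gi].
Qed.

Lemma plane_affine_cvg (s_ : nat -> R) (s : R) x u : s_ n @[n --> \oo] --> s ->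
  plane_affine (s_ n) x u @[n --> \oo] --> (plane_affine s x u : R * R).
Proof.
move=> ss; apply: (@cvg_pair _ _ _ _ (nbhs (x.1 + s * u.1)) (nbhs (x.2 + s * u.2)) _ _ _
    (fun n => x.1 + s_ n * u.1) (fun n => x.2 + s_ n * u.2)).
  by apply: cvgD; [exact: cvg_cst|apply: cvgM => //; exact: cvg_cst].
by apply: cvgD; [exact: cvg_cst|apply: cvgM => //; exact: cvg_cst].
Qed.

Lemma rintegrable0 : rintegrable (leb2 R) (fun=> 0).
Proof. exact: integrable0. Qed.

(** The multiplication formula turns the damped integral into an average of [g] around [x] against a
    Gaussian of width [harm n]. After rescaling the Gaussian is fixed, of total mass [(2 pi)^2], and
    continuity of [g] gives the limit. *)
Lemma fourier_inversion g x : sch g ->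
  cintegral (leb2 R) (fun k => expi (dot k x) * fourier g k) = ((2 * pi) ^+ 2)%:C * g x.
Proof.
move=> sg; have gi := sch_integrable sg.
have ghi := sch_integrable (sch_fourier sg).
(* The damping parameter is a square so that [harm n] itself is the scale of the change of
   variable. *)
have d0 n : 0 < harm n * harm n by rewrite mulr_gt0.
have dc : harm n * harm n @[n --> \oo] --> (0 : R).
  by have := cvgM harm_cvg harm_cvg; rewrite mulr0 => h; exact: h.
have := regularization_cvg 0 x ghi d0 dc.
rewrite [X in ccvg _ _ X](_ : _ =
    cintegral (leb2 R) (fun k => expi (dot k x) * fourier g k)); last first.
  by apply: eq_plane_cintegral => k; rewrite /chirp oppr0 !mul0r expi0 mul1r.
move=> cv; apply: (ccvg_uniq cv).
pose f n u := g (plane_affine (harm n) x u) * (2 * pi * rgauss 1 u)%:C.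
have E n : cintegral (leb2 R) (fun k => expi (dot k x) * (gauss (harm n * harm n) 0 k * fourier g k))
    = cintegral (leb2 R) (f n).
  rewrite fourier_mul//; last exact/sch_integrable/sch_gauss.
  have h0 : harm n != 0 by rewrite gt_eqF.
  have fi : cintegrable (leb2 R) (fun y => g y * fourier (gauss (harm n * harm n) 0) (y - x)).
    apply: (@cintegrable_le _ (plane R) R _ _
      (fun y => 2 * pi / (harm n * harm n) * modulus (g y))).
    - apply: cmeasurableM; first exact: cintegrable_measurable gi.
      apply: (pmeasurable_translate (f := fourier _)); apply: fourier_measurable.
      exact/sch_integrable/sch_gauss.
    - move=> y; have p0 : 0 <= 2 * pi / (harm n * harm n) :> R.
        by rewrite mulr_ge0 ?invr_ge0 ?(ltW (d0 n))// mulr_ge0// pi_ge0.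
      rewrite modulusM fourier_rgauss// modulusR mulrC ler_wpM2r ?modulus_ge0//.
      rewrite ger0_norm; last by rewrite mulr_ge0// ltW// rgauss_gt0.
      by rewrite ler_piMr// rgauss_le1// invr_ge0 ltW.
    - by apply: rintegrableZ; exact: cintegrable_modulus.
  rewrite (cintegral_affine h0 x fi) -cintegralZ; last exact: (cintegrable_affine h0 x fi).
  apply: eq_plane_cintegral => u; rewrite /f plane_affine_translate fourier_rgauss//.
  rewrite mulrCA -RCM; congr (_ * _%:C).
  have -> : rgauss (harm n * harm n)^-1 (harm n *: u) = rgauss 1 u.
    by rewrite /rgauss dotZr dotC dotZr; congr expR; field.
  by field.
under eq_fun do rewrite E.
have r1i : rintegrable (leb2 R) (fun u => 2 * pi * rgauss 1 u).
  apply: rintegrableZ.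
  by have := cintegrable_modulus (sch_integrable (sch_gauss 0 (@ltr01 R)));
    under eq_fun do rewrite modulus_gauss.
have -> : ((2 * pi) ^+ 2)%:C * g x = cintegral (leb2 R) (fun u => g x * (2 * pi * rgauss 1 u)%:C).
  rewrite cintegralZ; last by split; [exact: r1i|exact: rintegrable0].
  rewrite cintegral_real RintegralZl// ?rgauss_integral//; last first.
    by have := cintegrable_modulus (sch_integrable (sch_gauss 0 (@ltr01 R)));
      under eq_fun do rewrite modulus_gauss.
  by rewrite mulrC; congr (_ * _%:C); rewrite divr1 expr2.
have [M gM] := sch_bounded sg.
apply: (plane_dominated (M := fun u => M * (2 * pi * rgauss 1 u))).
- move=> n; apply: cmeasurableM; last first.
    by apply: cmeasurable_real; exact: rintegrable_measurable r1i.
  exact: (@cmeasurable_comp _ _ (plane R) (plane R) R g _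
    (measurable_plane_affine (harm n) x) (cintegrable_measurable gi)).
- apply: cmeasurableM; first exact: cmeasurable_cst.
  by apply: cmeasurable_real; exact: rintegrable_measurable r1i.
- move=> u; apply: ccvgM; last exact: ccvg_cst.
  have cx := plane_affine_cvg (x := x) (u := u) harm_cvg.
  have x0 : plane_affine 0 x u = x by rewrite /plane_affine !mul0r !addr0 -surjective_pairing.
  by rewrite -[in X in ccvg _ _ X]x0; apply: ccvg_comp_continuous => //; exact: sch_ccontinuous.
- move=> n u; rewrite modulusM modulusR ger0_norm ?ler_wpM2r//.
    by rewrite mulr_ge0 ?mulr_ge0 ?pi_ge0// ltW// rgauss_gt0.
  by rewrite mulr_ge0 ?mulr_ge0 ?pi_ge0// ltW// rgauss_gt0.
- exact: rintegrableZ.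
Qed.

End Inversion.

(** * Square integrability of transforms *)

Section Bessel.
Context {R : realType}.
Implicit Types (f g h : R * R -> R[i]) (x y k : R * R) (i : 'I_2) (d a b : R).

Lemma cJM (u v : R[i]) : @conjc R (u * v) = @conjc R u * @conjc R v.
Proof. exact: rmorphM. Qed.

Lemma rintegrable_rgauss d : 0 < d -> rintegrable (leb2 R) (rgauss d).
Proof.
move=> d0; have := cintegrable_modulus (sch_integrable (sch_gauss 0 d0)).
by under eq_fun do rewrite modulus_gauss.
Qed.

Lemma fourier_rgauss_mass d y : 0 < d ->
  rintegrable (leb2 R) (fun z => 2 * pi / d * rgauss d^-1 (z - y)) /\
  Rintegral (leb2 R) setT (fun z => 2 * pi / d * rgauss d^-1 (z - y)) = (2 * pi) ^+ 2.
Proof.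
move=> d0; have dV : 0 < d^-1 by rewrite invr_gt0.
have E : (fun z => rgauss d^-1 (z - y)) = (fun z => rgauss d^-1 (plane_affine 1 (- y) z)).
  apply/funext => z; congr rgauss; rewrite /plane_affine !mul1r addrC.
  by case: z => z1 z2; case: y.
have ti : rintegrable (leb2 R) (fun z => rgauss d^-1 (z - y)).
  by rewrite E; apply: rintegrable_affine; [exact: oner_neq0|exact: rintegrable_rgauss].
split; first exact: rintegrableZ.
rewrite RintegralZl// E.
have := Rintegral_affine (oner_neq0 R) (- y) (rintegrable_rgauss dV).
rewrite expr1n mul1r => <-; rewrite rgauss_integral// invrK.
by field; rewrite gt_eqF.
Qed.

(** Write [|fourier f|^2] as a product with the conjugate and open one of the two integrals. The
    remaining factor [I] is [f] convolved with a Gaussian of total mass [(2 pi)^2], hence at most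
    [M (2 pi)^2]. What matters is that the bound does not depend on [d]. *)
Lemma fourier_square_bound f (M : R) d : 0 < d -> cintegrable (leb2 R) f ->
  (forall x, modulus (f x) <= M) ->
  rintegrable (leb2 R) (fun k => rgauss d k * modulus (fourier f k) ^+ 2) /\
  Rintegral (leb2 R) setT (fun k => rgauss d k * modulus (fourier f k) ^+ 2) <=
    M * (2 * pi) ^+ 2 * Rintegral (leb2 R) setT (fun x => modulus (f x)).
Proof.
move=> d0 fi fM.
have mf := cintegrable_measurable fi; have mF := fourier_measurable fi.
pose B := Rintegral (leb2 R) setT (fun x => modulus (f x)).
rewrite -/B.
have FB k : modulus (fourier f k) <= B by exact: modulus_fourier.
have B0 : 0 <= B by exact: le_trans (modulus_ge0 _) (FB 0).
have mg : pmeasurable (fun k => (rgauss d k)%:C).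
  by apply: cmeasurable_real; apply: continuous_measurable_plane; exact: continuous_rgauss.
have qi : rintegrable (leb2 R) (fun k => rgauss d k * modulus (fourier f k) ^+ 2).
  apply: (@rintegrable_le _ (plane R) R _ _ (fun k => B ^+ 2 * rgauss d k)).
  - apply: measurable_funM; first exact: (mg.1).
    by apply: measurable_funX; exact: measurable_modulus.
  - move=> k; rewrite ger0_norm; last by rewrite mulr_ge0 ?exprn_ge0 ?modulus_ge0// ltW// rgauss_gt0.
    rewrite mulrC ler_wpM2r ?(ltW (rgauss_gt0 _ _))//.
    by rewrite ler_pXn2r ?nnegrE ?modulus_ge0.
  - by apply: rintegrableZ; exact: rintegrable_rgauss.
split => //.
have gi : cintegrable (leb2 R) (gauss d 0) by exact/sch_integrable/sch_gauss.
pose I y := cintegral (leb2 R) (fun k => expi (dot k y) * (gauss d 0 k * fourier f k)).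
have IM y : modulus (I y) <= M * (2 * pi) ^+ 2.
  have [mi me] := fourier_rgauss_mass y d0.
  have fri : cintegrable (leb2 R) (fun z => f z * fourier (gauss d 0) (z - y)).
    apply: (@cintegrable_le _ (plane R) R _ _ (fun z => M * (2 * pi / d * rgauss d^-1 (z - y)))).
    - apply: cmeasurableM => //; apply: (pmeasurable_translate (f := fourier _)).
      exact: fourier_measurable.
    - move=> z; rewrite modulusM fourier_rgauss// modulusR ger0_norm; last first.
        by rewrite mulr_ge0 ?(ltW (rgauss_gt0 _ _))// divr_ge0 ?(ltW d0)// mulr_ge0// pi_ge0.
      rewrite ler_wpM2r// mulr_ge0 ?(ltW (rgauss_gt0 _ _))// divr_ge0 ?(ltW d0)//.
      by rewrite mulr_ge0// pi_ge0.
    - exact: rintegrableZ.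
  rewrite /I fourier_mul//; apply: le_trans (modulus_cintegral fri) _.
  rewrite -me -RintegralZl//; apply: le_Rintegral => //.
  - exact: cintegrable_modulus.
  - exact: rintegrableZ.
  - move=> z _; rewrite modulusM fourier_rgauss// modulusR ger0_norm; last first.
      by rewrite mulr_ge0 ?(ltW (rgauss_gt0 _ _))// divr_ge0 ?(ltW d0)// mulr_ge0// pi_ge0.
    rewrite ler_wpM2r// mulr_ge0 ?(ltW (rgauss_gt0 _ _))// divr_ge0 ?(ltW d0)//.
    by rewrite mulr_ge0// pi_ge0.
have gFi : cintegrable (leb2 R) (fun k => gauss d 0 k * fourier f k).
  apply: (@cintegrable_le _ (plane R) R _ _ (fun k => B * rgauss d k)).
  - by apply: cmeasurableM => //; exact: pmeasurable_gauss.
  - move=> k; rewrite modulusM modulus_gauss mulrC.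
    by rewrite ler_wpM2r ?(ltW (rgauss_gt0 _ _)).
  - by apply: rintegrableZ; exact: rintegrable_rgauss.
have mI : pmeasurable I.
  (* [I] is a Fourier transform evaluated at the opposite point, which settles its measurability. *)
  have EI : I = (fun y => fourier (fun k => gauss d 0 k * fourier f k) (plane_affine (-1) 0 y)).
    apply/funext => y; apply: eq_plane_cintegral => k; congr (expi _ * _).
    by rewrite /dot /plane_affine /=; ring.
  rewrite EI; apply: (@cmeasurable_comp _ _ (plane R) (plane R) R (fourier _) (plane_affine (-1) 0)).
    by apply: measurable_plane_affine.
  exact: fourier_measurable.
have E : (Rintegral (leb2 R) setT (fun k => rgauss d k * modulus (fourier f k) ^+ 2))%:C =
    cintegral (leb2 R) (fun y => (f y)^* * I y).
  rewrite -cintegral_real.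
  transitivity (cintegral (leb2 R) (fun k => cintegral (leb2 R) (fun y =>
      (f y)^* * (expi (dot k y) * (gauss d 0 k * fourier f k))))).
    apply: eq_plane_cintegral => k; rewrite RCM -mulcJ.
    have -> : (rgauss d k)%:C = gauss d 0 k.
      by rewrite /gauss /chirp oppr0 !mul0r expi0 mul1r.
    transitivity (cintegral (leb2 R) (fun y => (expi (- dot k y) * f y)^*) *
        (gauss d 0 k * fourier f k)).
      by rewrite cintegralJ; [rewrite mulrC mulrA -mulrA; ring|exact: cintegrable_waveM].
    rewrite -cintegralZr; last by apply: cintegrableJ; exact: cintegrable_waveM.
    apply: eq_plane_cintegral => y. rewrite cJM; move: (gauss d 0 k * fourier f k) => G.
    have -> : expi (dot k y) = (expi (- dot k y))^* by rewrite expiJ opprK.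
    ring.
  rewrite (@plane_fubini R _ (fun k => B * rgauss d k) (fun y => modulus (f y))).
  - apply: eq_plane_cintegral => y; rewrite /I -cintegralZ//.
    by have := cintegrable_wave y gFi; under eq_fun do rewrite dotC.
  - have -> : (fun z : plane R * plane R => (f z.2)^* *
        (expi (@dot R z.1 z.2) * (gauss d 0 z.1 * fourier f z.1))) =
      (fun z => (f z.2)^* * (@conjc R (expi (- @dot R z.1 z.2)) * (gauss d 0 z.1 * fourier f z.1))).
      by apply/funext => z; rewrite (expiJ (- dot z.1 z.2)) opprK.
    apply: cmeasurableM; first by apply: cmeasurableJ; exact: (cmeasurable_comp measurable_snd mf).
    apply: cmeasurableM; first by apply: cmeasurableJ; exact: pmeasurable_wave2.
    exact: (cmeasurable_comp measurable_fst (cintegrable_measurable gFi)).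
  - by apply: rintegrableZ; exact: rintegrable_rgauss.
  - exact: cintegrable_modulus.
  - move=> k y; rewrite (modulusM (f y)^*) (modulusM (expi _)) (modulusM (gauss d 0 k)) modulusJ modulus_expi mul1r modulus_gauss mulrC.
    rewrite ler_wpM2r ?modulus_ge0// mulrC.
    by rewrite ler_wpM2r ?(ltW (rgauss_gt0 _ _)).
have M0 : 0 <= M by exact: le_trans (modulus_ge0 _) (fM 0).
rewrite -[leLHS]/(Re (_)%:C) E; apply: le_trans (ler_norm _) _.
have ii : cintegrable (leb2 R) (fun y => (f y)^* * I y).
  apply: (@cintegrable_le _ (plane R) R _ _ (fun y => M * (2 * pi) ^+ 2 * modulus (f y))).
  - by apply: cmeasurableM => //; exact: cmeasurableJ.
  - by move=> y; rewrite modulusM modulusJ mulrC ler_wpM2r ?modulus_ge0.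
  - by apply: rintegrableZ; exact: cintegrable_modulus.
apply: le_trans (Re_le_modulus _) _; apply: le_trans (modulus_cintegral ii) _.
have fmi := cintegrable_modulus fi.
rewrite -RintegralZl//; apply: le_Rintegral => //.
- exact: cintegrable_modulus.
- exact: rintegrableZ.
- by move=> y _; rewrite modulusM modulusJ mulrC ler_wpM2r ?modulus_ge0.
Qed.

End Bessel.

(** Fatou's lemma turns the bound of [fourier_square_bound], uniform in the Gaussian parameter, into
    integrability of the undamped square. *)
Lemma rintegrable_fatou d (T : measurableType d) (R : realType)
    (mu : {measure set T -> \bar R}) (h_ : nat -> T -> R) (h : T -> R) (C : R) :
  (forall n, rintegrable mu (h_ n)) -> (forall n x, 0 <= h_ n x) ->
  measurable_fun setT h -> (forall x, h_ n x @[n --> \oo] --> h x) ->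
  (forall n, Rintegral mu setT (h_ n) <= C) -> rintegrable mu h.
Proof.
move=> ih h0 mh hh hC.
have hx0 x : 0 <= h x.
  have c := cvgP _ (hh x); rewrite -(cvg_lim (@Rhausdorff R) (hh x)).
  by apply: limr_ge => //; exact: nearW.
apply/integrableP; split; first exact/measurable_EFinP.
have := @fatou _ T R mu setT measurableT (fun n x => (h_ n x)%:E) _ _.
have E x : limn_einf (fun n => (h_ n x)%:E) = (h x)%:E.
  have c : (h_ n x)%:E @[n --> \oo] --> (h x)%:E by apply: cvg_EFin; [exact: nearW|exact: hh].
  by rewrite is_cvg_limn_einfE; [exact/cvg_lim|apply/cvg_ex; exists (h x)%:E].
under eq_integral do rewrite E.
have -> : (\int[mu]_x `|(EFin \o h) x| = \int[mu]_x (h x)%:E)%E.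
  by apply: eq_integral => x _ /=; rewrite ger0_norm.
move=> F; apply: (@le_lt_trans _ _ C%:E); last exact: ltry.
apply: le_trans (F _ _) _.
- by move=> n; apply/measurable_EFinP; exact: rintegrable_measurable (ih n).
- by move=> n x _; rewrite lee_fin.
rewrite limn_einf_lim; apply: lime_le; first exact: is_cvg_einfs.
apply: nearW => n; apply: (@le_trans _ _ (\int[mu]_x (h_ n x)%:E)%E).
  by apply: ereal_inf_lbound; exists n => /=.
have := hC n; rewrite /Rintegral -lee_fin fineK//.
by apply: integrable_fin_num => //; exact: ih n.
Qed.

(** * Integrability of transforms from two derivatives *)

Section Wiener.
Context {R : realType}.
Implicit Types (f g h : R * R -> R[i]) (x y k : R * R) (i : 'I_2) (d a b : R).

Lemma fourier_square_integrable f (M : R) : cintegrable (leb2 R) f ->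
  (forall x, modulus (f x) <= M) ->
  rintegrable (leb2 R) (fun k => modulus (fourier f k) ^+ 2).
Proof.
move=> fi fM; pose d n : R := n.+1%:R^-1.
have d0 n : 0 < d n by rewrite invr_gt0.
apply: (@rintegrable_fatou _ (plane R) R (leb2 R)
  (fun n k => rgauss (d n) k * modulus (fourier f k) ^+ 2) _
  (M * (2 * pi) ^+ 2 * Rintegral (leb2 R) setT (fun x => modulus (f x)))).
- by move=> n; have [] := fourier_square_bound (d0 n) fi fM.
- by move=> n k; rewrite mulr_ge0 ?exprn_ge0 ?modulus_ge0// ltW// rgauss_gt0.
- by apply: measurable_funX; apply: measurable_modulus; exact: fourier_measurable.
- move=> k; rewrite -[X in _ --> X]mul1r; apply: cvgMl.
  have : ccvg \oo (fun n => gauss (d n) 0 k) (gauss 0 0 k).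
    by apply: gauss_ccvg; [exact: cvg_harmonic|exact: cvg_cst].
  move/ccvg_modulus; rewrite gauss00 modulus1.
  by under eq_fun do rewrite modulus_gauss.
- by move=> n; have [] := fourier_square_bound (d0 n) fi fM.
Qed.

(* (1 + i k_0)(1 + i k_1) fourier f is the transform of f + f0 + h, hence square
   integrable, and so is 1 / |(1 + i k_0)(1 + i k_1)|: Cauchy-Schwarz. *)
Lemma fourier_integrable f f0 h (C : R) :
  pmeasurable f -> pmeasurable f0 -> pmeasurable h ->
  (forall x, is_cpartial ord0 f x (f0 x)) ->
  (forall x, is_cpartial ord_max (fun x => f x + f0 x) x (h x)) ->
  (forall x, modulus (f x) <= C * weight x) ->
  (forall x, modulus (f0 x) <= C * weight x) ->
  (forall x, modulus (h x) <= C * weight x) ->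
  cintegrable (leb2 R) (fourier f).
Proof.
move=> mf mf0 mh df0 dh fC f0C hC.
have fi := weight_integrable mf fC; have f0i := weight_integrable mf0 f0C.
have hi := weight_integrable mh hC.
pose G x := f x + f0 x; pose K x := G x + h x.
have Gi : cintegrable (leb2 R) G by exact: cintegrableD.
have C0 : 0 <= C by rewrite -(pmulr_lge0 _ (weight_gt0 (0 : R * R))); exact: le_trans (modulus_ge0 _) (fC 0).
have GC x : modulus (G x) <= (C + C) * weight x.
  by rewrite mulrDl; apply: le_trans (modulusD _ _) (lerD _ _).
have hC2 x : modulus (h x) <= (C + C) * weight x.
  by rewrite mulrDl; apply: le_trans (hC x) _; rewrite lerDl mulr_ge0// ltW// weight_gt0.
have Ki : cintegrable (leb2 R) K by exact: cintegrableD.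
have KC x : modulus (K x) <= C + C + (C + C).
  apply: le_trans (modulusD _ _) (lerD _ _); [apply: le_trans (GC x) _|apply: le_trans (hC2 x) _];
  by rewrite ler_piMr ?addr_ge0// weight_le1.
have KE k : fourier K k = (1 + iC * (crd ord_max k)%:C) * ((1 + iC * (crd ord0 k)%:C) * fourier f k).
  rewrite fourierD// (fourier_partial k Gi dh GC hC2 mh) fourierD//.
  by rewrite (fourier_partial k fi df0 fC f0C mf0); ring.
have m1 (t : R) : modulus (1 + iC * t%:C) ^+ 2 = (weight1 t)^-1.
  by rewrite modulus_sqr ReD ImD ReM ImM /= invrK; ring.
(* Cauchy-Schwarz enters pointwise, as the arithmetic-geometric mean inequality for
   [|fourier f|^2 = |fourier K|^2 weight]. *)
apply: (@cintegrable_le _ (plane R) R _ _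
  (fun k => 2^-1 * (modulus (fourier K k) ^+ 2 + weight k))).
- exact: fourier_measurable.
- move=> k.
  have : modulus (fourier K k) ^+ 2 * weight k = modulus (fourier f k) ^+ 2.
    rewrite KE !modulusM !exprMn !m1 /weight /crd/=.
    by field; rewrite !gt_eqF ?weight1_gt0.
  move=> E; rewrite mulrC ler_pdivlMr//.
  rewrite -ler_sqr ?nnegrE ?mulr_ge0 ?modulus_ge0//; last first.
    by rewrite addr_ge0 ?exprn_ge0 ?modulus_ge0// ltW// weight_gt0.
  rewrite exprMn -E.
  have := sqr_ge0 (modulus (fourier K k) ^+ 2 - weight k); nra.
- apply: rintegrableZ; apply: rintegrableD; last exact: rintegrable_weight.
  exact: fourier_square_integrable Ki KC.
Qed.

End Wiener.

(** * Agreement with the seminorm definition of Schwartz functions *)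

Section SchwartzClass.
Context {R : realType}.
Implicit Types (f g h : R * R -> R[i]) (u : R * R -> R) (x y k : R * R) (i : 'I_2).

(** Sums of monomials times iterated partials: the stable class that places a function with rapidly
    decaying derivatives in [sch]. Zero is listed because a coordinate has zero derivative along the
    other axis. *)
Inductive partial_span u : (R * R -> R[i]) -> Prop :=
| partial_span_base s : partial_span u (fun x => (iter_partial s u x)%:C)
| partial_span_zero : partial_span u (fun=> 0)
| partial_span_crd i f : partial_span u f -> partial_span u (fun x => (crd i x)%:C * f x)
| partial_span_add f g : partial_span u f -> partial_span u g ->
    partial_span u (fun x => f x + g x).

Lemma crd_le_enorm i x : `|crd i x| <= enorm x.
Proof.
rewrite /enorm /dot -sqrtr_sqr ler_sqrt; last by rewrite addr_ge0// -expr2 sqr_ge0.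
by rewrite /crd; case: ifP => _; rewrite ?lerDl ?lerDr -expr2 sqr_ge0.
Qed.

Lemma enorm_le_crd x : enorm x <= `|crd ord0 x| + `|crd ord_max x|.
Proof.
rewrite /enorm -[leRHS]ger0_norm ?addr_ge0// -sqrtr_sqr ler_sqrt ?sqr_ge0//.
rewrite dot_crd sqrrD !real_normK ?num_real// -!expr2 -addrA lerD2l lerDr.
by rewrite mulrn_wge0// mulr_ge0.
Qed.

Lemma enorm_ge0 x : 0 <= enorm x. Proof. exact: sqrtr_ge0. Qed.

(** The induction carries an arbitrary monomial [s], so that a coordinate factor merely lengthens
    the list; at a base term [rapidly_decaying] is used with exponent [size s]. *)
Lemma partial_span_bounded u f : rapidly_decaying u -> partial_span u f ->
  forall s : seq 'I_2, exists M, forall x,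
    modulus ((\prod_(i <- s) crd i x)%:C * f x) <= M.
Proof.
move=> ud; elim => [t|| i {}f _ IH|{}f g _ IHf _ IHg] s.
- have [M HM] := ud (size s) t; exists M => x.
  apply: le_trans (HM x); rewrite modulusM !modulusR ler_wpM2r//.
  elim: s {HM} => [|i s IH]; first by rewrite big_nil normr1 expr0.
  by rewrite big_cons normrM exprS ler_pM// crd_le_enorm.
- by exists 0 => x; rewrite mulr0 modulus0.
- have [M HM] := IH (i :: s); exists M => x; apply: le_trans (HM x).
  by rewrite big_cons RCM -mulrA mulrCA.
- have [M HM] := IHf s; have [N HN] := IHg s; exists (M + N) => x.
  by rewrite mulrDr; apply: le_trans (modulusD _ _) (lerD _ _).
Qed.

Lemma partial_span_stable u : smooth u -> rapidly_decaying u -> stable (partial_span u).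
Proof.
move=> us ud f uf; split.
- elim: uf => [s||i {}f _ IH|{}f g _ IHf _ IHg].
  + by apply: ccontinuous_real; exact: (us s).1.
  + exact: ccontinuous_cst.
  + by apply: ccontinuousM => //; apply: ccontinuous_real; exact: continuous_crd.
  + exact: ccontinuousD.
- have [M HM] := partial_span_bounded ud uf [::]; exists M => x.
  by have := HM x; rewrite big_nil mul1r.
- by move=> i; exact: partial_span_crd.
- move=> i; elim: uf => [s||j {}f uf [g ug gf]|{}f g _ [f' uf' ff] _ [g' ug' gf]].
  + exists (fun x => (iter_partial (i :: s) u x)%:C); first exact: partial_span_base.
    by move=> x; apply: is_cpartial_real; apply: DeriveDef => //; exact: (us s).2.
  + by exists (fun=> 0); [exact: partial_span_zero|move=> x; exact: is_cpartial_cst].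
  + have uif : partial_span u (fun x => ((i == j)%:R : R)%:C * f x).
      case: eqP => _; last first.
        by under eq_fun do rewrite mul0r; exact: partial_span_zero.
      by under eq_fun do rewrite mul1r.
    exists (fun x => ((i == j)%:R : R)%:C * f x + (crd j x)%:C * g x).
      by apply: partial_span_add => //; exact: partial_span_crd.
    by move=> x; apply: is_cpartialM => //; exact: is_cpartial_crd.
  + exists (fun x => f' x + g' x); first exact: partial_span_add.
    by move=> x; exact: is_cpartialD.
Qed.

Lemma schwartz_sch f : schwartz f -> sch f.
Proof.
move=> [rs is_ rd id]; apply: (@sch_ext _
  (fun x => (Re (f x))%:C + iC * (Im (f x))%:C)).
  by move=> x; apply: complexP; rewrite ?ReD ?ImD ?ReM ?ImM /=; ring.
apply: schD; [|apply: schZ].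
- exists (partial_span (fun x => Re (f x))); first exact: partial_span_stable.
  exact: (@partial_span_base _ [::]).
- exists (partial_span (fun x => Im (f x))); first exact: partial_span_stable.
  exact: (@partial_span_base _ [::]).
Qed.

Lemma sch_rapid f (N : nat) : sch f ->
  exists M, forall x, enorm x ^+ N * modulus (f x) <= M.
Proof.
elim: N f => [|N IH] f sf.
  by have [M HM] := sch_bounded sf; exists M => x; rewrite expr0 mul1r.
have [A HA] := IH _ (sch_crd ord0 sf); have [B HB] := IH _ (sch_crd ord_max sf).
exists (A + B) => x; apply: le_trans _ (lerD (HA x) (HB x)).
rewrite !modulusM !modulusR -mulrDr -mulrDl exprSr -mulrA ler_wpM2l//.
  by rewrite exprn_ge0// enorm_ge0.
by rewrite ler_wpM2r ?modulus_ge0// enorm_le_crd.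
Qed.

(** This direction lets functions built in the proof enter the definitions: the Gaussian cutoff in
    [oscillatory_chirp] and the intensity tested in [represented_by]. *)
Lemma sch_schwartz f : sch f -> schwartz f.
Proof.
move=> sf.
have main (p : R[i] -> R) : (forall z, `|p z| <= modulus z) ->
    (forall g, sch g -> continuous (fun x => p (g x))) ->
    (forall g i x l, is_cpartial i g x l ->
       is_derive x (coord_dir R i) (fun y => p (g y)) (p l)) ->
    smooth (fun x => p (f x)) /\ rapidly_decaying (fun x => p (f x)).
  move=> pm pc pd.
  have it s : exists2 g, sch g & iter_partial s (fun x => p (f x)) = (fun x => p (g x)).
    elim: s => [|i s [g sg gE]]; first by exists f.
    have [h sh hd] := sch_partial i sg; exists h => //=.
    apply/funext => x; rewrite /partial gE.
    exact: (@derive_val _ _ _ _ _ _ _ (pd _ _ _ _ (hd x))).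
  split.
    move=> s; have [g sg ->] := it s; split; first exact: pc.
    move=> i x; have [h sh hd] := sch_partial i sg.
    exact: (@ex_derive _ _ _ _ _ _ _ (pd _ _ _ _ (hd x))).
  move=> N s; have [g sg ->] := it s; have [M HM] := sch_rapid N sg.
  exists M => x; apply: le_trans (HM x); rewrite ler_wpM2l//.
  by rewrite exprn_ge0// enorm_ge0.
have [] := main (@Re R) (@Re_le_modulus R).
- by move=> g /sch_ccontinuous[].
- by move=> g i x l [].
move=> ? ?; have [] := main (@Im R) (@Im_le_modulus R).
- by move=> g /sch_ccontinuous[].
- by move=> g i x l [].
by move=> ? ?; split.
Qed.

End SchwartzClass.

(** * Integrable transform of the scattered field *)

Section Phase.
Context {R : realType}.
Implicit Types (f g h : R * R -> R[i]) (u W : R * R -> R) (x y k : R * R) (i : 'I_2).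

Definition growth x : R := 1 + `|x.1| + `|x.2|.

Lemma growth_ge1 x : 1 <= growth x.
Proof. by rewrite /growth -addrA lerDl addr_ge0. Qed.

Lemma growth_weight x : growth x ^+ 2 * weight x <= 3.
Proof.
rewrite /weight /weight1 -invfM ler_pdivrMr; last by rewrite mulr_gt0// ltr_pwDl// sqr_ge0.
rewrite -[x.1 ^+ 2]real_normK ?num_real// -[x.2 ^+ 2]real_normK ?num_real// /growth.
move: (`|x.1| : R) (`|x.2| : R) => a b.
rewrite -subr_ge0 (_ : _ - _ = (a - 1) ^+ 2 + (b - 1) ^+ 2 + (a - b) ^+ 2 + 3 * (a * b) ^+ 2).
  by rewrite !addr_ge0 ?sqr_ge0// mulr_ge0 ?sqr_ge0.
by ring.
Qed.

(** The exponent is 2 because the mixed second derivative of [expi (W x)] contains a product of two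
    first derivatives of [W], each of linear growth. *)
Lemma sch_growth f : sch f -> exists2 M, 0 <= M &
  forall x, growth x ^+ 2 * modulus (f x) <= M * weight x.
Proof.
move=> sf; have [M M0 fM] := sch_decay (sch_inv_weight sf).
exists (3 * M) => [|x]; first by rewrite mulr_ge0.
have := fM x; rewrite modulusM modulusR ger0_norm ?invr_ge0 ?(ltW (weight_gt0 _))//.
rewrite ler_pdivrMl ?weight_gt0// => H.
have g0 : 0 <= growth x ^+ 2 by rewrite sqr_ge0.
apply: le_trans (ler_wpM2l g0 H) _.
have w0 := ltW (weight_gt0 x).
by rewrite mulrA -[leRHS]mulrA ler_wpM2r ?growth_weight// mulr_ge0.
Qed.

(** This inequality and the next collect the terms of the two derivatives in
    [phase_fourier_integrable] under one constant: the coefficients that occur, at most [1 + A] or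
    [2 A + A^2], all lie below [(1 + A)^2]. *)
Lemma phase_bound1 (A m n p q a b : R) : 0 <= A -> 0 <= m -> 0 <= n -> 0 <= p -> 0 <= q ->
  a <= n -> b <= A * m -> a + b <= (1 + A) ^+ 2 * (m + n + p + q).
Proof.
move=> A0 m0 n0 p0 q0 an bm; apply: le_trans (lerD an bm) _.
rewrite -subr_ge0 (_ : _ - _ = m + p + q + A * (m + n + n + p + p + q + q)
  + A ^+ 2 * (m + n + p + q)); last by ring.
by rewrite !addr_ge0 ?mulr_ge0 ?addr_ge0 ?sqr_ge0.
Qed.

Lemma phase_bound2 (A m n p q a b c d e g h : R) :
  0 <= A -> 0 <= m -> 0 <= n -> 0 <= p -> 0 <= q ->
  a <= A * m -> b <= A * n -> c <= A ^+ 2 * m -> d <= p -> e <= q -> g <= A * m ->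
  h <= A * p -> a + b + c + (d + e + (g + h)) <= (1 + A) ^+ 2 * (m + n + p + q).
Proof.
move=> A0 m0 n0 p0 q0 am bn cm dp eq gm hp.
apply: le_trans (lerD (lerD (lerD am bn) cm) (lerD (lerD dp eq) (lerD gm hp))) _.
rewrite -subr_ge0 (_ : _ - _ = m + n + A * (n + p + q + q) + A ^+ 2 * (n + p + q)); last by ring.
by rewrite !addr_ge0 ?mulr_ge0 ?addr_ge0 ?sqr_ge0.
Qed.

(** Expanding [(1 + d_0)(1 + d_1)] on [expi W * f] produces only [W0], [W1], their product and the
    mixed derivative [W01]. The linear growth of the first two is paid by the Schwartz factor. *)
Lemma phase_fourier_integrable W W0 W1 W01 (A : R) f :
  continuous W -> continuous W0 -> continuous W1 -> continuous W01 ->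
  (forall x, is_derive x (coord_dir R ord0) W (W0 x)) ->
  (forall x, is_derive x (coord_dir R ord_max) W (W1 x)) ->
  (forall x, is_derive x (coord_dir R ord_max) W0 (W01 x)) ->
  (forall x, `|W0 x| <= A * growth x) -> (forall x, `|W1 x| <= A * growth x) ->
  (forall x, `|W01 x| <= A) -> sch f ->
  cintegrable (leb2 R) (fourier (fun x => expi (W x) * f x)).
Proof.
move=> Wc W0c W1c W01c d0 d1 d01 A0 A1 A01 sf.
have [f0 sf0 df0] := sch_partial ord0 sf; have [f1 sf1 df1] := sch_partial ord_max sf.
have [f01 sf01 df01] := sch_partial ord_max sf0.
(* [g] is [(1 + d_0)] of the phased function with the phase stripped off, and [g1] is its derivative
   along the second axis. *)
pose g x := f x + f0 x + iC * (W0 x)%:C * f x.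
pose g1 x := f1 x + f01 x + (iC * (W01 x)%:C * f x + iC * (W0 x)%:C * f1 x).
have Ap : 0 <= A by exact: le_trans (normr_ge0 _) (A01 0).
have cE : ccontinuous (fun x => expi (W x)) by exact: ccontinuous_expi.
have cf := sch_ccontinuous sf; have cf0 := sch_ccontinuous sf0.
have cf1 := sch_ccontinuous sf1; have cf01 := sch_ccontinuous sf01.
have cW h u : continuous u -> ccontinuous h -> ccontinuous (fun x => iC * (u x)%:C * h x).
  move=> uc hc; apply: ccontinuousM => //; apply: ccontinuousM; first exact: ccontinuous_cst.
  exact: ccontinuous_real.
have [M M0 fM] := sch_growth sf; have [N N0 fN] := sch_growth sf0.
have [P P0 fP] := sch_growth sf1; have [Q Q0 fQ] := sch_growth sf01.
pose C := (1 + A) ^+ 2 * (M + N + P + Q).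
have w0 x : 0 <= weight x by exact: ltW (weight_gt0 x).
have S0 K x : 0 <= K -> 0 <= K * weight x by move=> K0; exact: mulr_ge0.
have q1 := growth_ge1.
have CW x : C * weight x = (1 + A) ^+ 2 * (M * weight x + N * weight x + P * weight x + Q * weight x).
  by rewrite /C; ring.
have mE x z : modulus (expi (W x) * z) = modulus z by rewrite modulusM modulus_expi mul1r.
have mW (a : R) z : modulus (iC * a%:C * z) = `|a| * modulus z.
  by rewrite !modulusM modulus_iC mul1r modulusR.
have h1 h K x : growth x ^+ 2 * modulus (h x) <= K -> modulus (h x) <= K.
  by apply: le_trans; rewrite ler_peMl ?modulus_ge0// expr_ge1 ?(le_trans ler01).
have h2 h K x : growth x ^+ 2 * modulus (h x) <= K -> forall a, `|a| <= A * growth x ->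
    `|a| * modulus (h x) <= A * K.
  move=> H a aA; apply: le_trans (ler_wpM2r (modulus_ge0 _) aA) _.
  rewrite -mulrA ler_wpM2l//; apply: le_trans H.
  by rewrite expr2 -mulrA ler_peMl ?mulr_ge0 ?modulus_ge0// (le_trans ler01).
have h3 h K x : growth x ^+ 2 * modulus (h x) <= K ->
    `|W1 x| * (`|W0 x| * modulus (h x)) <= A ^+ 2 * K.
  move=> H; rewrite mulrA; apply: le_trans (_ : (A * growth x) ^+ 2 * modulus (h x) <= _).
    by rewrite ler_wpM2r ?modulus_ge0// expr2 ler_pM.
  by rewrite exprMn -mulrA ler_wpM2l// sqr_ge0.
apply: (@fourier_integrable R _ (fun x => expi (W x) * (f0 x + iC * (W0 x)%:C * f x))
  (fun x => expi (W x) * (iC * (W1 x)%:C * g x + g1 x)) C).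
- by apply: ccontinuous_pmeasurable; exact: ccontinuousM.
- apply: ccontinuous_pmeasurable; apply: ccontinuousM => //; apply: ccontinuousD => //.
  exact: cW.
- apply: ccontinuous_pmeasurable; apply: ccontinuousM => //; apply: ccontinuousD => //.
    apply: (cW) => //; apply: ccontinuousD; last exact: cW.
    exact: ccontinuousD.
  apply: ccontinuousD; first exact: ccontinuousD.
  by apply: ccontinuousD; exact: cW.
- move=> x; apply: is_cpartial_ext (is_cpartialM (is_cpartial_expi (d0 x)) (df0 x)) => //.
  by ring.
- move=> x.
  have H := is_cpartialM (is_cpartial_expi (d1 x))
   (is_cpartialD (is_cpartialD (df1 x) (df01 x))
    (is_cpartialM (is_cpartialZ iC (is_cpartial_real (d01 x))) (df1 x))).
  apply: is_cpartial_ext H; first by move=> z; ring.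
  by rewrite /g /g1; ring.
- move=> x; rewrite mE CW; apply: le_trans (h1 _ _ x (fM x)) _.
  have K0 : 0 <= M + N + P + Q by rewrite !addr_ge0.
  rewrite -!mulrDl; apply: le_trans (_ : (M + N + P + Q) * weight x <= _).
    by rewrite ler_wpM2r// -!addrA lerDl !addr_ge0.
  by rewrite ler_peMl ?S0// exprn_ege1// lerDl.
- move=> x; rewrite mE CW; apply: le_trans (modulusD _ _) _; rewrite mW.
  apply: phase_bound1; rewrite ?S0//; [exact: h1 (fN x)|exact: h2 (fM x) _ (A0 x)].
- move=> x; rewrite mE CW.
  apply: (@le_trans _ _ (`|W1 x| * modulus (f x) + `|W1 x| * modulus (f0 x) +
    `|W1 x| * (`|W0 x| * modulus (f x)) +
    (modulus (f1 x) + modulus (f01 x) + (`|W01 x| * modulus (f x) + `|W0 x| * modulus (f1 x))))).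
    apply: le_trans (modulusD _ _) (lerD _ _).
      rewrite mW -!mulrDr ler_wpM2l// /g; apply: le_trans (modulusD _ _) _.
      by rewrite mW lerD2r modulusD.
    apply: le_trans (modulusD _ _) (lerD (modulusD _ _) _).
    by apply: le_trans (modulusD _ _) _; rewrite !mW.
  apply: phase_bound2; rewrite ?S0//.
  - exact: h2 (fM x) _ (A1 x).
  - exact: h2 (fN x) _ (A1 x).
  - exact: h3 (fM x).
  - exact: h1 (fP x).
  - exact: h1 (fQ x).
  - exact: ler_pM (normr_ge0 _) (modulus_ge0 _) (A01 x) (h1 _ _ x (fM x)).
  - exact: h2 (fP x) _ (A0 x).
Qed.

Lemma plane_affine0 (s : R) x : plane_affine s 0 x = s *: x.
Proof. by rewrite /plane_affine !add0r; case: x. Qed.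

Lemma is_derive_dilate (s : R) u i x l : is_derive (s *: x) (coord_dir R i) u l ->
  is_derive x (coord_dir R i) (fun y => u (s *: y)) (s * l).
Proof.
rewrite -plane_affine0 => ul.
have [H _] := is_cpartial_affine (is_cpartial_real ul).
apply: is_derive_ext H; first by move=> z; rewrite plane_affine0.
by rewrite ReM /= mul0r subr0.
Qed.

Lemma continuous_dilate (s : R) u : continuous u -> continuous (fun x => u (s *: x)).
Proof.
move=> uc; under eq_fun do rewrite -plane_affine0.
by move=> x; apply: continuous_comp; [exact: continuous_plane_affine|exact: uc].
Qed.

Lemma continuous_scalel (a : R) u : continuous u -> continuous (fun x => a * u x).
Proof. by move=> uc x; apply: cvgM; [exact: cvg_cst|exact: uc]. Qed.

(** Go from the origin to [x] along the two axes; on each leg the mean value theorem costs at most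
    [M] times the length. *)
Lemma partial_growth u (M : R) : smooth u ->
  (forall i j x, `|iter_partial [:: i; j] u x| <= M) ->
  exists2 A, 0 <= A & forall i x, `|partial i u x| <= A * growth x.
Proof.
move=> us uM; have M0 : 0 <= M by exact: le_trans (normr_ge0 _) (uM ord0 ord0 0).
exists (`|partial ord0 u 0| + `|partial ord_max u 0| + M) => [|i x]; first by rewrite !addr_ge0.
have d j y : is_derive y (coord_dir R j) (partial i u) (iter_partial [:: j; i] u y).
  by apply: DeriveDef => //; exact: (us [:: i]).2.
have [c _ Ec] := derivable_mean_value 0 (d ord0) x.1.
have [c' _ Ec'] := derivable_mean_value (0 + x.1 *: coord_dir R ord0) (d ord_max) x.2.
have Ex : 0 + x.1 *: coord_dir R ord0 + x.2 *: coord_dir R ord_max = x.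
  rewrite add0r /coord_dir /= [LHS]surjective_pairing/= !scaler0 addr0 add0r.
  by rewrite /GRing.scale /= !mulr1 -surjective_pairing.
rewrite Ex in Ec'.
have -> : partial i u x = partial i u 0 + iter_partial [:: ord0; i] u (0 + c *: coord_dir R ord0) * x.1
  + iter_partial [:: ord_max; i] u (0 + x.1 *: coord_dir R ord0 + c' *: coord_dir R ord_max) * x.2.
  have tele (p q r : R) : r = p + (q - p) + (r - q) by ring.
  by rewrite -Ec -Ec'; exact: tele.
apply: le_trans (ler_normD _ _) _; apply: le_trans (lerD (ler_normD _ _) (lexx _)) _.
rewrite !normrM.
have h j z (t : R) : `|iter_partial [:: j; i] u z| * `|t| <= M * `|t| by rewrite ler_wpM2r.
apply: le_trans (lerD (lerD (lexx _) (h _ _ _)) (h _ _ _)) _.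
have p0 : `|partial i u 0| <= `|partial ord0 u 0| + `|partial ord_max u 0|.
  by case: (ord2P i) => ->; [rewrite lerDl|rewrite lerDr].
rewrite -addrA -mulrDr mulrDl; apply: lerD.
  apply: le_trans p0 _; rewrite ler_peMr ?addr_ge0//; exact: growth_ge1.
by rewrite ler_wpM2l// /growth -addrA lerDr.
Qed.

Lemma growth_dilate (s : R) x : growth (s *: x) <= (1 + `|s|) * growth x.
Proof.
rewrite /growth /= /GRing.scale /= !normrM.
have := normr_ge0 s; have := normr_ge0 x.1; have := normr_ge0 x.2.
move: (`|s| : R) (`|x.1| : R) (`|x.2| : R) => a b c; nra.
Qed.

(* The Fourier transform of the field just behind the interface is integrable;
   only two bounded derivatives of the phase are available, so this is not a
   consequence of absolute decay estimates. *)
Lemma scattered_fourier_integrable u (M tau s : R) f : smooth u ->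
  (forall i j x, `|iter_partial [:: i; j] u x| <= M) -> sch f ->
  cintegrable (leb2 R) (fourier (fun x => expi (tau * u (s *: x)) * f x)).
Proof.
move=> us uM sf; have [A A0 uA] := partial_growth us uM.
have M0 : 0 <= M by exact: le_trans (normr_ge0 _) (uM ord0 ord0 0).
(* The first summand serves the first derivatives after dilation, with [1 + |s|] from
   [growth_dilate]; the second serves the mixed derivative. *)
pose B := `|tau * s| * (A * (1 + `|s|)) + `|tau * s ^+ 2| * M.
have bA i x : `|tau * (s * partial i u (s *: x))| <= B * growth x.
  rewrite mulrA normrM; have gx := growth_ge1 x.
  apply: (@le_trans _ _ (`|tau * s| * (A * (1 + `|s|)) * growth x)); last first.
    rewrite ler_wpM2r ?(le_trans ler01)// lerDl mulr_ge0//.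
  rewrite -mulrA ler_wpM2l//; apply: le_trans (uA _ _) _.
  by rewrite -mulrA ler_wpM2l// growth_dilate.
have c1 i : continuous (fun x => tau * (s * partial i u (s *: x))).
  do 2 apply: continuous_scalel; apply: continuous_dilate.
  exact: (us [:: i]).1.
have D i x : is_derive x (coord_dir R i) (fun x => tau * u (s *: x)) (tau * (s * partial i u (s *: x))).
  apply: is_derive_scale; apply: is_derive_dilate.
  by apply: DeriveDef => //; exact: (us [::]).2.
apply: (@phase_fourier_integrable _ (fun x => tau * (s * partial ord0 u (s *: x)))
  (fun x => tau * (s * partial ord_max u (s *: x)))
  (fun x => tau * (s * (s * iter_partial [:: ord_max; ord0] u (s *: x)))) B) => //.
- by apply: continuous_scalel; apply: continuous_dilate; exact: (us [::]).1.
- do 3 apply: continuous_scalel; apply: continuous_dilate.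
  exact: (us [:: ord_max; ord0]).1.
- move=> x; do 2 apply: is_derive_scale; apply: is_derive_dilate.
  by apply: DeriveDef => //; exact: (us [:: ord0]).2.
- move=> x; rewrite (_ : _ * _ = tau * s ^+ 2 * iter_partial [:: ord_max; ord0] u (s *: x)); last by ring.
  rewrite normrM /B; apply: le_trans (ler_wpM2l (normr_ge0 _) (uM _ _ _)) _.
  by rewrite lerDr mulr_ge0// mulr_ge0// addr_ge0.
Qed.

End Phase.

(** * Oscillatory integrals of chirps and the matched field template *)

Section OscillatoryIntegral.
Context {R : realType}.
Implicit Types (f g h : R * R -> R[i]) (x y k p : R * R) (a : R).

Lemma sch_neg f : sch f -> sch (fun x => f (- x)).
Proof.
move=> sf; have := sch_affine 0 (_ : (-1 : R) != 0) sf; rewrite oppr_eq0 oner_eq0 => /(_ isT).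
by apply: sch_ext => x; rewrite plane_affine0 scaleN1r.
Qed.

Lemma cintegral_neg f : cintegrable (leb2 R) f ->
  cintegral (leb2 R) f = cintegral (leb2 R) (fun x => f (- x)).
Proof.
move=> fi; have N1 : (-1 : R) != 0 by rewrite oppr_eq0 oner_eq0.
rewrite (cintegral_affine N1 0 fi) sqrrN expr1n mul1r; apply: eq_plane_cintegral => x.
by rewrite plane_affine0 scaleN1r.
Qed.

(** The inverse transform. It presents an arbitrary Schwartz cutoff as a Fourier transform, which is
    the form that [chirp_multiplier] handles. *)
Definition sch_preimage f x : R[i] := ((2 * pi) ^- 2 : R)%:C * fourier f (- x).

Lemma sch_preimage_sch f : sch f -> sch (sch_preimage f).
Proof. by move=> sf; apply: schZ; apply: (sch_neg (f := fourier f)); exact: sch_fourier. Qed.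

Lemma fourier_sch_preimage f : sch f -> fourier (sch_preimage f) = f.
Proof.
move=> sf; have sF := sch_fourier sf; apply/funext => k.
have pi20 : (2 * pi) ^+ 2 != 0 :> R by rewrite expf_neq0// mulf_neq0// gt_eqF ?pi_gt0.
rewrite fourierZ; last exact: sch_integrable (sch_neg sF).
transitivity (((2 * pi) ^- 2)%:C * cintegral (leb2 R) (fun x => expi (dot k x) * fourier f x)).
  have wi := cintegrable_wave k (sch_integrable sF).
  rewrite (cintegral_neg wi); congr (_ * _).
  by apply: eq_plane_cintegral => x; rewrite -dotNr.
under eq_plane_cintegral do rewrite dotC.
by rewrite fourier_inversion// mulrA -RCM mulVf// mul1r.
Qed.

(** Rescaling [k] moves [delta] from the cutoff to the chirp, and the Fresnel formula applies with
    parameter [a / delta^2]. Afterwards [delta] survives only inside a unimodular factor, so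
    dominated convergence will apply. *)
Lemma scaled_cutoff_integral X a p (delta : R) : a != 0 -> 0 < delta -> sch X ->
  cintegral (leb2 R) (fun k => fourier X (delta *: k) * (chirp (- a) k * expi (dot k p))) =
  (2 * pi)%:C * (iC * (- a^-1)%:C) *
    cintegral (leb2 R) (fun y => X y * chirp a^-1 (delta *: y - p)).
Proof.
move=> a0 d0 sX.
have dn : delta != 0 by rewrite gt_eqF.
have dV : delta^-1 != 0 by rewrite invr_eq0.
have ad : a / delta ^+ 2 != 0 by rewrite mulf_neq0// invr_eq0 expf_neq0.
pose F k : R[i] := fourier X (delta *: k) * (chirp (- a) k * expi (dot k p)).
have Fi : cintegrable (leb2 R) F.
  have sF : sch (fun k => fourier X (delta *: k)).
    by apply: sch_ext (sch_affine 0 dn (sch_fourier sX)) => x; rewrite plane_affine0.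
  have := cintegrable_wave p (sch_integrable (sch_chirp (- a) sF)).
  by congr cintegrable; apply/funext => k; rewrite /F (dotC k p); ring.
rewrite -/F (cintegral_affine dV 0 Fi).
transitivity ((delta^-1 ^+ 2)%:C * cintegral (leb2 R) (fun k => expi (dot k (delta^-1 *: p)) *
    (chirp (- (a / delta ^+ 2)) k * fourier X k))).
  congr (_ * _); apply: eq_plane_cintegral => k; rewrite /F plane_affine0 scalerA mulfV// scale1r.
  rewrite mulrC -mulrA mulrCA; congr (_ * _); last first.
    by congr (_ * _); congr expi; rewrite /dot /= /GRing.scale /=; field.
  by congr (expi _); rewrite /dot /= /GRing.scale /=; ring.
rewrite chirp_multiplier//; [|exact: sch_integrable|exact/sch_integrable/sch_fourier].
rewrite !mulrA; congr (_ * _).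
  have -> : - a^-1 = delta^-1 ^+ 2 * - (a / delta ^+ 2)^-1 by field; rewrite dn.
  by rewrite RCM; ring.
apply: eq_plane_cintegral => y; congr (_ * expi _).
by rewrite /dot /= /GRing.scale /=; field; rewrite ?a0 ?dn.
Qed.

(** In the limit the chirp freezes at [p] and leaves the integral of [sch_preimage chi], which is
    [chi 0 = 1]; hence the limit is the same for all cutoffs. *)
Lemma is_oscillatory_chirp a p : a != 0 ->
  is_oscillatory_integral (fun k => chirp (- a) k * expi (dot k p))
    ((2 * pi)%:C * (iC * (- a^-1)%:C) * chirp a^-1 p).
Proof.
move=> a0 chi /schwartz_sch sc chi0.
(* Passing to sequences gives access to dominated convergence. *)
apply/cvg_at_rightP => d_ [d0 dc].
apply/(@ccvg_modulusP R nat \oo _ (fun n => cintegral (leb2 R) (fun k => chi (d_ n *: k) * (chirp (- a) k * expi (dot k p))))).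
have sX := sch_preimage_sch sc.
have E n : cintegral (leb2 R) (fun k => chi (d_ n *: k) * (chirp (- a) k * expi (dot k p))) =
  (2 * pi)%:C * (iC * (- a^-1)%:C) *
    cintegral (leb2 R) (fun y => sch_preimage chi y * chirp a^-1 (d_ n *: y - p)).
  by rewrite -(scaled_cutoff_integral _ a0 (d0 n) sX) fourier_sch_preimage.
under eq_fun do rewrite E.
apply: ccvgM; first exact: ccvg_cst.
have -> : chirp a^-1 p = cintegral (leb2 R) (fun y => sch_preimage chi y * chirp a^-1 (0 *: y - p)).
  have Ep y : sch_preimage chi y * chirp a^-1 (0 *: y - p) = chirp a^-1 p * (expi (- dot 0 y) * sch_preimage chi y).
    rewrite (_ : expi (- dot 0 y) = 1); last by rewrite /dot /= !mul0r addr0 oppr0 expi0.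
    by rewrite mul1r mulrC; congr (expi _ * _); rewrite scale0r sub0r dotNr dotC dotNr opprK.
  under eq_plane_cintegral do rewrite Ep.
  rewrite cintegralZ; last exact/cintegrable_waveM/sch_integrable.
  by rewrite -/(fourier (sch_preimage chi) 0) fourier_sch_preimage// chi0 mulr1.
have mX := ccontinuous_pmeasurable (sch_ccontinuous sX).
have cc (t : R) : ccontinuous (fun y : R * R => chirp a^-1 (t *: y - p)).
  have -> : (fun y : R * R => chirp a^-1 (t *: y - p)) = fun y => chirp a^-1 (plane_affine t (- p) y).
    by apply/funext => y; rewrite addrC; congr chirp; case: (p); case: y.
  by apply: ccontinuous_affine; exact: ccontinuous_chirp.
apply: (plane_dominated (M := fun x => modulus (sch_preimage chi x))).
- by move=> n; apply: cmeasurableM => //; exact: ccontinuous_pmeasurable.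
- by apply: cmeasurableM => //; exact: ccontinuous_pmeasurable.
- move=> y; apply: ccvgM; first exact: ccvg_cst.
  have -> : (fun n => chirp a^-1 (d_ n *: y - p)) = fun n => chirp a^-1 (plane_affine (d_ n) (- p) y).
    by apply/funext => n; rewrite addrC; congr chirp; case: (p); case: y.
  have -> : chirp a^-1 (0 *: y - p) = chirp a^-1 (plane_affine 0 (- p) y).
    by rewrite addrC; congr chirp; case: (p); case: y.
  by apply: ccvg_comp_continuous; [exact: ccontinuous_chirp|exact: plane_affine_cvg].
- by move=> n x; rewrite modulusM modulus_chirp mulr1.
- by apply: cintegrable_modulus; exact: sch_integrable.
Qed.

(** [xget] selects some admissible limit, so its value is known only once the limit is unique;
    testing on a single cutoff, the Gaussian, decides that. *)
Lemma oscillatory_chirp a p : a != 0 ->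
  oscillatory_integral (fun k => chirp (- a) k * expi (dot k p)) =
  (2 * pi)%:C * (iC * (- a^-1)%:C) * chirp a^-1 p.
Proof.
move=> a0; apply: xget_unique; first exact: is_oscillatory_chirp.
move=> l ol; pose chi : R * R -> R[i] := gauss 1 0.
have sc : schwartz chi by apply: sch_schwartz; apply: sch_gauss.
have c0 : chi 0 = 1 by exact: gauss0.
have := ol _ sc c0; have := is_oscillatory_chirp p a0 sc c0.
move=> /(@ccvg_modulusP _ _ (0 : R)^'+ _ (fun delta : R => cintegral (leb2 R) (fun k => chi (delta *: k) * (chirp (- a) k * expi (dot k p))))) h1.
move=> /(@ccvg_modulusP _ _ (0 : R)^'+ _ (fun delta : R => cintegral (leb2 R) (fun k => chi (delta *: k) * (chirp (- a) k * expi (dot k p))))) h2.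
exact: ccvg_uniq h2 h1.
Qed.

Lemma propagator_chirp (omega c z : R) k : propagator omega c k z = chirp (- (z * c / omega)) k.
Proof. by rewrite /propagator /chirp; congr expi; rewrite invfM; ring. Qed.

Lemma chirpM a b x : chirp a x * chirp b x = chirp (a + b) x.
Proof. by rewrite /chirp -expiD; congr expi; ring. Qed.

Lemma U_mf_chirp (omega c0 c1 z_int z_obs : R) x y :
  let a := (z_obs - z_int) * c1 / omega + z_int * c0 / omega in a != 0 ->
  U_mf omega c0 c1 z_int z_obs x y =
  ((2 * pi)^-1 : R)%:C * (iC * (- a^-1)%:C) * chirp a^-1 (x - y).
Proof.
move=> a a0; rewrite /U_mf.
have -> : (fun k => propagator omega c1 k (z_obs - z_int) * propagator omega c0 k z_int *
    expi (dot k (x - y))) = (fun k => chirp (- a) k * expi (dot k (x - y))).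
  by apply/funext => k; rewrite !propagator_chirp chirpM -opprD.
rewrite oscillatory_chirp// !mulrA -RCM; congr (_%:C * _ * _ * _).
have p0 : 2 * pi != 0 :> R by rewrite mulf_neq0// gt_eqF// pi_gt0.
by rewrite expr2 invfM -mulrA mulVf// mulr1.
Qed.

End OscillatoryIntegral.

(** * Composition of Fresnel propagations *)

Section ChirpCalculus.
Context {R : realType}.
Implicit Types (f g h : R * R -> R[i]) (x y k u : R * R) (a b c : R).

Lemma chirpB c u x : chirp c (u - x) = chirp c u * chirp c x * expi (- dot (c *: x) u).
Proof.
rewrite /chirp -!expiD; congr expi.
by rewrite /dot /= /GRing.scale /=; field.
Qed.

Lemma chirpJ c x : (chirp c x)^* = chirp (- c) x.
Proof. by rewrite /chirp expiJ; congr expi; rewrite !mulNr. Qed.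

Lemma chirpK c x : chirp c x * chirp (- c) x = 1.
Proof. by rewrite chirpM subrr /chirp !mul0r expi0. Qed.

Lemma cintegrable_chirp c g : cintegrable (leb2 R) g ->
  cintegrable (leb2 R) (fun x => chirp c x * g x).
Proof.
move=> gi; apply: (cintegrable_bounded_mul (M := 1)) => //.
  by apply: ccontinuous_pmeasurable; exact: ccontinuous_chirp.
by move=> x; rewrite modulus_chirp.
Qed.

Lemma cintegrable_wavel x g : cintegrable (leb2 R) g ->
  cintegrable (leb2 R) (fun k => expi (dot k x) * g k).
Proof. by move=> /(cintegrable_wave x); under eq_fun do rewrite dotC. Qed.

(** Expanding the square in the phase: a Fresnel integral is a Fourier transform at frequency
    [c *: x], framed by two chirps. *)
Lemma chirp_convolution c g x : cintegrable (leb2 R) g ->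
  cintegral (leb2 R) (fun u => g u * chirp c (u - x)) =
  chirp c x * fourier (fun u => chirp c u * g u) (c *: x).
Proof.
move=> gi; rewrite -cintegralZ; last exact/cintegrable_waveM/cintegrable_chirp.
by apply: eq_plane_cintegral => u; rewrite chirpB; ring.
Qed.

Lemma conj_chirp_kernel a x :
  @conjc R (((2 * pi)^-1)%:C * (iC * (- a^-1)%:C) * chirp a^-1 x) =
  ((2 * pi)^-1)%:C * (iC * (a^-1)%:C) * chirp (- a^-1) x.
Proof.
rewrite !cJM chirpJ; congr (_ * _ * _); first by apply: complexP; rewrite ?ReJ ?ImJ /= ?oppr0.
by apply: complexP; rewrite ?ReM ?ImM ?ReJ ?ImJ /=; ring.
Qed.

(* Propagation by b followed by matched filtering with a = b + a0 amounts to
   filtering with a0. *)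
Lemma matched_filter a0 b g y : 0 < a0 -> 0 < b ->
  cintegrable (leb2 R) g ->
  cintegrable (leb2 R) (fourier (fun u => chirp b^-1 u * g u)) ->
  let a := b + a0 in
  cintegral (leb2 R) (fun x =>
    (((2 * pi)^-1)%:C * (iC * (- b^-1)%:C) * cintegral (leb2 R) (fun u => g u * chirp b^-1 (u - x))) *
    (((2 * pi)^-1)%:C * (iC * (a^-1)%:C) * chirp (- a^-1) (x - y))) =
  ((2 * pi)^-1)%:C * (iC * (a0^-1)%:C) * cintegral (leb2 R) (fun u => g u * chirp (- a0^-1) (u - y)).
Proof.
move=> a00 b0 gi Hi a; have a_gt0 : 0 < a by rewrite addr_gt0.
have an : a != 0 by rewrite gt_eqF. have bn : b != 0 by rewrite gt_eqF.
have a0n : a0 != 0 by rewrite gt_eqF. have bVn : b^-1 != 0 by rewrite invr_eq0.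
pose h u := chirp b^-1 u * g u; have hi : cintegrable (leb2 R) h by exact: cintegrable_chirp.
pose c := ((2 * pi)^-1)%:C * ((2 * pi)^-1)%:C * (b^-1)%:C * (a^-1)%:C.
pose F x := c * (chirp b^-1 x * chirp (- a^-1) (x - y) * fourier h (b^-1 *: x)).
have -> : (fun x => (((2 * pi)^-1)%:C * (iC * (- b^-1)%:C) * cintegral (leb2 R) (fun u => g u * chirp b^-1 (u - x))) *
    (((2 * pi)^-1)%:C * (iC * (a^-1)%:C) * chirp (- a^-1) (x - y))) = F.
  apply/funext => x; rewrite chirp_convolution// /F /c -/h RCN.
  transitivity (- (iC * iC) * (((2 * pi)^-1)%:C * ((2 * pi)^-1)%:C * (b^-1)%:C * (a^-1)%:C *
    (chirp b^-1 x * chirp (- a^-1) (x - y) * fourier h (b^-1 *: x)))); first by ring.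
  by rewrite iC_sqr; ring.
have Fi : cintegrable (leb2 R) F.
  apply: cintegrableZ; apply: (cintegrable_bounded_mul (M := 1)).
  - apply: cmeasurableM; first by apply: ccontinuous_pmeasurable; exact: ccontinuous_chirp.
    apply: (pmeasurable_translate (f := chirp _)).
    by apply: ccontinuous_pmeasurable; exact: ccontinuous_chirp.
  - by move=> x; rewrite modulusM !modulus_chirp mulr1.
  - have := cintegrable_affine bVn 0 Hi.
    by under eq_fun do rewrite plane_affine0.
rewrite (cintegral_affine bn 0 Fi).
(* [be = b - b^2 / a] is the quadratic coefficient that the two chirps leave after the substitution
   [x = b k]. *)
pose be := b * a0 / a.
have ben : - be != 0 by rewrite oppr_eq0 !mulf_neq0// invr_eq0.
pose C := c * chirp (- a^-1) y.
transitivity ((b ^+ 2)%:C * (C * cintegral (leb2 R) (fun k => expi (dot k ((b / a) *: y)) *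
   (chirp (- - be) k * fourier h k)))).
  congr (_ * _); rewrite -cintegralZ; last exact/cintegrable_wavel/cintegrable_chirp.
  apply: eq_plane_cintegral => k; rewrite plane_affine0 /F scalerA mulVf// scale1r.
  have -> : chirp b^-1 (b *: k) * chirp (- a^-1) (b *: k - y) =
      chirp (- a^-1) y * (expi (dot k ((b / a) *: y)) * chirp (- - be) k).
    rewrite /chirp -!expiD; congr expi.
    rewrite /be /dot /= /GRing.scale /=; have : b + a0 = a by [].
    by move=> <-; field; rewrite /a in an; rewrite an bn.
  by rewrite /C; ring.
rewrite chirp_multiplier//.
transitivity ((b ^+ 2)%:C * (C * ((2 * pi)%:C * (iC * (- (- be)^-1)%:C) *
  (chirp a^-1 y * cintegral (leb2 R) (fun u => g u * chirp (- a0^-1) (u - y)))))).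
  congr (_ * (_ * (_ * _))); rewrite -cintegralZ; last first.
    under eq_fun do rewrite mulrC; apply: (cintegrable_bounded_mul (M := 1)) => //.
      apply: (pmeasurable_translate (f := chirp _)).
      by apply: ccontinuous_pmeasurable; exact: ccontinuous_chirp.
    by move=> x; rewrite modulus_chirp.
  apply: eq_plane_cintegral => u.
  (* Since [1 / b - 1 / be = - 1 / a0], the distance beyond the interface drops out of the quadratic
     phase. *)
  have E : chirp b^-1 u * chirp (- be)^-1 (u - (b / a) *: y) =
      chirp a^-1 y * chirp (- a0^-1) (u - y).
    rewrite /chirp -!expiD; congr expi.
    rewrite /be /dot /= /GRing.scale /=; have : b + a0 = a by [].
    by move=> <-; field; rewrite /a in an; rewrite an bn a0n.
  by rewrite /h; transitivity (g u * (chirp b^-1 u * chirp (- be)^-1 (u - (b / a) *: y)));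
    [ring|rewrite E; ring].
have p0 : 2 * pi != 0 :> R by rewrite mulf_neq0// gt_eqF// pi_gt0.
transitivity ((chirp a^-1 y * chirp (- a^-1) y) * (iC * ((b ^+ 2)%:C * ((2 * pi)^-1)%:C *
   ((2 * pi)^-1)%:C * (b^-1)%:C * (a^-1)%:C * (2 * pi)%:C * (- (- be)^-1)%:C) *
   cintegral (leb2 R) (fun u => g u * chirp (- a0^-1) (u - y)))).
  by rewrite /C /c; ring.
rewrite chirpK mul1r -!RCM.
have -> : b ^+ 2 * (2 * pi)^-1 * (2 * pi)^-1 * b^-1 * a^-1 * (2 * pi) * - (- be)^-1 = (2 * pi)^-1 * a0^-1.
  rewrite /be; move: (2 * pi) p0 => q q0; by field; rewrite q0 an bn a0n.
by rewrite RCM; ring.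
Qed.

Lemma fourier_affine a y f u : a != 0 -> cintegrable (leb2 R) f ->
  fourier (fun x => f (plane_affine a y x)) u =
  ((a ^+ 2)^-1)%:C * expi (dot (a^-1 *: u) y) * fourier f (a^-1 *: u).
Proof.
move=> a0 fi; rewrite [in RHS]/fourier (cintegral_affine a0 y); last exact: cintegrable_waveM.
have -> : fourier (fun x => f (plane_affine a y x)) u = expi (dot (a^-1 *: u) y) *
    cintegral (leb2 R) (fun x => expi (- dot (a^-1 *: u) (plane_affine a y x)) * f (plane_affine a y x)).
  rewrite -cintegralZ; last first.
    apply: (cintegrable_affine a0 y (f := fun x => expi (- dot (a^-1 *: u) x) * f x)).
    exact: cintegrable_waveM.
  apply: eq_plane_cintegral => x.
  rewrite mulrA -expiD; congr (expi _ * _).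
  by rewrite /dot /plane_affine /= /GRing.scale /=; field.
move: (cintegral _ _) => I.
transitivity (((a ^+ 2)%:C * ((a ^+ 2)^-1)%:C) * (expi (dot (a^-1 *: u) y) * I)); last by ring.
by rewrite -RCM mulfV ?mul1r// expf_neq0.
Qed.

End ChirpCalculus.

(** * The imaging functional in closed form *)

Section ImagingFunctional.
Context {R : realType}.
Variables (omega c0 c1 z_int z_obs : R) (Psi : R * R -> R[i]) (y : R * R).
Hypotheses (omega_gt0 : 0 < omega) (c0_gt0 : 0 < c0) (c1_gt0 : 0 < c1)
  (z_int_gt0 : 0 < z_int) (z_int_lt_obs : z_int < z_obs) (sPsi : sch Psi).

Let a0 := z_int * c0 / omega.
Let b := (z_obs - z_int) * c1 / omega.

(** The function [Theta] of the overview; its chirp factor is unimodular, so it has the intensity of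
    the shifted source. *)
Definition image_profile (k : R * R) : R[i] :=
  chirp a0^-1 (plane_affine a0 y k) * Psi (plane_affine a0 y k).

Let a0_gt0 : 0 < a0. Proof. by rewrite divr_gt0// mulr_gt0. Qed.
Let b_gt0 : 0 < b. Proof. by rewrite divr_gt0// mulr_gt0// subr_gt0. Qed.
Let a0n : a0 != 0. Proof. by rewrite gt_eqF. Qed.
Let bn : b != 0. Proof. by rewrite gt_eqF. Qed.

Lemma sch_image_profile : sch image_profile.
Proof.
exact: (sch_affine (f := fun x => chirp a0^-1 x * Psi x) _ a0n (sch_chirp _ sPsi)).
Qed.

Let f0 := inv_fourier (fun k => propagator omega c0 k z_int * fourier Psi k).

Let pi20 : 2 * pi != 0 :> R.
Proof. by rewrite mulf_neq0// gt_eqF// pi_gt0. Qed.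

Let pi2V : (2 * pi) ^- 2 * (2 * pi) = (2 * pi)^-1 :> R.
Proof. by rewrite expr2 invfM -mulrA mulVf// mulr1. Qed.

Let f0E x : f0 x = ((2 * pi)^-1)%:C * (iC * (- a0^-1)%:C) *
  (chirp a0^-1 x * fourier (fun u => chirp a0^-1 u * Psi u) (a0^-1 *: x)).
Proof.
rewrite /f0 /inv_fourier; under eq_plane_cintegral do rewrite propagator_chirp -/a0.
rewrite chirp_multiplier//; [|exact: sch_integrable|exact/sch_integrable/sch_fourier].
by rewrite chirp_convolution ?mulrA -?RCM ?pi2V//; exact: sch_integrable.
Qed.

(** The closed form [f0E] exhibits the field arriving at the interface as a chirp times a dilated
    Schwartz transform. Being Schwartz is what [scattered_fourier_integrable] asks of it. *)
Let sf0 : sch f0.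
Proof.
apply: (@sch_ext _ _ _ (fun x => esym (f0E x))); apply: schZ; apply: sch_chirp.
have an : a0^-1 != 0 by rewrite invr_eq0.
apply: sch_ext (sch_affine 0 an (sch_fourier (sch_chirp a0^-1 sPsi))) => x.
by rewrite plane_affine0.
Qed.

(** A statement about one realisation [u]. The matched filter undoes the propagation beyond the
    interface, and what remains of it undoes the propagation up to the interface except for a linear
    phase, the one produced by the transform of [image_profile]. *)
Lemma image_formula (u : R * R -> R) (M tau s : R) : smooth u ->
  (forall i j x, `|iter_partial [:: i; j] u x| <= M) ->
  cintegral (leb2 R) (fun x =>
    inv_fourier (fun k => scattering_operator (fun x => u (s *: x)) tau
      (fun k' => propagator omega c0 k' z_int * fourier Psi k') k
      * propagator omega c1 k (z_obs - z_int)) x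
    * (U_mf omega c0 c1 z_int z_obs x y)^*) =
  chirp (- a0^-1) y * (((2 * pi) ^- 2)%:C *
    cintegral (leb2 R) (fun x => expi (tau * u (s *: x)) * fourier image_profile x)).
Proof.
move=> us uM; pose g x := expi (tau * u (s *: x)) * f0 x.
have mm : pmeasurable (fun x => expi (tau * u (s *: x))).
  apply: ccontinuous_pmeasurable; apply: ccontinuous_expi; apply: continuous_scalel.
  by apply: continuous_dilate; exact: (us [::]).1.
have phase_int h : sch h -> cintegrable (leb2 R) (fun x => expi (tau * u (s *: x)) * h x).
  move=> sh; apply: (cintegrable_bounded_mul (M := 1)) => //; last exact: sch_integrable.
  by move=> x; rewrite modulus_expi.
have gi : cintegrable (leb2 R) g by exact: phase_int.
have Gi : cintegrable (leb2 R) (fourier g) by exact: scattered_fourier_integrable us uM sf0.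
(* The chirp is moved onto the Schwartz factor, so the same integrability result applies. *)
have Hi : cintegrable (leb2 R) (fourier (fun x => chirp b^-1 x * g x)).
  have -> : (fun x => chirp b^-1 x * g x) =
      (fun x => expi (tau * u (s *: x)) * (chirp b^-1 x * f0 x)).
    by apply/funext => x; rewrite /g mulrCA.
  exact: scattered_fourier_integrable us uM (sch_chirp b^-1 sf0).
have -> : (fun x => inv_fourier (fun k => scattering_operator (fun x => u (s *: x)) tau
      (fun k' => propagator omega c0 k' z_int * fourier Psi k') k
      * propagator omega c1 k (z_obs - z_int)) x
    * (U_mf omega c0 c1 z_int z_obs x y)^*) = (fun x =>
    (((2 * pi)^-1)%:C * (iC * (- b^-1)%:C) * cintegral (leb2 R) (fun u => g u * chirp b^-1 (u - x))) *
    (((2 * pi)^-1)%:C * (iC * ((b + a0)^-1)%:C) * chirp (- (b + a0)^-1) (x - y))).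
  apply/funext => x; rewrite U_mf_chirp -/a0 -/b; last by rewrite gt_eqF// addr_gt0.
  congr (_ * _); last exact: conj_chirp_kernel.
  rewrite /inv_fourier /scattering_operator.
  rewrite -/f0 -/g; under eq_plane_cintegral do rewrite propagator_chirp -/b [fourier _ _ * _]mulrC.
  by rewrite chirp_multiplier// !mulrA -RCM pi2V.
rewrite matched_filter//.
have E1 v : fourier image_profile v = ((a0 ^+ 2)^-1)%:C * expi (dot (a0^-1 *: v) y) *
    fourier (fun x => chirp a0^-1 x * Psi x) (a0^-1 *: v).
  by apply: fourier_affine => //; exact/sch_integrable/sch_chirp.
rewrite -[in RHS]cintegralZ; last exact/phase_int/sch_fourier/sch_image_profile.
rewrite -[in RHS]cintegralZ; last first.
  exact/cintegrableZ/phase_int/sch_fourier/sch_image_profile.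
rewrite -cintegralZ; last first.
  under eq_fun do rewrite mulrC; apply: (cintegrable_bounded_mul (M := 1)) => //.
    apply: (pmeasurable_translate (f := chirp _)).
    by apply: ccontinuous_pmeasurable; exact: ccontinuous_chirp.
  by move=> x; rewrite modulus_chirp.
apply: eq_plane_cintegral => v; rewrite /g f0E E1 chirpB.
have -> : expi (- dot (- a0^-1 *: y) v) = expi (dot (a0^-1 *: v) y).
  by congr expi; rewrite /dot /= /GRing.scale /=; ring.
(* Here the quadratic phases in [v] meet and cancel, and the two factors [i] combine into a sign. *)
transitivity ((chirp a0^-1 v * chirp (- a0^-1) v) * (- (iC * iC) *
   (chirp (- a0^-1) y * ((((2 * pi)^-1)%:C * ((2 * pi)^-1)%:C) * (expi (tau * u (s *: v)) *
    ((a0^-1)%:C * (a0^-1)%:C * expi (dot (a0^-1 *: v) y) *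
      fourier (fun x : R * R => chirp a0^-1 x * Psi x) (a0^-1 *: v))))))).
  by rewrite RCN; ring.
rewrite chirpK iC_sqr opprK !mul1r -!RCM.
by rewrite -[(2 * pi)^-1 * _]expr2 -[a0^-1 * _]expr2 !exprVn.
Qed.

End ImagingFunctional.

(** * Consequences of stationarity and isotropy *)

Section Law.
Context d (T : measurableType d) (R : realType) (P : probability T R).

Lemma eq_law_Rintegral (X Y : T -> R) (g : R -> R) (M : R) :
  measurable_fun setT X -> measurable_fun setT Y ->
  (forall B : set R, measurable B -> P (X @^-1` B) = P (Y @^-1` B)) ->
  measurable_fun [set: R] g -> (forall t, `|g t| <= M) ->
  Rintegral P setT (fun w => g (X w)) = Rintegral P setT (fun w => g (Y w)).
Proof.
move=> mX mY XY mg gM.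
have bounded_integrable (Z : T -> R) : measurable_fun setT Z ->
    P.-integrable setT (EFin \o (fun w => g (Z w))).
  move=> mZ; apply: (@rintegrable_le _ _ _ _ _ (fun=> M)).
  - exact: measurableT_comp.
  - by move=> w.
  - by apply: finite_measure_integrable_cst.
have mE : measurable_fun [set: R] (EFin \o g) by exact/measurable_EFinP.
have EX := @integral_pushforward _ _ _ _ R X mX P setT (EFin \o g) mE (bounded_integrable _ mX) measurableT.
have EY := @integral_pushforward _ _ _ _ R Y mY P setT (EFin \o g) mE (bounded_integrable _ mY) measurableT.
rewrite /Rintegral; congr fine; rewrite preimage_setT in EX EY.
rewrite -[LHS]EX -[RHS]EY; apply: eq_measure_integral => A mA _.
exact: XY.
Qed.

Lemma eq_law_expi (X Y : T -> R) :
  measurable_fun setT X -> measurable_fun setT Y ->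
  (forall B : set R, measurable B -> P (X @^-1` B) = P (Y @^-1` B)) ->
  forall tau, cintegral P (fun w => expi (tau * X w)) = cintegral P (fun w => expi (tau * Y w)).
Proof.
move=> mX mY XY tau; apply: complexP => /=.
- apply: (eq_law_Rintegral (g := fun t => cos (tau * t)) (M := 1) mX mY XY).
  + by apply: (measurableT_comp (f := cos)) => //; apply: continuous_measurable_fun => x; exact: continuous_cos.
  + by move=> t; rewrite ler_norml cos_geN1 cos_le1.
- apply: (eq_law_Rintegral (g := fun t => sin (tau * t)) (M := 1) mX mY XY).
  + by apply: (measurableT_comp (f := sin)) => //; apply: continuous_measurable_fun => x; exact: continuous_sin.
  + by move=> t; rewrite ler_norml sin_geN1 sin_le1.
Qed.

(** Equality of laws on function space is thereby brought down to linear combinations of two values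
    of the field, which covers both [phi_V] and [phi_DeltaV]. *)
Lemma field_measurable_affine (al be : R) (a b : R * R) (B : set R) :
  measurable B -> @field_measurable R [set f | B (al * f a + be * f b)].
Proof.
move=> mB.
pose G := [set E | exists (x : R * R) (B : set R), measurable B /\ E = [set f : R * R -> R | B (f x)]].
have ev x : measurable_fun setT (fun f : g_sigma_algebraType G => f x).
  move=> _ C mC; rewrite setTI; apply: sub_sigma_algebra.
  by exists x, C.
have m : measurable_fun setT (fun f : g_sigma_algebraType G => al * f a + be * f b).
  by apply: measurable_funD; apply: measurable_funM => //; exact: ev.
by have := m measurableT B mB; rewrite setTI.
Qed.

Lemma same_law_expi (X Y : R * R -> {RV P >-> R}) (tau al be : R) (a b : R * R) :
  same_law P X Y ->
  cintegral P (fun w => expi (tau * (al * X a w + be * X b w))) =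
  cintegral P (fun w => expi (tau * (al * Y a w + be * Y b w))).
Proof.
move=> XY; apply: (eq_law_expi (X := fun w => al * X a w + be * X b w)
   (Y := fun w => al * Y a w + be * Y b w)).
- by apply: measurable_funD; apply: measurable_funM.
- by apply: measurable_funD; apply: measurable_funM.
- by move=> B mB; exact: (XY _ (field_measurable_affine al be a b mB)).
Qed.

Variable V : R * R -> {RV P >-> R}.
Hypotheses (Vs : stationary V) (Vi : isotropic V).

Lemma phi_V_stationary tau x : cintegral P (fun w => expi (tau * V x w)) = phi_V V tau.
Proof.
have E (X : R * R -> {RV P >-> R}) z : (fun w => expi (tau * X z w)) =
    (fun w => expi (tau * (1 * X z w + 0 * X z w))).
  by apply/funext => w; rewrite mul1r mul0r addr0.
rewrite /phi_V (E V x) (E V 0).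
have := same_law_expi tau 1 0 0 0 (Vs x); by rewrite add0r.
Qed.

Lemma phi_DeltaV_stationary tau x y :
  cintegral P (fun w => expi (tau * (V x w - V y w))) = phi_DeltaV V tau (x - y).
Proof.
have E (X : R * R -> {RV P >-> R}) z1 z2 : (fun w => expi (tau * (X z1 w - X z2 w))) =
    (fun w => expi (tau * (1 * X z1 w + (-1) * X z2 w))).
  by apply/funext => w; rewrite mul1r mulN1r.
rewrite /phi_DeltaV !E.
by have := same_law_expi tau 1 (-1) (x - y) 0 (Vs y); rewrite subrK add0r.
Qed.

(** The rotation of angle [pi] is [x |-> - x]. Together with the exchange of the two base points it
    makes [phi_DeltaV] even in [tau], which matters because [Delta_k] carries an absolute value and
    the phase does not. *)
Lemma phi_DeltaVN tau x : phi_DeltaV V tau (- x) = phi_DeltaV V tau x.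
Proof.
have E (X : R * R -> {RV P >-> R}) z1 z2 : (fun w => expi (tau * (X z1 w - X z2 w))) =
    (fun w => expi (tau * (1 * X z1 w + (-1) * X z2 w))).
  by apply/funext => w; rewrite mul1r mulN1r.
rewrite /phi_DeltaV !E.
have := same_law_expi tau 1 (-1) x 0 (Vi pi).
have rp z : rotate pi z = - z.
  by rewrite /rotate cospi sinpi !mulN1r !mul0r subr0 add0r; case: z.
by rewrite !rp oppr0.
Qed.

Lemma phi_DeltaV_oppt tau x : phi_DeltaV V (- tau) x = phi_DeltaV V tau x.
Proof.
rewrite -[RHS]phi_DeltaVN -[- x]add0r -phi_DeltaV_stationary.
by apply: eq_cintegral => w; congr expi; ring.
Qed.

Lemma cintegrable_bounded (Z : T -> R[i]) (M : R) : cmeasurable Z ->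
  (forall w, modulus (Z w) <= M) -> cintegrable P Z.
Proof.
move=> mZ ZM; apply: (cintegrable_le mZ ZM).
by apply: finite_measure_integrable_cst.
Qed.

Lemma cintegral_prob_cst (z : R[i]) : cintegral P (fun=> z) = z.
Proof.
by apply: complexP; rewrite /= /Rintegral integral_cst//= probability_setT mule1.
Qed.

Lemma modulus_cintegral_prob (Z : T -> R[i]) (M : R) : cmeasurable Z ->
  (forall w, modulus (Z w) <= M) -> modulus (cintegral P Z) <= M.
Proof.
move=> mZ ZM; have Zi := cintegrable_bounded mZ ZM.
apply: le_trans (modulus_cintegral Zi) _.
have -> : M = Rintegral P setT (fun=> M).
  by have /(congr1 (@Re R)) := cintegral_prob_cst M%:C.
apply: le_Rintegral => //; first exact: cintegrable_modulus.
by apply: finite_measure_integrable_cst.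
Qed.

Lemma cmeasurable_phase tau x : cmeasurable (fun w => expi (tau * V x w)).
Proof. by apply: cmeasurable_expi; apply: measurable_funM. Qed.

Lemma modulus_phi_V_oppt tau : modulus (phi_V V (- tau)) = modulus (phi_V V tau).
Proof.
rewrite -[RHS]modulusJ /phi_V -cintegralJ; last first.
  apply: (cintegrable_bounded (M := 1)); first exact: cmeasurable_phase.
  by move=> w; rewrite modulus_expi.
by congr modulus; apply: eq_cintegral => w; rewrite expiJ mulNr.
Qed.

End Law.

(** * Exchanging expectation and plane integrals *)

Section ProbabilityFubini.
Context {d} {T : measurableType d} {R : realType} (P : probability T R).
Variables (f : R * R -> T -> R[i]) (a : R * R -> R).
Hypotheses (mf : @cmeasurable _ (plane R * T)%type R (fun z => f z.1 z.2))
  (ia : rintegrable (leb2 R) a) (fa : forall x w, modulus (f x w) <= a x).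

Let i1 : rintegrable P (fun=> 1).
Proof. by apply: finite_measure_integrable_cst. Qed.

Let fa1 x w : modulus (f x w) <= a x * (fun=> 1) w.
Proof. by rewrite mulr1. Qed.

Lemma expectation_cintegral :
  cintegral P (fun w => cintegral (leb2 R) (f^~ w)) =
  cintegral (leb2 R) (fun x => cintegral P (f x)).
Proof. by rewrite (plane_prob_fubini mf ia i1 fa1). Qed.

Lemma cintegrable_expectation : cintegrable (leb2 R) (fun x => cintegral P (f x)).
Proof.
exact: (@cintegrable_fubini _ _ (plane R) T R (@sleb2 R) P (fun z => f z.1 z.2) a (fun=> 1)).
Qed.

Lemma cmeasurable_cintegral : cmeasurable (fun w => cintegral (leb2 R) (f^~ w)).
Proof.
apply: (@cintegrable_measurable _ T R P).
apply: (@cintegrable_fubini _ _ T (plane R) R P (@sleb2 R) (fun z => f z.2 z.1) (fun=> 1) a) => //.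
  apply: (@cmeasurable_comp _ _ (T * plane R)%type (plane R * T)%type R
    (fun z => f z.1 z.2) (fun z => (z.2, z.1)) _ mf).
  exact: measurable_fun_pair measurable_snd measurable_fst.
by move=> w x; rewrite mul1r.
Qed.

End ProbabilityFubini.

(** In [corr_swap] the numbers [a], [b], [e] are the weights at [x], [x + r] and [r]; one factor [a]
    is kept for integrability in [x]. *)
Lemma autocorrelation_bound {R : realType} (M a b e : R) : 0 <= a ->
  b ^+ 2 * a <= 4 * e -> M * b ^+ 2 * (M * a ^+ 2) <= 4 * M ^+ 2 * a * e.
Proof.
move=> a0 H.
rewrite (_ : M * b ^+ 2 * (M * a ^+ 2) = M ^+ 2 * (b ^+ 2 * a * a)); last by ring.
rewrite (_ : 4 * M ^+ 2 * a * e = M ^+ 2 * (4 * e * a)); last by ring.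
by rewrite ler_wpM2l ?sqr_ge0// ler_wpM2r.
Qed.

(** * First and second moments of the random integral *)

Section Moments.
Context d (T : measurableType d) (R : realType) (P : probability T R).
Variable V : R * R -> {RV P >-> R}.
Hypotheses (Vs : stationary V) (Vsm : smooth_field V).
Variables (tau s : R) (Theta : R * R -> R[i]).
Hypothesis sTheta : sch Theta.

Let th := fourier Theta.
Let sth : sch th. Proof. exact: sch_fourier. Qed.
Let m (x : R * R) (w : T) : R[i] := expi (tau * V (s *: x) w).
Let J (w : T) : R[i] := cintegral (leb2 R) (fun x => m x w * th x).

Let mm : @cmeasurable _ (plane R * T)%type R (fun z => m z.1 z.2).
Proof.
apply: cmeasurable_expi; apply: measurable_funM => //.
apply: (@measurable_plane_family R _ T (fun z => V (s *: z.1) z.2)).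
  by move=> w; apply: (continuous_dilate (u := fun x => V x w)); exact: (Vsm w [::]).1.
move=> x; have H : measurable_fun setT (V (s *: (x : R * R))) by [].
exact: H.
Qed.

Let m_section x : cmeasurable (m x).
Proof. exact: cmeasurable_phase. Qed.

Let modulus_m x w : modulus (m x w) = 1. Proof. exact: modulus_expi. Qed.

Let mth : pmeasurable th.
Proof. by apply: ccontinuous_pmeasurable; exact: sch_ccontinuous. Qed.

Let thi : cintegrable (leb2 R) th. Proof. exact: sch_integrable. Qed.

Let thm : rintegrable (leb2 R) (fun x => modulus (th x)).
Proof. exact: cintegrable_modulus. Qed.

Let joint_mth : @cmeasurable _ (plane R * T)%type R (fun z => m z.1 z.2 * th z.1).
Proof.
apply: cmeasurableM => //.
exact: (@cmeasurable_comp _ _ (plane R * T)%type (plane R) R th fst measurable_fst mth).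
Qed.

Let bound_mth x w : modulus (m x w * th x) <= modulus (th x).
Proof. by rewrite modulusM modulus_m mul1r. Qed.

Lemma cmeasurable_imaging : cmeasurable J.
Proof. exact: (cmeasurable_cintegral P (f := fun x w => m x w * th x) joint_mth thm bound_mth). Qed.

Let mJ := cmeasurable_imaging.

Lemma imaging_mean : cintegral P J = phi_V V tau * (((2 * pi) ^+ 2)%:C * Theta 0).
Proof.
rewrite /J (expectation_cintegral P (f := fun x w => m x w * th x) joint_mth thm bound_mth).
transitivity (cintegral (leb2 R) (fun x => phi_V V tau * th x)).
  apply: eq_plane_cintegral => x; rewrite cintegralZr.
    by rewrite phi_V_stationary.
  by apply: (@cintegrable_bounded _ _ _ P _ 1) => // w; rewrite modulus_m.
rewrite cintegralZ//; congr (_ * _); rewrite -fourier_inversion//.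
by apply: eq_plane_cintegral => x; rewrite /dot /= !mulr0 addr0 expi0 mul1r.
Qed.

Let B := Rintegral (leb2 R) setT (fun x => modulus (th x)).

Let th_section w : cintegrable (leb2 R) (fun x => m x w * th x).
Proof.
apply: (cintegrable_bounded_mul (M := 1)) => //; last by move=> x; rewrite modulus_m.
exact: (@cmeasurable_comp _ _ (plane R) (plane R * T)%type R _ (pair^~ w) _ mm).
Qed.

Lemma modulus_imaging w : modulus (J w) <= B.
Proof.
apply: le_trans (modulus_cintegral (th_section w)) _; apply: le_of_eq.
by apply: eq_Rintegral => x _; rewrite modulusM modulus_m mul1r.
Qed.

Let A r := cintegral (leb2 R) (fun x => th (x + r) * (th x)^*).

Lemma measurable_field : measurable_fun [set: plane R * T] (fun z => V z.1 z.2).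
Proof.
apply: (@measurable_plane_family R _ T (fun z => V z.1 z.2)).
  by move=> w; exact: (Vsm w [::]).1.
by move=> x; have H : measurable_fun setT (V x) by []; exact: H.
Qed.

(** Fubini applies to the integrand damped by a Gaussian in [r]; the reciprocal Gaussian
    [rgauss (-1)] then removes the damping. *)
Lemma phi_DeltaV_measurable : pmeasurable (phi_DeltaV V tau).
Proof.
pose f (r : R * R) w := (rgauss 1 r)%:C * expi (tau * (V r w - V 0 w)).
have mg (c : R) : pmeasurable (fun r => (rgauss c r)%:C).
  by apply: ccontinuous_pmeasurable; apply: ccontinuous_real; exact: continuous_rgauss.
have mf : @cmeasurable _ (plane R * T)%type R (fun z => f z.1 z.2).
  apply: cmeasurableM.
    exact: (@cmeasurable_comp _ _ (plane R * T)%type (plane R) R _ fst measurable_fst (mg 1)).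
  apply: cmeasurable_expi; apply: measurable_funM => //; apply: measurable_funB.
    exact: measurable_field.
  exact: (measurableT_comp (f := V 0)).
have fa r w : modulus (f r w) <= rgauss 1 r.
  by rewrite modulusM modulusR modulus_expi mulr1 ger0_norm// ltW// rgauss_gt0.
have Ei := cintegrable_expectation P mf (rintegrable_rgauss ltr01) fa.
have -> : phi_DeltaV V tau = fun r => (rgauss (-1) r)%:C * cintegral P (f r).
  apply/funext => r; rewrite /f cintegralZ; last first.
    apply: (@cintegrable_bounded _ _ _ P _ 1); last by move=> w; rewrite modulus_expi.
    by apply: cmeasurable_expi; apply: measurable_funM => //; apply: measurable_funB.
  rewrite mulrA -RCM -rgaussD addNr (_ : rgauss 0 r = 1) ?mul1r//.
  by rewrite /rgauss !mul0r oppr0 expR0.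
by apply: cmeasurableM => //; exact: cintegrable_measurable Ei.
Qed.

Lemma modulus_phi_DeltaV r : modulus (phi_DeltaV V tau r) <= 1.
Proof.
apply: modulus_cintegral_prob; last by move=> w; rewrite modulus_expi.
by apply: cmeasurable_expi; apply: measurable_funM => //; apply: measurable_funB.
Qed.

Let phis r := phi_DeltaV V tau (s *: r).

Let mphis : pmeasurable phis.
Proof.
have := @cmeasurable_comp _ _ (plane R) (plane R) R _ _ (measurable_plane_affine s 0) phi_DeltaV_measurable.
by under eq_fun do rewrite plane_affine0.
Qed.

Let corr_swap :
  cintegral (leb2 R) (fun x => cintegral (leb2 R) (fun r =>
    phi_DeltaV V tau (s *: r) * (th (x + r) * (th x)^*))) =
  cintegral (leb2 R) (fun r => phi_DeltaV V tau (s *: r) * A r).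
Proof.
have [M M0 hM] := sch_decay (sch_inv_weight sth).
have w0 (x : R * R) : 0 <= weight x by exact: ltW (weight_gt0 x).
have thM x : modulus (th x) <= M * weight x ^+ 2.
  have := hM x; rewrite modulusM modulusR ger0_norm ?invr_ge0//.
  by rewrite ler_pdivrMl ?weight_gt0//; congr (_ <= _); ring.
rewrite (@plane_fubini R (fun x r => phi_DeltaV V tau (s *: r) * (th (x + r) * (th x)^*))
  (fun x => 4 * M ^+ 2 * weight x) weight).
- apply: eq_plane_cintegral => r; rewrite cintegralZ//.
  have [N hN] := sch_bounded sth.
  apply: (cintegrable_bounded_mul (M := N)) => //; last exact: cintegrableJ.
  by have := pmeasurable_translate (- r) mth; under eq_fun do rewrite opprK.
- apply: cmeasurableM.
    exact: (@cmeasurable_comp _ _ (plane R * plane R)%type (plane R) R phis snd measurable_snd mphis).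
  apply: cmeasurableM; last first.
    apply: cmeasurableJ.
    exact: (@cmeasurable_comp _ _ (plane R * plane R)%type (plane R) R th fst measurable_fst mth).
  apply: (@cmeasurable_comp _ _ (plane R * plane R)%type (plane R) R th
    (fun z => (z.1.1 + z.2.1, z.1.2 + z.2.2)) _ mth).
  apply: measurable_fun_pair; apply: measurable_funD.
  + exact: (measurableT_comp measurable_fst measurable_fst).
  + exact: (measurableT_comp measurable_fst measurable_snd).
  + exact: (measurableT_comp measurable_snd measurable_fst).
  + exact: (measurableT_comp measurable_snd measurable_snd).
- by apply: rintegrableZ; exact: rintegrable_weight.
- exact: rintegrable_weight.
- move=> x r; rewrite !modulusM modulusJ -[leRHS]mul1r.
  apply: ler_pM; rewrite ?mulr_ge0 ?modulus_ge0 ?modulus_phi_DeltaV//.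
  apply: le_trans (ler_pM (modulus_ge0 _) (modulus_ge0 _) (thM (x + r)) (thM x)) _.
  (* Peetre's inequality, after dropping one factor [weight (x + r) <= 1]. *)
  have H : weight (x + r) ^+ 2 * weight x <= 4 * weight r.
    rewrite expr2 -mulrA; apply: le_trans (weight_peetre x r).
    by apply: ler_piMl; [exact: mulr_ge0|exact: weight_le1].
  exact: autocorrelation_bound.
Qed.

(** Opening [J] puts the field at two points [u] and [x] under one expectation; stationarity leaves
    their difference, and [u = x + r] recentres the integral. *)
Let inner x : cintegral P (fun w => J w * @conjc R (m x w * th x)) =
  cintegral (leb2 R) (fun r => phi_DeltaV V tau (s *: r) * (th (x + r) * (th x)^*)).
Proof.
transitivity (cintegral P (fun w => cintegral (leb2 R) (fun u => m u w * th u * @conjc R (m x w * th x)))).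
  by apply: eq_cintegral => w; rewrite cintegralZr.
rewrite (@expectation_cintegral _ T R P (fun u w => m u w * th u * @conjc R (m x w * th x))
  (fun u => modulus (th x) * modulus (th u))).
- have E u : cintegral P (fun w => m u w * th u * @conjc R (m x w * th x)) =
      phis (u - x) * (th u * (th x)^*).
    rewrite /phis scalerBr -phi_DeltaV_stationary// -cintegralZr; last first.
      apply: (@cintegrable_bounded _ _ _ P _ 1); last by move=> w; rewrite modulus_expi.
      by apply: cmeasurable_expi; apply: measurable_funM => //; apply: measurable_funB.
    apply: eq_cintegral => w; rewrite cJM /m expiJ mulrBr expiD.
    ring.
  under eq_plane_cintegral do rewrite E.
  rewrite (@cintegral_affine R 1 (oner_neq0 R) x (fun u => phis (u - x) * (th u * (th x)^*))).
    rewrite expr1n mul1r; apply: eq_plane_cintegral => r.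
    have -> : plane_affine 1 x r = x + r by rewrite /plane_affine !mul1r; case: (x); case: r.
    by rewrite /phis addrAC subrr add0r.
  apply: (cintegrable_bounded_mul (M := 1)).
  + exact: pmeasurable_translate mphis.
  + by move=> u; exact: modulus_phi_DeltaV.
  + have := cintegrableZ (th x)^* thi.
    by under eq_fun do rewrite mulrC.
- apply: cmeasurableM => //; apply: cmeasurableJ.
  apply: (@cmeasurable_comp _ _ (plane R * T)%type T R (fun w => m x w * th x) snd measurable_snd).
  by apply: cmeasurableM => //; exact: cmeasurable_cst.
- exact: rintegrableZ.
- by move=> u w; rewrite !modulusM modulusJ !modulusM !modulus_m !mul1r mulrC.
Qed.

(** The two integrals in [J] times its conjugate are opened one at a time: [J w] stays whole,
    bounded by [B], while the expectation enters the first one, and [inner] treats the second. *)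
Lemma imaging_second_moment :
  (Rintegral P setT (fun w => modulus (J w) ^+ 2))%:C =
  cintegral (leb2 R) (fun r => phi_DeltaV V tau (s *: r) * A r).
Proof.
rewrite -cintegral_real -corr_swap.
transitivity (cintegral P (fun w => cintegral (leb2 R) (fun x => J w * @conjc R (m x w * th x)))).
  apply: eq_cintegral => w; rewrite -mulcJ cintegralZ; last exact: cintegrableJ.
  by rewrite cintegralJ.
rewrite (@expectation_cintegral _ T R P (fun x w => J w * @conjc R (m x w * th x))
  (fun x => B * modulus (th x))).
- by apply: eq_plane_cintegral => x; exact: inner.
- apply: cmeasurableM; last exact: cmeasurableJ.
  exact: (@cmeasurable_comp _ _ (plane R * T)%type T R J snd measurable_snd mJ).
- exact: rintegrableZ.
- move=> x w; rewrite modulusM modulusJ ler_pM ?modulus_ge0 ?modulus_imaging//.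
Qed.

End Moments.

(** * The variance as an integral against [phi_DeltaV] *)

Section Variance.
Context d (T : measurableType d) (R : realType) (P : probability T R).

Lemma sch_intensity (f : R * R -> R[i]) : sch f -> sch (fun k => (modulus (f k) ^+ 2)%:C).
Proof.
move=> sf; apply: sch_ext (schM sf (schJ sf)) => x.
exact: mulcJ.
Qed.

(** Parseval by way of the multiplication formula: translating the transform is modulating [f], and
    by inversion the transform of the conjugate of [fourier f] is [(2 pi)^2] times the conjugate of
    [f]. *)
Lemma autocorrelation_fourier (f : R * R -> R[i]) r : sch f ->
  cintegral (leb2 R) (fun x => fourier f (x + r) * (fourier f x)^*) =
  ((2 * pi) ^+ 2)%:C * fourier (fun k => (modulus (f k) ^+ 2)%:C) r.
Proof.
move=> sf; have fi := sch_integrable sf; have sF := sch_fourier sf.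
pose h u := expi (- dot r u) * f u.
have hi : cintegrable (leb2 R) h by exact: cintegrable_waveM.
have gi : cintegrable (leb2 R) (fun x => (fourier f x)^*) by exact/cintegrableJ/sch_integrable.
have Eh x : fourier h x = fourier f (x + r).
  apply: eq_plane_cintegral => u; rewrite /h mulrA -expiD; congr (expi _ * _).
  by rewrite /dot /=; ring.
transitivity (cintegral (leb2 R) (fun k => expi (dot k 0) * ((fourier f k)^* * fourier h k))).
  apply: eq_plane_cintegral => k.
  by rewrite Eh (_ : expi (dot k 0) = 1) ?mul1r 1?mulrC// /dot /= !mulr0 addr0 expi0.
rewrite fourier_mul// -cintegralZ; last exact/cintegrable_waveM/sch_integrable/sch_intensity.
apply: eq_plane_cintegral => u; rewrite subr0 -mulcJ /h.
have -> : fourier (fun x => (fourier f x)^*) u = (((2 * pi) ^+ 2)%:C * f u)^*.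
  rewrite -fourier_inversion// -cintegralJ; last exact/cintegrable_wavel/sch_integrable.
  apply: eq_plane_cintegral => k; rewrite cJM expiJ dotC; ring.
rewrite cJM; have -> : @conjc R ((2 * pi) ^+ 2)%:C = ((2 * pi) ^+ 2)%:C.
  by apply: complexP; rewrite ?ReJ ?ImJ /= ?oppr0.
by ring.
Qed.

Lemma cvariance_scale (J : T -> R[i]) (z : R[i]) (c B : R) : cmeasurable J ->
  (forall w, modulus (J w) <= B) -> modulus z = 1 -> 0 <= c ->
  cvariance P (fun w => z * (c%:C * J w)) =
  c ^+ 2 * Rintegral P setT (fun w => modulus (J w) ^+ 2)
  - (c * modulus (cintegral P J)) ^+ 2.
Proof.
move=> mJ bJ z1 c0; have Ji := cintegrable_bounded P mJ bJ.
rewrite /cvariance; congr (_ - _).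
  have -> : (fun w => modulus (z * (c%:C * J w)) ^+ 2) = (fun w => c ^+ 2 * modulus (J w) ^+ 2).
    by apply/funext => w; rewrite !modulusM z1 mul1r modulusR exprMn ger0_norm.
  rewrite RintegralZl//.
  apply: (@rintegrable_le _ T R P _ (fun=> B ^+ 2)).
  - by apply: measurable_funX; exact: measurable_modulus.
  - move=> w; rewrite ger0_norm ?sqr_ge0// ler_pXn2r ?nnegrE ?modulus_ge0//.
    exact: le_trans (modulus_ge0 _) (bJ w).
  - by apply: finite_measure_integrable_cst.
rewrite cintegralZ; last exact: cintegrableZ.
by rewrite cintegralZ// !modulusM z1 mul1r modulusR ger0_norm.
Qed.

Variable V : R * R -> {RV P >-> R}.
Hypotheses (Vs : stationary V) (Vsm : smooth_field V).

Lemma imaging_variance (tau s : R) (Theta : R * R -> R[i]) (z : R[i]) : sch Theta ->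
  modulus z = 1 ->
  (cvariance P (fun w => z * (((2 * pi) ^- 2)%:C *
     cintegral (leb2 R) (fun x => expi (tau * V (s *: x) w) * fourier Theta x))))%:C =
  ((2 * pi) ^- 2)%:C * cintegral (leb2 R) (fun r => phi_DeltaV V tau (s *: r) *
     fourier (fun k => (modulus (Theta k) ^+ 2)%:C) r)
  - (modulus (phi_V V tau * Theta 0) ^+ 2)%:C.
Proof.
move=> sT z1; have M := imaging_mean Vs Vsm tau s sT.
have M2 := imaging_second_moment Vs Vsm tau s sT.
have p0 : 2 * pi != 0 :> R by rewrite mulf_neq0// gt_eqF// pi_gt0.
have c0 : 0 <= (2 * pi) ^- 2 :> R by rewrite invr_ge0 sqr_ge0.
rewrite (cvariance_scale (cmeasurable_imaging Vsm tau s sT) (modulus_imaging Vsm tau s sT) z1 c0).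
rewrite RCD RCN; congr (_ - _).
  rewrite RCM M2.
  (* Parseval contributes [(2 pi)^2], which reduces the squared normalisation [(2 pi)^-4] to the
     constant of [kappa]. *)
  under eq_plane_cintegral do rewrite (autocorrelation_fourier _ sT) mulrCA.
  rewrite cintegralZ; last first.
    apply: (cintegrable_bounded_mul (M := 1)).
    - have := @cmeasurable_comp _ _ (plane R) (plane R) R _ _ (measurable_plane_affine s 0) (phi_DeltaV_measurable Vsm tau).
      by under eq_fun do rewrite plane_affine0.
    - by move=> r; exact: modulus_phi_DeltaV.
    - exact/sch_integrable/sch_fourier/sch_intensity.
  by rewrite mulrA -RCM expr2 -mulrA mulVf ?mulr1// expf_neq0.
rewrite M !modulusM modulusR ger0_norm ?sqr_ge0//.
by congr ((_ ^+ 2)%:C); rewrite mulrCA; congr (_ * _); rewrite mulrA mulVf ?mul1r// expf_neq0.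
Qed.

End Variance.

(** * Covariances of bounded random variables *)

Section Covariance.
Context d (T : measurableType d) (R : realType) (P : probability T R).

Definition bounded_rv (U : T -> R) (M : R) :=
  measurable_fun setT U /\ forall w, `|U w| <= M.

Definition rcov (U W : T -> R) : R :=
  Rintegral P setT (fun w => U w * W w) - Rintegral P setT U * Rintegral P setT W.

Lemma bounded_rv_integrable U M : bounded_rv U M -> rintegrable P U.
Proof.
move=> [mU bU]; apply: (rintegrable_le mU bU).
by apply: finite_measure_integrable_cst.
Qed.

Lemma Rintegral_prob_bound U M : bounded_rv U M -> `|Rintegral P setT U| <= M.
Proof.
move=> bU; have [mU UM] := bU.
have := modulus_cintegral_prob P (Z := fun w => (U w)%:C) (M := M) (cmeasurable_real mU).
rewrite cintegral_real modulusR; apply => w; by rewrite modulusR.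
Qed.

Lemma bounded_rvM U W M N : bounded_rv U M -> bounded_rv W N ->
  bounded_rv (fun w => U w * W w) (M * N).
Proof.
move=> [mU UM] [mW WN]; split; first exact: measurable_funM.
by move=> w; rewrite normrM ler_pM.
Qed.

Lemma bounded_rvD U W M N : bounded_rv U M -> bounded_rv W N ->
  bounded_rv (fun w => U w + W w) (M + N).
Proof.
move=> [mU UM] [mW WN]; split; first exact: measurable_funD.
by move=> w; apply: le_trans (ler_normD _ _) (lerD _ _).
Qed.

Lemma bounded_rvZ c U M : bounded_rv U M -> bounded_rv (fun w => c * U w) (`|c| * M).
Proof.
move=> [mU UM]; split; first exact: measurable_funM.
by move=> w; rewrite normrM ler_wpM2l.
Qed.

Lemma rcovC U W : rcov U W = rcov W U.
Proof.
rewrite /rcov [X in _ - X]mulrC; congr (_ - _).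
by apply: eq_Rintegral => w _; rewrite mulrC.
Qed.

Lemma rcov_bound U W M N : bounded_rv U M -> bounded_rv W N -> `|rcov U W| <= 2 * (M * N).
Proof.
move=> bU bW; rewrite /rcov; apply: le_trans (ler_normB _ _) _.
rewrite [2 * _]mulr_natl mulr2n; apply: lerD.
  exact: Rintegral_prob_bound (bounded_rvM bU bW).
by rewrite normrM ler_pM// ?(Rintegral_prob_bound bU) ?(Rintegral_prob_bound bW).
Qed.

Lemma rcov_linear U U' W c M M' N : bounded_rv U M -> bounded_rv U' M' -> bounded_rv W N ->
  rcov (fun w => U w + c * U' w) W = rcov U W + c * rcov U' W.
Proof.
move=> bU bU' bW; rewrite /rcov.
have iU := bounded_rv_integrable bU; have iU' := bounded_rv_integrable (bounded_rvZ c bU').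
have iUW := bounded_rv_integrable (bounded_rvM bU bW).
have bUW' := bounded_rvM bU' bW; have iUW' := bounded_rv_integrable (bounded_rvZ c bUW').
have i1 := bounded_rv_integrable bUW'; have i2 := bounded_rv_integrable bU'.
have -> : (fun w => (U w + c * U' w) * W w) = (fun w => U w * W w + c * (U' w * W w)).
  by apply/funext => w; ring.
by rewrite !RintegralD// !RintegralZl//; ring.
Qed.

Lemma rcov_sum (U : nat -> T -> R) (c : nat -> R) W N (alpha : R) (n : nat) :
  (forall j, bounded_rv (U j) 1) -> bounded_rv W N ->
  (forall j, `|rcov (U j) W| <= alpha) ->
  `|rcov (fun w => \sum_(j < n) c j * U j w) W| <= (\sum_(j < n) `|c j|) * alpha.
Proof.
move=> bU bW UW.
have bS k : exists K, bounded_rv (fun w => \sum_(j < k) c j * U j w) K.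
  elim: k => [|k [K IH]].
    by exists 0; under eq_fun do rewrite big_ord0; split=> // w; rewrite normr0.
  exists (K + `|c k| * 1); under eq_fun do rewrite big_ord_recr /=.
  by apply: bounded_rvD => //; exact: bounded_rvZ.
elim: n => [|n IH].
  under eq_fun do rewrite big_ord0.
  have b0 : bounded_rv (fun=> 0) 0 by split=> // w; rewrite normr0.
  by rewrite big_ord0 mul0r; have := rcov_bound b0 bW; rewrite mul0r mulr0.
have [K bK] := bS n.
have -> : (fun w => \sum_(j < n.+1) c j * U j w) =
    (fun w => \sum_(j < n) c j * U j w + c n * U n w).
  by apply/funext => w; rewrite big_ord_recr.
rewrite (rcov_linear _ bK (bU n) bW) big_ord_recr /= mulrDl.
apply: le_trans (ler_normD _ _) (lerD IH _).
by rewrite normrM ler_wpM2l.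
Qed.

(** Replace one argument at a time. The error in [U] is paired with [W], bounded by 1, and costs
    [2 e]; the error in [W] is paired with [U'], bounded only by 2, and costs [4 e]. *)
Lemma rcov_approx (U U' W W' : T -> R) (e alpha : R) : 0 <= e -> e <= 1 ->
  bounded_rv U 1 -> bounded_rv W 1 ->
  measurable_fun setT U' -> measurable_fun setT W' ->
  (forall w, `|U w - U' w| <= e) -> (forall w, `|W w - W' w| <= e) ->
  `|rcov U' W'| <= alpha -> `|rcov U W| <= 6 * e + alpha.
Proof.
move=> e0 e1 bU bW mU' mW' eU eW a.
have bU' : bounded_rv U' 2.
  split=> // w; rewrite -[U' w](subKr (U w)); apply: le_trans (ler_normB _ _) _.
  by rewrite -[2]/(1 + 1)%R lerD//; [exact: bU.2|exact: le_trans (eU w) e1].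
have bW' : bounded_rv W' 2.
  split=> // w; rewrite -[W' w](subKr (W w)); apply: le_trans (ler_normB _ _) _.
  by rewrite -[2]/(1 + 1)%R lerD//; [exact: bW.2|exact: le_trans (eW w) e1].
have bDU : bounded_rv (fun w => U w - U' w) e by split=> //; apply: measurable_funB => //; exact: bU.1.
have bDW : bounded_rv (fun w => W w - W' w) e by split=> //; apply: measurable_funB => //; exact: bW.1.
have -> : rcov U W = rcov U' W' + 1 * rcov (fun w => W w - W' w) U' + 1 * rcov (fun w => U w - U' w) W.
  have -> : rcov U W = rcov U' W + 1 * rcov (fun w => U w - U' w) W.
    rewrite -(rcov_linear _ bU' bDU bW); congr rcov; apply/funext => w; ring.
  congr (_ + _); rewrite rcovC (rcovC U') -(rcov_linear _ bW' bDW bU').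
  by congr rcov; apply/funext => w; ring.
rewrite !mul1r; apply: le_trans (ler_normD _ _) _; apply: le_trans (lerD (ler_normD _ _) (lexx _)) _.
have := rcov_bound bDW bU'; have := rcov_bound bDU bW; lra.
Qed.

End Covariance.

(** * From mixing of events to decay of [phi_DeltaV] *)

Section Mixing.
Context {R : realType}.

(** For positive [N], an interval of length [1 / N] counted from [- M]; the form without division
    lets [Num.truncn] find the cell of a point. *)
Definition cell (N : nat) (M : R) (j : nat) : set R :=
  [set t | j%:R <= N%:R * (t + M) < j.+1%:R].

Lemma measurable_cell N M j : measurable (cell N M j).
Proof.
have mf : measurable_fun [set: R] (fun t : R => N%:R * (t + M)).
  by apply: measurable_funM => //; apply: measurable_funD.
have := mf measurableT `[j%:R, j.+1%:R[%classic (measurable_itv _); rewrite setTI.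
by congr measurable; apply/seteqP; split => t; rewrite /cell /= in_itv.
Qed.

Lemma step_approximation (g : R -> R) (L M e : R) : 0 < e -> 0 <= M ->
  (forall t u, `|g t - g u| <= L * `|t - u|) ->
  exists (N K : nat) (c : nat -> R), forall t, `|t| <= M ->
    `|g t - \sum_(j < K) c j * \1_(cell N M j) t| <= e.
Proof.
move=> e0 M0 gL.
have L0 : 0 <= L by have := le_trans (normr_ge0 _) (gL 1 0); rewrite subr0 normr1 mulr1.
(* [N] exceeds [L / e], so an [L]-Lipschitz function varies by at most [e] on a cell. *)
pose N := (Num.truncn (L / e)).+1; have N0 : 0 < N%:R :> R by rewrite ltr0n.
(* The successor includes the cell of the endpoint [t = M]; values are sampled at left ends of
   cells. *)
exists N, (Num.truncn (N%:R * (M + M))).+1, (fun j => g (j%:R / N%:R - M)) => t tM.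
have t0 : 0 <= N%:R * (t + M).
  by rewrite mulr_ge0 ?(ltW N0)//; move: tM; rewrite ler_norml; lra.
pose k := Num.truncn (N%:R * (t + M)).
have kK : (k < (Num.truncn (N%:R * (M + M))).+1)%N.
  rewrite ltnS /k truncn_le_nat; apply: (@le_lt_trans _ _ (N%:R * (M + M))).
    by rewrite ler_wpM2l ?(ltW N0)// lerD2r (le_trans (ler_norm _)).
  exact: truncnS_gt.
rewrite (bigD1 (Ordinal kK))//= big1 ?addr0; last first.
  move=> j jk; rewrite indicE memNset ?mulr0//.
  rewrite /cell /= -truncn_eq// -/k => /eqP E; move/negP: jk; apply.
  by apply/eqP/val_inj.
have /andP[k1 k2] := truncn_itv t0; rewrite -/k in k1 k2.
rewrite indicE mem_set ?mulr1; last by rewrite /cell /= k1 k2.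
apply: le_trans (gL _ _) _.
have -> : t - (k%:R / N%:R - M) = (N%:R * (t + M) - k%:R) / N%:R by field; rewrite gt_eqF.
rewrite normrM normfV [`|N%:R|]ger0_norm ?(ltW N0)// mulrA ler_pdivrMr//.
have : `|N%:R * (t + M) - k%:R| <= 1.
  by rewrite ger0_norm ?subr_ge0//; rewrite -natr1 in k2; lra.
move=> h; apply: le_trans (ler_wpM2l L0 h) _; rewrite mulr1 mulrC -ler_pdivrMr//.
exact: ltW (truncnS_gt _).
Qed.

End Mixing.

Lemma modulus_expiB {R : realType} (a b : R) : modulus (expi a - expi b) <= 2 * `|a - b|.
Proof.
have -> : expi a - expi b = expi b * (expi (a - b) - 1).
  by rewrite mulrBr mulr1 -expiD [b + _]addrC subrK.
by rewrite modulusM modulus_expi mul1r modulus_expiB1.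
Qed.

Section MixingField.
Context d (T : measurableType d) (R : realType) (P : probability T R).
Variable V : R * R -> {RV P >-> R}.
Hypotheses (Vs : stationary V) (Vb : bounded_field V) (Vm : rapidly_mixing V).

Lemma fine_prob_itv (E : set T) : measurable E -> 0 <= fine (P E) <= 1.
Proof.
move=> mE; have h := probability_le1 P mE; have h0 : (0 <= P E)%E by [].
by rewrite fine_ge0//= -lee_fin fineK// fin_num_measure.
Qed.

Lemma field_events_measurable (A : set (R * R)) E : field_events V A E -> measurable E.
Proof.
move: E; apply: smallest_sub.
  exact: sigma_algebra_measurable.
move=> _ [x [B [_ mB ->]]]; rewrite -[_ @^-1` _]setTI.
exact: (measurable_funP (V x)).
Qed.

(** [sup] dominates its set only if that set is bounded above; here 1 is a bound, as a probability
    and a product of two probabilities both lie in [[0, 1]]. *)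
Lemma mixing_coef_ge r (A B : set (R * R)) E F :
  (forall x y, A x -> B y -> r <= enorm (x - y)) ->
  field_events V A E -> field_events V B F ->
  `|fine (P (E `&` F)) - fine (P E) * fine (P F)| <= mixing_coef V r.
Proof.
move=> AB hE hF; apply: ub_le_sup; last by exists A, B, E, F.
exists 1 => _ [A' [B' [E' [F' [_ /field_events_measurable mE /field_events_measurable mF ->]]]]].
have /andP[a0 a1] := fine_prob_itv (measurableI _ _ mE mF).
have /andP[b0 b1] := fine_prob_itv mE; have /andP[c0 c1] := fine_prob_itv mF.
have : 0 <= fine (P E') * fine (P F') <= 1 by rewrite mulr_ge0// mulr_ile1.
by rewrite ler_norml; lra.
Qed.

Lemma Rintegral_prob_indic (E : set T) : measurable E -> Rintegral P setT (\1_E) = fine (P E).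
Proof. by move=> mE; rewrite /Rintegral integral_indic// setIT. Qed.

Lemma rcov_indic x (A B : set R) : measurable A -> measurable B ->
  `|rcov P (\1_(V x @^-1` A)) (\1_(V 0 @^-1` B))| <= mixing_coef V (enorm x).
Proof.
move=> mA mB.
have mE z (C : set R) : measurable C -> measurable (V z @^-1` C).
  by move=> mC; rewrite -[_ @^-1` _]setTI; exact: (measurable_funP (V z)).
rewrite /rcov !Rintegral_prob_indic ?mE//.
have -> : (fun w => \1_(V x @^-1` A) w * \1_(V 0 @^-1` B) w) =
   (\1_(V x @^-1` A `&` V 0 @^-1` B) : T -> R) by rewrite indicI.
rewrite Rintegral_prob_indic; last by apply: measurableI; exact: mE.
apply: (@mixing_coef_ge _ [set x] [set 0]).
- by move=> _ _ -> ->; rewrite subr0.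
- by apply: sub_sigma_algebra; exists x, A.
- by apply: sub_sigma_algebra; exists 0, B.
- exact: mE.
- exact: mE.
Qed.

(** Step functions reduce the covariance to indicators of cells, that is, to events at the two
    points [x] and 0. Boundedness of the field makes the sums finite, and [S], a product of sums of
    coefficients, depends on [e] but not on [x]. *)
Lemma rcov_decay (g h : R -> R) (L : R) :
  (forall t u, `|g t - g u| <= L * `|t - u|) -> (forall t u, `|h t - h u| <= L * `|t - u|) ->
  measurable_fun setT g -> measurable_fun setT h ->
  (forall t, `|g t| <= 1) -> (forall t, `|h t| <= 1) ->
  forall e, 0 < e -> exists2 S, 0 <= S & forall x,
    `|rcov P (fun w => g (V x w)) (fun w => h (V 0 w))| <= e + S * mixing_coef V (enorm x).
Proof.
move=> gL hL mg mh g1 h1 e e0.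
have [M0 hM0] := Vb; pose M := `|M0|.
have VM x w : `|V x w| <= M by apply: le_trans (hM0 x w) (ler_norm _).
(* Both requirements of [rcov_approx]: [e' <= 1] and [6 e' <= e]. *)
pose e' := Num.min 1 (e / 6).
have e'0 : 0 < e' by rewrite lt_min ltr01 divr_gt0.
have e'1 : e' <= 1 by rewrite ge_min lexx.
have e'e : 6 * e' <= e by rewrite mulrC -ler_pdivlMr// ge_min lexx orbT.
have [N1 [K1 [c1 a1]]] := step_approximation e'0 (normr_ge0 M0) gL.
have [N2 [K2 [c2 a2]]] := step_approximation e'0 (normr_ge0 M0) hL.
exists ((\sum_(j < K1) `|c1 j|) * (\sum_(j < K2) `|c2 j|)) => [|x].
  by rewrite mulr_ge0// sumr_ge0.
pose U j := (\1_(V x @^-1` (cell N1 M j)) : T -> R).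
pose W j := (\1_(V 0 @^-1` (cell N2 M j)) : T -> R).
have bI (E : set T) : measurable E -> bounded_rv (\1_E : T -> R) 1.
  by move=> mE; split=> [|w]; [exact: measurable_indic|rewrite indicE; case: (_ \in _); rewrite ?normr1 ?normr0].
have mE z N j : measurable (V z @^-1` cell N M j).
  by rewrite -[_ @^-1` _]setTI; exact: (measurable_funP (V z)) measurableT _ (measurable_cell _ _ _).
have bU j : bounded_rv (U j) 1 by exact: bI.
have bW j : bounded_rv (W j) 1 by exact: bI.
have mS K (c : nat -> R) (Z : nat -> T -> R) : (forall j, bounded_rv (Z j) 1) ->
    measurable_fun setT (fun w => \sum_(j < K) c j * Z j w).
  move=> bZ; apply: measurable_sum => j; apply: measurable_funM => //; exact: (bZ j).1.
apply: (@le_trans _ _ (6 * e' + (\sum_(j < K1) `|c1 j|) * ((\sum_(j < K2) `|c2 j|) * mixing_coef V (enorm x)))); last first.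
  by rewrite mulrA lerD2r.
have bSW : exists B, bounded_rv (fun w => \sum_(j < K2) c2 j * W j w) B.
  exists (1 + e'); split; first exact: mS.
  move=> w; set s := \sum_(j < K2) _; rewrite -[s](subKr (h (V 0 w))).
  apply: le_trans (ler_normB _ _) _; rewrite lerD//.
  exact: (a2 _ (VM 0 w)).
have [B bB] := bSW.
apply: (rcov_approx (U' := fun w => \sum_(j < K1) c1 j * U j w)
  (W' := fun w => \sum_(j < K2) c2 j * W j w)) => //.
- exact: ltW.
- by split=> [|w]; [exact: measurableT_comp|exact: g1].
- by split=> [|w]; [exact: measurableT_comp|exact: h1].
- exact: mS.
- exact: mS.
- by move=> w; exact: (a1 _ (VM x w)).
- by move=> w; exact: (a2 _ (VM 0 w)).
- apply: rcov_sum bB _ => // j; rewrite rcovC.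
  apply: rcov_sum (bU j) _ => // k; rewrite rcovC.
  by apply: rcov_indic; exact: measurable_cell.
Qed.

Lemma mixing_coef_decay : exists2 C, 0 <= C &
  forall r, 0 < r -> mixing_coef V r <= C / r.
Proof.
have [C hC] := Vm 1; exists `|C| => // r r0; rewrite ler_pdivlMr// mulrC.
by have := hC r r0; rewrite expr1 => /le_trans; apply; exact: ler_norm.
Qed.

(** By the addition formulas, the difference has real and imaginary parts that combine four
    covariances of cosines and sines of the field at [x] and at 0, each controlled by
    [rcov_decay]. *)
Lemma phi_DeltaV_decay tau e : 0 < e -> exists2 K, 0 < K & forall x, K <= enorm x ->
  modulus (phi_DeltaV V tau x - (modulus (phi_V V tau) ^+ 2)%:C) <= e.
Proof.
move=> e0.
have Lc t u : `|cos (tau * t) - cos (tau * u)| <= 2 * `|tau| * `|t - u|.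
  rewrite -mulrA -normrM mulrBr; apply: le_trans (modulus_expiB _ _).
  by apply: le_trans (Re_le_modulus _); rewrite ReD ReN.
have Ls t u : `|sin (tau * t) - sin (tau * u)| <= 2 * `|tau| * `|t - u|.
  rewrite -mulrA -normrM mulrBr; apply: le_trans (modulus_expiB _ _).
  by apply: le_trans (Im_le_modulus _); rewrite ImD ImN.
have mc : measurable_fun [set: R] (fun t => cos (tau * t)).
  by apply: (measurableT_comp (f := cos)) => //; apply: continuous_measurable_fun => x; exact: continuous_cos.
have ms : measurable_fun [set: R] (fun t => sin (tau * t)).
  by apply: (measurableT_comp (f := sin)) => //; apply: continuous_measurable_fun => x; exact: continuous_sin.
have c1 t : `|cos (tau * t)| <= 1 by rewrite ler_norml cos_geN1 cos_le1.
have s1 t : `|sin (tau * t)| <= 1 by rewrite ler_norml sin_geN1 sin_le1.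
(* Four approximation errors use up [e / 2]; the other half is left for the mixing coefficient. *)
have e8 : 0 < e / 8 by rewrite divr_gt0.
have [S1 S10 H1] := rcov_decay Lc Lc mc mc c1 c1 e8.
have [S2 S20 H2] := rcov_decay Ls Ls ms ms s1 s1 e8.
have [S3 S30 H3] := rcov_decay Ls Lc ms mc s1 c1 e8.
have [S4 S40 H4] := rcov_decay Lc Ls mc ms c1 s1 e8.
have [C C0 hC] := mixing_coef_decay.
pose S := S1 + S2 + S3 + S4.
have S0 : 0 <= S by rewrite !addr_ge0.
(* Chosen so that [S * C / enorm x <= e / 2]; the added 1 keeps the radius positive when
   [S * C = 0]. *)
exists (2 * (S * C + 1) / e) => [|x xK].
  by rewrite divr_gt0// mulr_gt0// ltr_wpDl// mulr_ge0.
have Kx : 0 < enorm x.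
  by apply: lt_le_trans xK; rewrite divr_gt0// mulr_gt0// ltr_wpDl// mulr_ge0.
pose cX w := cos (tau * V x w). pose sX w := sin (tau * V x w).
pose cY w := cos (tau * V 0 w). pose sY w := sin (tau * V 0 w).
have E : phi_DeltaV V tau x - (modulus (phi_V V tau) ^+ 2)%:C =
    (rcov P cX cY + rcov P sX sY) +i* (rcov P sX cY - rcov P cX sY).
  have EX : Rintegral P setT cX = Re (phi_V V tau) /\ Rintegral P setT sX = Im (phi_V V tau).
    by rewrite -(phi_V_stationary Vs tau x).
  have [Ec Es] := EX.
  have bv (f : R -> R) z : measurable_fun setT f -> (forall t, `|f t| <= 1) ->
      bounded_rv (fun w => f (V z w)) 1 by move=> mf f1; split => //; exact: measurableT_comp.
  rewrite modulus_sqr; apply: complexP; rewrite ?ReD ?ReN ?ImD ?ImN /=.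
  - rewrite /rcov Ec Es.
    have -> : Rintegral P setT (fun w => cos (tau * (V x w - V 0 w))) =
       Rintegral P setT (fun w => cX w * cY w) + Rintegral P setT (fun w => sX w * sY w).
      rewrite -RintegralD//; last first.
      + exact: bounded_rv_integrable (bounded_rvM (bv _ x ms s1) (bv _ 0 ms s1)).
      + exact: bounded_rv_integrable (bounded_rvM (bv _ x mc c1) (bv _ 0 mc c1)).
      by apply: eq_Rintegral => w _; rewrite mulrBr cosB.
    by rewrite /phi_V /= -/cY -/sY; ring.
  - rewrite /rcov Ec Es oppr0 addr0.
    have -> : Rintegral P setT (fun w => sin (tau * (V x w - V 0 w))) =
       Rintegral P setT (fun w => sX w * cY w) - Rintegral P setT (fun w => cX w * sY w).
      rewrite -RintegralB//; last first.
      + exact: bounded_rv_integrable (bounded_rvM (bv _ x mc c1) (bv _ 0 ms s1)).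
      + exact: bounded_rv_integrable (bounded_rvM (bv _ x ms s1) (bv _ 0 mc c1)).
      by apply: eq_Rintegral => w _; rewrite mulrBr sinB.
    by rewrite /phi_V /= -/cY -/sY; ring.
rewrite E; apply: le_trans (modulus_leD _) _ => /=.
apply: le_trans (lerD (ler_normD _ _) (ler_normB _ _)) _.
apply: le_trans (lerD (lerD (H1 x) (H2 x)) (lerD (H3 x) (H4 x))) _.
have : S * mixing_coef V (enorm x) <= e / 2.
  apply: le_trans (ler_wpM2l S0 (hC _ Kx)) _.
  rewrite mulrA ler_pdivrMr//; move: xK; rewrite ler_pdivrMr//.
  by move: (enorm x) => n; have := mulr_ge0 S0 C0; lra.
rewrite /S; lra.
Qed.

End MixingField.

(** * Dilated integrals *)

Section Scaling.
Context {R : realType}.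

Lemma enormZ (a : R) x : enorm (a *: x) = `|a| * enorm x.
Proof.
rewrite /enorm (_ : dot (a *: x) (a *: x) = a ^+ 2 * dot x x); last first.
  by rewrite /dot /= /GRing.scale /=; ring.
by rewrite sqrtrM ?sqr_ge0// sqrtr_sqr.
Qed.

Lemma enorm_gt0 (x : R * R) : x != 0 -> 0 < enorm x.
Proof.
rewrite lt_neqAle enorm_ge0 andbT eq_sym; apply: contra_neq => x0.
have c0 i : crd i x = 0.
  by apply/eqP; rewrite -normr_le0; apply: le_trans (crd_le_enorm i x) _; rewrite x0.
by rewrite [RHS]surjective_pairing; congr (_, _); apply: esym; [exact: (c0 ord0)|exact: (c0 ord_max)].
Qed.

Lemma leb2_origin : leb2 R [set 0] = 0%E.
Proof.
have -> : [set 0 : R * R] = [set (0 : R)] `*` [set (0 : R)].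
  by apply/seteqP; split => [x -> //|[a b] /= [-> ->]].
have := @product_measure1E _ _ (measurableTypeR R) (measurableTypeR R) R
  (@lebesgue_measure R) (@lebesgue_measure R) [set 0] [set 0]
  (measurable_set1 _) (measurable_set1 _).
move=> E; apply: (etrans E).
apply: etrans (congr2 (fun u v => u * v)%E (lebesgue_measure_set1 (0 : R)) (lebesgue_measure_set1 (0 : R))) _.
by rewrite mule0.
Qed.

(** Dilations fix the origin, so no convergence to [c] can be expected there; it is a null set, and
    elsewhere dominated convergence applies. *)
Lemma dilation_integral_cvg (phi F : R * R -> R[i]) (s_ : nat -> R) (c : R[i]) :
  pmeasurable phi -> (forall x, modulus (phi x) <= 1) -> cintegrable (leb2 R) F ->
  (forall r, r != 0 -> ccvg \oo (fun n => phi (s_ n *: r)) c) ->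
  ccvg \oo (fun n => cintegral (leb2 R) (fun r => phi (s_ n *: r) * F r))
    (c * cintegral (leb2 R) F).
Proof.
move=> mphi phi1 Fi phic; rewrite -cintegralZ//.
have mF := cintegrable_measurable Fi.
have [//|//||||_] := @cintegral_dominated _ (plane R) R (leb2 R)
  (fun n r => phi (s_ n *: r) * F r) (fun r => c * F r) (fun r => modulus (F r)).
- move=> n; apply: cmeasurableM => //.
  have := @cmeasurable_comp _ _ (plane R) (plane R) R _ _ (measurable_plane_affine (s_ n) 0) mphi.
  by under eq_fun do rewrite plane_affine0.
- by apply: cmeasurableM => //; exact: cmeasurable_cst.
- exists [set 0]; split; [|exact: leb2_origin|].
    have -> : [set 0 : R * R] = [set (0 : R)] `*` [set (0 : R)].
      by apply/seteqP; split => [x -> //|[a b] /= [-> ->]].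
    by apply: measurableX; exact: measurable_set1.
  move=> r /= h; apply: contrapT => r0; apply: h.
  by apply: ccvgM; [apply: phic; apply/eqP|exact: ccvg_cst].
- by move=> n r; rewrite modulusM ler_piMl ?modulus_ge0.
- exact: cintegrable_modulus.
- exact.
Qed.

Lemma critical_integral (eps : R) (phi F : R * R -> R[i]) :
  cintegral (leb2 R) (fun r => phi ((eps `^ (2^-1 - 2^-1))^-1 *: r) * F r) =
  cintegral (leb2 R) (fun r => phi r * F r).
Proof.
have E (r : R * R) : (eps `^ (2^-1 - 2^-1))^-1 *: r = r.
  by rewrite subrr powRr0 invr1 scale1r.
by apply: eq_plane_cintegral => r; rewrite E.
Qed.

End Scaling.

(** * The three regimes of the variance *)

Section Imaging.
Context (R : realType) (d : measure_display)
    (T : measurableType d) (P : probability T R) (V : R * R -> {RV P >-> R}).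
Variables (omega c0 c1 z_int z_obs : R) (Psi : R * R -> R[i]) (y : R * R).
Hypotheses (omega_gt0 : 0 < omega) (c0_gt0 : 0 < c0) (c1_gt0 : 0 < c1)
    (z_int_gt0 : 0 < z_int) (z_int_lt_obs : z_int < z_obs)
    (V_stationary : stationary V)
    (V_isotropic : isotropic V) (V_bounded : bounded_field V)
    (V_mixing : rapidly_mixing V) (V_smooth : smooth_field V)
    (V_second_derivatives : bounded_second_derivatives V)
    (sPsi : sch Psi).

Let Dk := Delta_k omega c0 c1.
Let intensity (k : R * R) : R := modulus (Psi (y + (c0 * z_int / omega) *: k)) ^+ 2.
Let Var gamma eps := cvariance P (I_mf V omega c0 c1 z_int z_obs Psi gamma eps y).
Let a0 := z_int * c0 / omega.

Lemma Delta_k_cases : omega * (c0^-1 - c1^-1) = Dk \/ omega * (c0^-1 - c1^-1) = - Dk.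
Proof.
rewrite /Dk /Delta_k; have [h|h] := leP 0 (c0^-1 - c1^-1).
  by left; rewrite ger0_norm.
by right; rewrite ltr0_norm// mulrN opprK.
Qed.

Lemma phi_DeltaV_Dk x : phi_DeltaV V (omega * (c0^-1 - c1^-1)) x = phi_DeltaV V Dk x.
Proof. by have [->|->] := Delta_k_cases => //; exact: phi_DeltaV_oppt. Qed.

Lemma modulus_phi_V_Dk : modulus (phi_V V (omega * (c0^-1 - c1^-1))) = modulus (phi_V V Dk).
Proof. by have [->|->] := Delta_k_cases => //; exact: modulus_phi_V_oppt. Qed.

Let shift_affine k : y + (c0 * z_int / omega) *: k = plane_affine a0 y k.
Proof. by rewrite /plane_affine /a0 [z_int * _]mulrC; case: k; case: (y). Qed.

Let a0n : a0 != 0. Proof. by rewrite gt_eqF// divr_gt0// mulr_gt0. Qed.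

Lemma sch_shifted_intensity : sch (fun k => (intensity k)%:C).
Proof.
apply: sch_ext (sch_intensity (sch_affine y a0n sPsi)) => k.
by rewrite /intensity shift_affine.
Qed.

Let profile_intensity k :
  modulus (image_profile omega c0 z_int Psi y k) ^+ 2 = intensity k.
Proof. by rewrite /image_profile modulusM modulus_chirp mul1r -/a0 /intensity shift_affine. Qed.

(** An exact identity for every [gamma] and [eps]. The regimes differ only in the behaviour of the
    dilated [phi_DeltaV]. *)
Lemma variance_formula gamma eps : (Var gamma eps)%:C =
  ((2 * pi) ^- 2)%:C * cintegral (leb2 R) (fun r =>
     phi_DeltaV V Dk ((eps `^ (gamma - 2^-1))^-1 *: r) * fourier (fun k => (intensity k)%:C) r)
  - (modulus (phi_V V Dk * Psi y) ^+ 2)%:C.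
Proof.
have [M hM] := V_second_derivatives.
pose tau := omega * (c0^-1 - c1^-1); pose s := (eps `^ (gamma - 2^-1))^-1.
have E : I_mf V omega c0 c1 z_int z_obs Psi gamma eps y = (fun w => chirp (- a0^-1) y *
   (((2 * pi) ^- 2)%:C * cintegral (leb2 R) (fun x => expi (tau * V (s *: x) w) *
      fourier (image_profile omega c0 z_int Psi y) x))).
  apply/funext => w.
  exact: (image_formula y omega_gt0 c0_gt0 c1_gt0 z_int_gt0 z_int_lt_obs sPsi tau s (V_smooth w) (fun i j x => hM i j x w)).
have sI := sch_image_profile y omega_gt0 c0_gt0 z_int_gt0 sPsi.
rewrite /Var E (imaging_variance V_stationary V_smooth tau s sI (modulus_chirp _ _)).
have -> : modulus (phi_V V tau * image_profile omega c0 z_int Psi y 0) = modulus (phi_V V Dk * Psi y).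
  rewrite !modulusM modulus_phi_V_Dk modulus_chirp mul1r; congr (_ * modulus (Psi _)).
  by rewrite -shift_affine scaler0 addr0.
have -> : (fun k => (modulus (image_profile omega c0 z_int Psi y k) ^+ 2)%:C) = (fun k => (intensity k)%:C).
  by apply/funext => k; rewrite profile_intensity.
by under eq_plane_cintegral do rewrite phi_DeltaV_Dk.
Qed.

Lemma variance_critical eps : (Var 2^-1 eps)%:C =
  kappa V Dk (fun k => (intensity k)%:C) - (modulus (phi_V V Dk * Psi y) ^+ 2)%:C.
Proof. by apply: (etrans (variance_formula 2^-1 eps)); rewrite critical_integral. Qed.

Lemma variance_critical_measure eps (mu : {finite_measure set (plane R) -> \bar R}) :
  represented_by (kappa V Dk) mu ->
  Var 2^-1 eps = Rintegral mu setT intensity - modulus (phi_V V Dk * Psi y) ^+ 2.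
Proof.
move=> kmu; have := variance_critical eps.
rewrite (kmu _ (sch_schwartz sch_shifted_intensity)) cintegral_real -RCN -RCD.
exact: (congr1 (@complex.Re R)).
Qed.

(** Shared by the two limits: [c] is 1 below the critical exponent and [|phi_V|^2] above it. The
    hypothesis is sequential and avoids [r = 0], as in [dilation_integral_cvg]. *)
Lemma variance_cvg gamma (c : R) :
  (forall eps : nat -> R, (forall n, 0 < eps n) -> eps n @[n --> \oo] --> (0 : R) ->
   forall r, r != 0 ->
   ccvg \oo (fun n => phi_DeltaV V Dk ((eps n `^ (gamma - 2^-1))^-1 *: r)) c%:C) ->
  Var gamma eps @[eps --> 0^'+] --> c * modulus (Psi y) ^+ 2 - modulus (phi_V V Dk * Psi y) ^+ 2.
Proof.
move=> H; apply/cvg_at_rightP => eps [e0 ec].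
have p0 : (2 * pi) ^+ 2 != 0 :> R by rewrite expf_neq0// mulf_neq0// gt_eqF// pi_gt0.
have sI := sch_shifted_intensity; have sF := sch_fourier sI.
have L := dilation_integral_cvg (phi_DeltaV_measurable V_smooth Dk)
  (modulus_phi_DeltaV V Dk) (sch_integrable sF) (H eps e0 ec).
(* Fourier inversion at the origin, where the shifted intensity is [|Psi y|^2]. *)
have I0 : cintegral (leb2 R) (fourier (fun k => (intensity k)%:C)) = ((2 * pi) ^+ 2 * modulus (Psi y) ^+ 2)%:C.
  transitivity (((2 * pi) ^+ 2)%:C * (intensity 0)%:C).
    rewrite -(fourier_inversion 0 sI); apply: eq_plane_cintegral => x.
    by rewrite /dot /= !mulr0 addr0 expi0 mul1r.
  by rewrite -RCM /intensity scaler0 addr0.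
have LE : ((2 * pi) ^- 2)%:C * (c%:C * cintegral (leb2 R) (fourier (fun k => (intensity k)%:C))) -
    (modulus (phi_V V Dk * Psi y) ^+ 2)%:C =
    (c * modulus (Psi y) ^+ 2 - modulus (phi_V V Dk * Psi y) ^+ 2)%:C.
  rewrite I0 -!RCM RCD RCN; congr (_%:C - _).
  by rewrite mulrCA [(_)^-1 * _]mulrA mulVf// mul1r.
have [+ _] := ccvgD (ccvgM (ccvg_cst ((2 * pi) ^- 2)%:C) L)
  (ccvg_cst (- (modulus (phi_V V Dk * Psi y) ^+ 2)%:C)).
rewrite LE; under eq_fun do rewrite -variance_formula.
exact.
Qed.

Lemma variance_coarse gamma : gamma < 2^-1 ->
  Var gamma eps @[eps --> 0^'+] --> modulus (Psi y) ^+ 2 * (1 - modulus (phi_V V Dk) ^+ 2).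
Proof.
move=> g; have -> : modulus (Psi y) ^+ 2 * (1 - modulus (phi_V V Dk) ^+ 2) =
    1 * modulus (Psi y) ^+ 2 - modulus (phi_V V Dk * Psi y) ^+ 2.
  by rewrite modulusM exprMn; ring.
apply: variance_cvg => eps e0 ec r _.
have p0 : 0 < 2^-1 - gamma by rewrite subr_gt0.
(* The dilation factor is [eps] to the positive power [1/2 - gamma]. *)
have sc : (eps n `^ (gamma - 2^-1))^-1 @[n --> \oo] --> (0 : R).
  under eq_fun do rewrite -powRN opprB.
  by have /cvg_at_rightP := powR_cvg0 p0; apply.
(* Writing 1 as an expectation allows dominated convergence over the samples, each of which is
   continuous at the origin. *)
rewrite /phi_DeltaV -(_ : cintegral P (fun=> 1) = 1%:C); last exact: cintegral_prob_cst.
have [//|//||||_] := @cintegral_dominated _ T R P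
  (fun n w => expi (Dk * (V ((eps n `^ (gamma - 2^-1))^-1 *: r) w - V 0 w)))
  (fun=> 1) (fun=> 1).
- by move=> n; apply: cmeasurable_expi; apply: measurable_funM => //; apply: measurable_funB.
- apply: aeW => w; have -> : 1 = expi (Dk * (V 0 w - V 0 w)) :> R[i] by rewrite subrr mulr0 expi0.
  apply: ccvg_expi.
  apply: cvgM; first exact: cvg_cst.
  apply: cvgB; last exact: cvg_cst.
  have Vc : continuous (fun x => V x w) by exact: (V_smooth w [::]).1.
  have xc : plane_affine ((eps n `^ (gamma - 2^-1))^-1) 0 r @[n --> \oo] -->
      (plane_affine 0 0 r : R * R) by exact: plane_affine_cvg.
  have E0 : plane_affine 0 0 r = 0 :> R * R by rewrite plane_affine0 scale0r.
  rewrite E0 in xc; under eq_fun do rewrite -plane_affine0.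
  exact: (cvg_comp _ _ xc (Vc 0)).
- by move=> n w; rewrite modulus_expi.
- by apply: finite_measure_integrable_cst.
- exact.
Qed.

Lemma variance_fine gamma : 2^-1 < gamma -> Var gamma eps @[eps --> 0^'+] --> (0 : R).
Proof.
move=> g; have Z : 0 = modulus (phi_V V Dk) ^+ 2 * modulus (Psi y) ^+ 2 -
    modulus (phi_V V Dk * Psi y) ^+ 2 :> R by rewrite modulusM exprMn subrr.
rewrite [X in _ --> X]Z.
apply: variance_cvg => eps e0 ec r r0.
have p0 : 0 < gamma - 2^-1 by rewrite subr_gt0.
have er := enorm_gt0 r0.
apply/ccvg_modulusP/cvgrPdist_le => e e_gt0.
have [K K0 hK] := phi_DeltaV_decay V_stationary V_bounded V_mixing Dk e_gt0.
have /cvg_at_rightP/(_ eps (conj e0 ec))/cvgrPdist_lt := powR_cvg0 p0.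
have q0 : 0 < enorm r / K by rewrite divr_gt0.
(* Once [eps] to the power [gamma - 1/2] is below [enorm r / K], the dilated point has norm at least
   [K], where the decay estimate holds. *)
move=> /(_ _ q0); apply: filterS => n; rewrite sub0r normrN ger0_norm ?powR_ge0// => h.
rewrite sub0r normrN ger0_norm ?modulus_ge0//; apply: hK.
have -> : enorm ((eps n `^ (gamma - 2^-1))^-1 *: r) = (eps n `^ (gamma - 2^-1))^-1 * enorm r.
  by rewrite enormZ ger0_norm// invr_ge0 powR_ge0.
rewrite mulrC ler_pdivlMr ?powR_gt0// mulrC -ler_pdivlMr//.
exact: ltW.
Qed.

End Imaging.

Theorem proposition3p2 (R : realType) (d : measure_display)
    (T : measurableType d) (P : probability T R) (V : R * R -> {RV P >-> R})
    (omega c0 c1 z_int z_obs : R) (Psi : R * R -> R[i])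
    (omega_gt0 : 0 < omega) (c0_gt0 : 0 < c0) (c1_gt0 : 0 < c1)
    (z_int_gt0 : 0 < z_int) (z_int_lt_obs : z_int < z_obs)
    (V_mean_zero : mean_zero V) (V_stationary : stationary V)
    (V_isotropic : isotropic V) (V_bounded : bounded_field V)
    (V_mixing : rapidly_mixing V) (V_smooth : smooth_field V)
    (V_second_derivatives : bounded_second_derivatives V)
    (Psi_schwartz : schwartz Psi) (y : R * R) :
  let Var_I_mf gamma eps :=
    cvariance P (I_mf V omega c0 c1 z_int z_obs Psi gamma eps y) in
  let Dk := Delta_k omega c0 c1 in
  let shifted_intensity (k : R * R) : R :=
    modulus (Psi (y + (c0 * z_int / omega) *: k)) ^+ 2 in
  [/\ (* kappa acting as a tempered distribution, and as a measure *)
      forall gamma eps : R, gamma = 2^-1 -> 0 < eps ->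
        (Var_I_mf gamma eps)%:C
          = kappa V Dk (fun k => (shifted_intensity k)%:C)
            - (modulus (phi_V V Dk * Psi y) ^+ 2)%:C
        /\
        forall mu : {finite_measure set (plane R) -> \bar R},
          represented_by (kappa V Dk) mu ->
          Var_I_mf gamma eps
            = Rintegral mu setT shifted_intensity
              - modulus (phi_V V Dk * Psi y) ^+ 2,
      forall gamma : R, gamma < 2^-1 ->
        Var_I_mf gamma eps @[eps --> 0^'+]
          --> modulus (Psi y) ^+ 2 * (1 - modulus (phi_V V Dk) ^+ 2)
    & forall gamma : R, 2^-1 < gamma ->
        Var_I_mf gamma eps @[eps --> 0^'+] --> (0 : R)].
Proof.
move=> Var_I_mf Dk shifted_intensity; have sPsi := schwartz_sch Psi_schwartz.
split.
- move=> gamma eps -> eps_gt0; split; first exact: variance_critical.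
  by move=> mu kmu; exact: variance_critical_measure.
- by move=> gamma; exact: variance_coarse.
- by move=> gamma; exact: variance_fine.
Qed.
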